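(* Let $T_B, T_F$ be algebraic tori, and let $B=X_{\Sigma_B}$ and $F=X_{\Sigma_F}$ be toric varieties with respect to $T_B$ and $T_F$, given by rational polyhedral fans $\Sigma_B$ in $N_B$ and $\Sigma_F$ in $N_F$. Then every toric variety bundle over $B$ with fiber $F$, i.e. every variety $E_{\Sigma_F}=(E\times X_{\Sigma_F})/T_F$ with $E\to X_{\Sigma_B}$ a $T_F$-principal bundle, can be equipped with the structure of a $T=T_B\times T_F$-toric variety given by a fan $\Sigma=\Sigma_B\ltimes_\Phi\Sigma_F$ for some cone-wise linear map $\Phi\colon|\Sigma_B|\to N_F$.
   Context: All varieties are over $\mathbb{C}$. $T_B\simeq(\mathbb{C}^* )^k$ and $T_F\simeq(\mathbb{C}^* )^n$ are algebraic tori with character lattices $M_B, M_F$ and cocharacter lattices $N_B=\mathrm{Hom}(M_B,\mathbb{Z})$, $N_F=\mathrm{Hom}(M_F,\mathbb{Z})$; $T=T_B\times T_F$ has cocharacter lattice $N=N_B\times N_F$. For a rational polyhedral fan $\Sigma$ in a lattice, $X_\Sigma$ denotes the corresponding toric variety; fans need not be smooth or complete, but it is assumed throughout that the rays of $\Sigma_B$, $\Sigma_F$, $\Sigma$ span the lattices $N_B$, $N_F$, $N$ respectively. Toric variety bundle: given a $T_F$-principal bundle $p\colon E\to B$ over an algebraic variety $B$ and a $T_F$-toric variety $X_{\Sigma_F}$, the associated toric variety bundle is $E_{\Sigma_F}=E\times_{T_F}X_{\Sigma_F}:=(E\times X_{\Sigma_F})/T_F$, with its natural projection to $B$, which is a fiber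 bundle with fiber $X_{\Sigma_F}$. Cone-wise linear map: $\Phi\colon|\Sigma_B|\to N_F$ denotes a continuous map from the support of $\Sigma_B$ to $(N_F)_{\mathbb{R}}=N_F\otimes\mathbb{R}$ whose restriction to every cone $\sigma\in\Sigma_B$ is linear and integral (it maps $\sigma\cap N_B$ into $N_F$). Twisted product: $\Sigma_B\ltimes_\Phi\Sigma_F$ is the fan in $N=N_B\times N_F$ with cones $\{\widetilde\sigma+\tau \mid \sigma\in\Sigma_B,\ \tau\in\Sigma_F\}$, where $\widetilde\sigma=\{(x,\Phi(x))\mid x\in\sigma\}$ is the graph of $\Phi|_\sigma$ and $\tau$ is regarded as the cone $\{0\}\times\tau$. *)

(* Defs.v *)
From HB Require Import structures.
From mathcomp Require Import all_boot all_order all_algebra.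
From mathcomp Require Import all_classical all_reals topology normedtype.
From mathcomp Require Import complex.
From mathcomp Require mpoly.
Import (canonicals) mpoly.

Set Implicit Arguments.
Unset Strict Implicit.
Unset Printing Implicit Defensive.
Import Order.TTheory GRing.Theory Num.Theory.
Import numFieldNormedType.Exports.
Local Open Scope classical_set_scope.
Local Open Scope ring_scope.
Local Open Scope complex_scope.

(** * Varieties as spaces with functions

    We use the classical language: a variety over an algebraically closed field
    is a topological space with a sheaf of K-valued functions that is locally
    an affine algebraic set.  [regfun U f] reads "U is open and the restriction
    of f to U is regular"; by [regfun_glue] it only depends on the values of f
    on U. *)

HB.mixin Record isFunSpace (K : fieldType) X & Topological X := {
  regfun : set X -> set (X -> K);
  regfun_open : forall U f, regfun U f -> open U;
  regfun_glue : forall U f,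
    (forall x, U x -> exists V g,
       [/\ V x, V `<=` U, regfun V g & forall y, V y -> f y = g y]) ->
    regfun U f;
  regfun_restr : forall U V f,
    open V -> V `<=` U -> regfun U f -> regfun V f;
  regfun_cst : forall U c, open U -> regfun U (fun=> c);
  regfunD : forall U f g,
    regfun U f -> regfun U g -> regfun U (fun x => f x + g x);
  regfunM : forall U f g,
    regfun U f -> regfun U g -> regfun U (fun x => f x * g x);
  regfunV : forall U f,
    regfun U f -> regfun (U `&` [set x | f x != 0]) (fun x => (f x)^-1)
}.

#[short(type="funSpaceType")]
HB.structure Definition FunSpace (K : fieldType) :=
  {X of Topological X & isFunSpace K X}.

(** The structure generated by partially defined functions: the sets
    V `&` {a != 0} with [gen V a] form a basis of open sets, and a function is
    regular if it is locally a quotient a / b with [gen V a] and [gen V b]. *)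
HB.factory Record isGeneratedFunSpace (K : fieldType) X & Choice X := {
  gen : set X -> set (X -> K);
  gen_cst : forall c, gen setT (fun=> c);
  genD : forall U V a b,
    gen U a -> gen V b -> gen (U `&` V) (fun x => a x + b x);
  genM : forall U V a b,
    gen U a -> gen V b -> gen (U `&` V) (fun x => a x * b x)
}.

HB.builders Context K X & isGeneratedFunSpace K X.

Definition gen_open (W : set X) := forall x, W x -> exists V a,
  [/\ gen V a, V x, a x != 0 & forall y, V y -> a y != 0 -> W y].

Definition gen_regfun (W : set X) (f : X -> K) := forall x, W x ->
  exists V a b, [/\ gen V a, gen V b, V x, b x != 0 &
    forall y, V y -> b y != 0 -> W y /\ f y = a y / b y].

Let gen_restr U V a b : gen U a -> gen V b -> gen (U `&` V) a.
Proof.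
move=> Ua Vb; have := genD Ua (genM Vb (gen_cst 0)); rewrite setIT.
by congr gen; apply/funext => x; rewrite mulr0 addr0.
Qed.

Let gen_openT : gen_open setT.
Proof. by move=> x _; exists setT, (fun=> 1); split=> //; [exact: gen_cst|exact: oner_neq0]. Qed.

Let gen_openI : setI_closed gen_open.
Proof.
move=> U V oU oV x [Ux Vx].
have [U' [a [Ua U'x ax aU]]] := oU x Ux.
have [V' [b [Vb V'x bx bV]]] := oV x Vx.
exists (U' `&` V'), (fun y => a y * b y); split=> //; first exact: genM.
  exact: mulf_neq0.
move=> y [U'y V'y]; rewrite mulf_eq0 negb_or => /andP[ay b_y].
by split; [exact: aU|exact: bV].
Qed.

Let gen_open_bigU (I : Type) (F : I -> set X) :
  (forall i, gen_open (F i)) -> gen_open (\bigcup_i F i).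
Proof.
move=> oF x [i _ Fx]; have [V [a [Va Vx ax aV]]] := oF i x Fx.
by exists V, a; split=> // y Vy ay; exists i => //; exact: aV.
Qed.

HB.instance Definition _ :=
  isOpenTopological.Build X gen_openT gen_openI gen_open_bigU.

Let openEgen (U : set X) : open U = gen_open U.
Proof. by []. Qed.

Let gen_regfun_open U f : gen_regfun U f -> open U.
Proof.
rewrite openEgen => rf x /rf[V [a [b [_ gb Vx bx abV]]]].
by exists V, b; split=> // y Vy b_y; have [] := abV y Vy b_y.
Qed.

Let gen_regfun_glue U f : (forall x, U x -> exists V g,
    [/\ V x, V `<=` U, gen_regfun V g & forall y, V y -> f y = g y]) ->
  gen_regfun U f.
Proof.
move=> H x /H[V [g [Vx VU rg fg]]].
have [W [a [b [ga gb Wx bx abW]]]] := rg x Vx.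
exists W, a, b; split=> // y Wy b_y; have [Vy gy] := abW y Wy b_y.
by split; [exact: VU|rewrite fg].
Qed.

Let gen_regfun_restr U V f :
  open V -> V `<=` U -> gen_regfun U f -> gen_regfun V f.
Proof.
rewrite openEgen => oV VU rf x Vx.
have [W [a [b [ga gb Wx bx abW]]]] := rf x (VU _ Vx).
have [W' [c [gc W'x cx cV]]] := oV x Vx.
exists (W `&` W'), (fun y => a y * c y), (fun y => b y * c y).
split=> //; [exact: genM|exact: genM|exact: mulf_neq0|].
move=> y [Wy W'y]; rewrite mulf_eq0 negb_or => /andP[b_y cy].
split; first exact: cV.
by rewrite (abW y Wy b_y).2 -mulf_div divff// mulr1.
Qed.

Let gen_regfun_cst U c : open U -> gen_regfun U (fun=> c).
Proof.
move=> oU; apply: gen_regfun_restr oU (@subsetT _ U) _ => x _.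
exists setT, (fun=> c), (fun=> 1).
split; [exact: gen_cst|exact: gen_cst|by []|exact: oner_neq0|].
by move=> y _ _; rewrite divr1.
Qed.

Let gen_regfunD U f g : gen_regfun U f -> gen_regfun U g ->
  gen_regfun U (fun x => f x + g x).
Proof.
move=> rf rg x Ux.
have [V [a [b [ga gb Vx bx abV]]]] := rf x Ux.
have [W [c [d [gc gd Wx dx cdW]]]] := rg x Ux.
exists (V `&` W), (fun y => a y * d y + c y * b y), (fun y => b y * d y).
split=> //.
- have := genD (genM ga gd) (genM gc gb).
  by congr gen; rewrite (setIC W) setIid.
- exact: genM.
- exact: mulf_neq0.
move=> y [Vy Wy]; rewrite mulf_eq0 negb_or => /andP[b_y dy].
have [Uy ->] := abV y Vy b_y; have [_ ->] := cdW y Wy dy.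
by split=> //; rewrite addf_div.
Qed.

Let gen_regfunM U f g : gen_regfun U f -> gen_regfun U g ->
  gen_regfun U (fun x => f x * g x).
Proof.
move=> rf rg x Ux.
have [V [a [b [ga gb Vx bx abV]]]] := rf x Ux.
have [W [c [d [gc gd Wx dx cdW]]]] := rg x Ux.
exists (V `&` W), (fun y => a y * c y), (fun y => b y * d y).
split=> //; [exact: genM|exact: genM|exact: mulf_neq0|].
move=> y [Vy Wy]; rewrite mulf_eq0 negb_or => /andP[b_y dy].
have [Uy ->] := abV y Vy b_y; have [_ ->] := cdW y Wy dy.
by split=> //; rewrite mulf_div.
Qed.

Let gen_regfunV U f : gen_regfun U f ->
  gen_regfun (U `&` [set x | f x != 0]) (fun x => (f x)^-1).
Proof.
move=> rf x [Ux /= fx].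
have [V [a [b [ga gb Vx bx abV]]]] := rf x Ux.
have ax : a x != 0.
  by move: fx; rewrite (abV x Vx bx).2 mulf_eq0 negb_or => /andP[].
exists V, (fun y => b y * b y), (fun y => a y * b y).
split=> //; [by have := genM gb gb; rewrite setIid|
  by have := genM ga gb; rewrite setIid|exact: mulf_neq0|].
move=> y Vy; rewrite mulf_eq0 negb_or => /andP[ay b_y].
have [Uy fy] := abV y Vy b_y; split.
  by split=> //=; rewrite fy mulf_neq0// invr_eq0.
by rewrite fy invf_div -mulf_div divff// mulr1.
Qed.

HB.instance Definition _ := isFunSpace.Build K X gen_regfun_open
  gen_regfun_glue gen_regfun_restr gen_regfun_cst gen_regfunD gen_regfunM
  gen_regfunV.

HB.end.

Section Morphisms.
Context {K : fieldType}.
Implicit Types X Y : funSpaceType K.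

(** f is a morphism on the open set U.  Since [regfun V g] forces V to be open
    and constants are regular, this includes continuity of f on U. *)
Definition morphism_on X Y (U : set X) (f : X -> Y) :=
  forall V g, regfun V g -> regfun (U `&` f @^-1` V) (g \o f : X -> K).

Definition morphism X Y (f : X -> Y) := morphism_on setT f.

Definition isomorphism X Y (f : X -> Y) :=
  morphism f /\ exists g : Y -> X, [/\ morphism g, cancel f g & cancel g f].

Definition open_immersion X Y (f : X -> Y) :=
  [/\ injective f, morphism f, (forall U, open U -> open (f @` U)) &
      forall U (g : Y -> K),
        open U -> regfun U (g \o f : X -> K) -> regfun (f @` U) g].

End Morphisms.

(** ** Products of varieties: the structure generated by the finite sums of
    f(x) g(y), with f and g regular on open sets U and V.  The topology is finer
    than the product topology, which is the reason for the new type. *)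

Definition vprod (K : fieldType) (X Y : funSpaceType K) : Type := (X * Y)%type.

Section Product.
Context {K : fieldType} (X Y : funSpaceType K).

Definition prod_gen (W : set (vprod X Y)) (h : vprod X Y -> K) :=
  exists (U : set X) (V : set Y) (r : nat)
    (f : 'I_r -> X -> K) (g : 'I_r -> Y -> K),
  [/\ W = U `*` V, (open U /\ open V),
      (forall i, regfun U (f i)), (forall i, regfun V (g i)) &
      h = fun u => \sum_(i < r) f i u.1 * g i u.2].

Let prod_gen_cst c : prod_gen setT (fun=> c).
Proof.
exists setT, setT, 1%N, (fun _ _ => c), (fun _ _ => 1); split.
- by rewrite setXTT.
- by split; exact: openT.
- by move=> _; apply: regfun_cst; exact: openT.
- by move=> _; apply: regfun_cst; exact: openT.
- by apply/funext => u; rewrite big_ord1 mulr1.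
Qed.

Let prod_genD U V a b : prod_gen U a -> prod_gen V b ->
  prod_gen (U `&` V) (fun x => a x + b x).
Proof.
move=> [A [B [r [f [g [-> [oA oB] rf rg ->]]]]]].
move=> [A' [B' [s [f' [g' [-> [oA' oB'] rf' rg' ->]]]]]].
have oAA := openI oA oA'; have oBB := openI oB oB'.
exists (A `&` A'), (B `&` B'), (r + s)%N,
  (fun i => match fintype.split i with inl j => f j | inr j => f' j end),
  (fun i => match fintype.split i with inl j => g j | inr j => g' j end).
split=> //; first by rewrite setXI.
- move=> i; case: (fintype.split i) => j; first exact: regfun_restr oAA (@subIsetl _ _ _) (rf j).
  exact: regfun_restr oAA (@subIsetr _ _ _) (rf' j).
- move=> i; case: (fintype.split i) => j; first exact: regfun_restr oBB (@subIsetl _ _ _) (rg j).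
  exact: regfun_restr oBB (@subIsetr _ _ _) (rg' j).
apply/funext => u; rewrite big_split_ord; congr (_ + _); apply: eq_bigr => i _.
  by rewrite (unsplitK (inl i)).
by rewrite (unsplitK (inr i)).
Qed.

Let prod_genM U V a b : prod_gen U a -> prod_gen V b ->
  prod_gen (U `&` V) (fun x => a x * b x).
Proof.
move=> [A [B [r [f [g [-> [oA oB] rf rg ->]]]]]].
move=> [A' [B' [s [f' [g' [-> [oA' oB'] rf' rg' ->]]]]]].
have oAA := openI oA oA'; have oBB := openI oB oB'.
exists (A `&` A'), (B `&` B'), #|{: 'I_r * 'I_s}|,
  (fun i x => f (enum_val i).1 x * f' (enum_val i).2 x),
  (fun i x => g (enum_val i).1 x * g' (enum_val i).2 x).
split=> //; first by rewrite setXI.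
- move=> i; apply: regfunM; first exact: regfun_restr oAA (@subIsetl _ _ _) (rf _).
  exact: regfun_restr oAA (@subIsetr _ _ _) (rf' _).
- move=> i; apply: regfunM; first exact: regfun_restr oBB (@subIsetl _ _ _) (rg _).
  exact: regfun_restr oBB (@subIsetr _ _ _) (rg' _).
apply/funext => u; rewrite big_distrlr/= pair_bigA/=.
rewrite (reindex (fun i : 'I_#|{: 'I_r * 'I_s}| => enum_val i))/=; last first.
  by exists enum_rank => i _; rewrite ?enum_valK ?enum_rankK.
by apply: eq_bigr => i _; rewrite mulrACA.
Qed.

HB.instance Definition _ := Choice.on (vprod X Y).
HB.instance Definition _ := isGeneratedFunSpace.Build K (vprod X Y)
  prod_gen_cst prod_genD prod_genM.

End Product.

Section Sum.
Context {K : fieldType} (I : choiceType) (X : I -> funSpaceType K).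

Definition sum_regfun (U : set {i & X i}) (f : {i & X i} -> K) :=
  forall i, regfun (existT X i @^-1` U) (f \o existT X i : X i -> K).

Let sum_open U f : sum_regfun U f -> open U.
Proof. by move=> rf; apply/sigT_openP => i; exact: regfun_open (rf i). Qed.

Let sum_glue U f : (forall x, U x -> exists V g,
    [/\ V x, V `<=` U, sum_regfun V g & forall y, V y -> f y = g y]) ->
  sum_regfun U f.
Proof.
move=> H i; apply: regfun_glue => x Ux.
have [V [g [Vx VU rg fg]]] := H _ Ux.
exists (existT X i @^-1` V), (g \o existT X i); split=> //.
- by move=> y; exact: VU.
- by move=> y; exact: fg.
Qed.

Let sum_restr U V f : open V -> V `<=` U -> sum_regfun U f -> sum_regfun V f.
Proof.
move=> /sigT_openP oV VU rf i; apply: regfun_restr (oV i) _ (rf i).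
by move=> y; exact: VU.
Qed.

Let sum_cst U c : open U -> sum_regfun U (fun=> c).
Proof. by move=> /sigT_openP oU i; exact: (@regfun_cst K (X i) _ c (oU i)). Qed.

Let sumD U f g : sum_regfun U f -> sum_regfun U g ->
  sum_regfun U (fun x => f x + g x).
Proof. by move=> rf rg i; exact: regfunD (rf i) (rg i). Qed.

Let sumM U f g : sum_regfun U f -> sum_regfun U g ->
  sum_regfun U (fun x => f x * g x).
Proof. by move=> rf rg i; exact: regfunM (rf i) (rg i). Qed.

Let sumV U f : sum_regfun U f ->
  sum_regfun (U `&` [set x | f x != 0]) (fun x => (f x)^-1).
Proof. by move=> rf i; exact: regfunV (rf i). Qed.

HB.instance Definition _ := isFunSpace.Build K {i & X i} sum_open sum_glue
  sum_restr sum_cst sumD sumM sumV.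

End Sum.

(** ** Quotients: the set of classes of the equivalence relation e, with the
    quotient topology; f is regular on U if its pull-back is regular on the
    preimage of U. *)

Definition quot (X : Type) (e : X -> X -> Prop) : Type :=
  {C : set X | exists x, C = e x}.

Definition to_quot (X : Type) (e : X -> X -> Prop) (x : X) : quot e :=
  exist _ (e x : set X) (ex_intro _ x erefl).

Definition of_quot (X : Type) (e : X -> X -> Prop) (C : quot e) : X :=
  projT1 (cid (proj2_sig C)).

Section Quotient.
Context {K : fieldType} (X : funSpaceType K) (e : X -> X -> Prop).

Definition quot_open (U : set (quot e)) := open (to_quot e @^-1` U).

Definition quot_regfun (U : set (quot e)) (f : quot e -> K) :=
  regfun (to_quot e @^-1` U) (f \o to_quot e : X -> K).

Let quot_openT : quot_open setT.
Proof. exact: openT. Qed.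

Let quot_openI : setI_closed quot_open.
Proof. by move=> U V; exact: openI. Qed.

Let quot_open_bigU (I : Type) (F : I -> set (quot e)) :
  (forall i, quot_open (F i)) -> quot_open (\bigcup_i F i).
Proof. by move=> oF; apply: bigcup_open => i _; exact: oF. Qed.

HB.instance Definition _ := gen_eqMixin (quot e).
HB.instance Definition _ := gen_choiceMixin (quot e).
HB.instance Definition _ :=
  isOpenTopological.Build (quot e) quot_openT quot_openI quot_open_bigU.

Let quot_regfun_open U f : quot_regfun U f -> open U.
Proof. by move=> /regfun_open. Qed.

Let quot_glue U f : (forall x, U x -> exists V g,
    [/\ V x, V `<=` U, quot_regfun V g & forall y, V y -> f y = g y]) ->
  quot_regfun U f.
Proof.
move=> H; apply: regfun_glue => x Ux.
have [V [g [Vx VU rg fg]]] := H _ Ux.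
exists (to_quot e @^-1` V), (g \o to_quot e); split=> //.
- by move=> y; exact: VU.
- by move=> y; exact: fg.
Qed.

Let quot_restr U V f : open V -> V `<=` U -> quot_regfun U f -> quot_regfun V f.
Proof. by move=> oV VU; apply: regfun_restr => // y; exact: VU. Qed.

Let quot_cst U c : open U -> quot_regfun U (fun=> c).
Proof. by move=> oU; exact: (@regfun_cst K X _ c oU). Qed.

Let quotD U f g : quot_regfun U f -> quot_regfun U g ->
  quot_regfun U (fun x => f x + g x).
Proof. by move=> rf rg; exact: regfunD rf rg. Qed.

Let quotM U f g : quot_regfun U f -> quot_regfun U g ->
  quot_regfun U (fun x => f x * g x).
Proof. by move=> rf rg; exact: regfunM rf rg. Qed.

Let quotV U f : quot_regfun U f ->
  quot_regfun (U `&` [set x | f x != 0]) (fun x => (f x)^-1).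
Proof. by move=> rf; exact: regfunV rf. Qed.

HB.instance Definition _ := isFunSpace.Build K (quot e) quot_regfun_open
  quot_glue quot_restr quot_cst quotD quotM quotV.

End Quotient.

Record algset (K : fieldType) (n : nat) (I : set (mpoly.mpoly n K)) := AlgSet {
  algset_pt :> 'rV[K]_n;
  algsetP : forall p, I p -> mpoly.meval (algset_pt 0) p = 0
}.

Section AlgSet.
Context {K : fieldType} (n : nat) (I : set (mpoly.mpoly n K)).

Definition algset_gen (V : set (algset I)) (a : algset I -> K) :=
  V = setT /\ exists p, a = fun x => mpoly.meval ((x : 'rV_n) 0) p.

Let algset_cst c : algset_gen setT (fun=> c).
Proof.
by split=> //; exists (mpoly.mpolyC n c); apply/funext => x; rewrite mpoly.mevalC.
Qed.

Let algsetD U V a b : algset_gen U a -> algset_gen V b ->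
  algset_gen (U `&` V) (fun x => a x + b x).
Proof.
move=> [-> [p ->]] [-> [q ->]]; split; first by rewrite setIT.
by exists (p + q); apply/funext => x; rewrite mpoly.mevalD.
Qed.

Let algsetM U V a b : algset_gen U a -> algset_gen V b ->
  algset_gen (U `&` V) (fun x => a x * b x).
Proof.
move=> [-> [p ->]] [-> [q ->]]; split; first by rewrite setIT.
by exists (p * q); apply/funext => x; rewrite mpoly.mevalM.
Qed.

HB.instance Definition _ := gen_eqMixin (algset I).
HB.instance Definition _ := gen_choiceMixin (algset I).
HB.instance Definition _ := isGeneratedFunSpace.Build K (algset I)
  algset_cst algsetD algsetM.

End AlgSet.

(** Finitely many affine charts, and separatedness. *)
Definition variety (K : fieldType) (X : funSpaceType K) :=
  (exists (r : nat) (n : 'I_r -> nat)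
     (I : forall i, set (mpoly.mpoly (n i) K)) (phi : forall i, algset (I i) -> X),
     (forall i, open_immersion (phi i)) /\ forall x, exists i z, phi i z = x) /\
  closed [set u : vprod X X | u.1 = u.2].

(** * Cones and fans in N_R = R^k, where N = Z^k *)

Section Fans.
Context {R : realType}.

Definition pairing k (m v : 'rV[R]_k) : R := \sum_(i < k) m 0 i * v 0 i.

Definition real_of k (v : 'rV[int]_k) : 'rV[R]_k := map_mx intr v.

(** Strongly convex rational polyhedral cones *)
Definition rational_cone k (s : set 'rV[R]_k) :=
  (exists (r : nat) (v : 'I_r -> 'rV[int]_k),
     s = [set x | exists2 c : 'I_r -> R, (forall i, 0 <= c i) &
                                         x = \sum_(i < r) c i *: real_of (v i)]) /\
  (forall x, s x -> s (- x) -> x = 0).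

Definition face k (t s : set 'rV[R]_k) :=
  exists2 m, (forall x, s x -> 0 <= pairing m x) &
             t = s `&` [set x | pairing m x = 0].

Definition fan k (S : set (set 'rV[R]_k)) :=
  [/\ finite_set S, S !=set0,
      (forall s, S s -> rational_cone s),
      (forall s t, S s -> face t s -> S t) &
      (forall s t, S s -> S t -> face (s `&` t) s /\ face (s `&` t) t)].

Definition support k (S : set (set 'rV[R]_k)) : set 'rV[R]_k :=
  \bigcup_(s in S) s.

Definition ray k (s : set 'rV[R]_k) :=
  exists2 v, v != 0 & s = [set x | exists2 a, 0 <= a & x = a *: v].

Definition rays_span k (S : set (set 'rV[R]_k)) :=
  forall x : 'rV[R]_k, exists (r : nat) (c : 'I_r -> R) (w : 'I_r -> 'rV[R]_k),
    (forall i, exists s, [/\ S s, ray s & s (w i)]) /\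
    x = \sum_(i < r) c i *: w i.

(** Only the values of Phi on the support of S matter. *)
Definition conewise_linear k n (S : set (set 'rV[R]_k))
    (Phi : 'rV[R]_k -> 'rV[R]_n) :=
  {within support S, continuous Phi} /\
  forall s, S s ->
    (exists A : 'M[R]_(k, n), forall x, s x -> Phi x = x *m A) /\
    (forall v : 'rV[int]_k, s (real_of v) ->
       exists w : 'rV[int]_n, Phi (real_of v) = real_of w).

Definition graph_cone k n (Phi : 'rV[R]_k -> 'rV[R]_n) (s : set 'rV[R]_k) :
    set 'rV[R]_(k + n) :=
  [set row_mx x (Phi x) | x in s].

Definition fiber_cone k n (t : set 'rV[R]_n) : set 'rV[R]_(k + n) :=
  [set row_mx 0 y | y in t].

Definition twisted_product k n (SB : set (set 'rV[R]_k))
    (Phi : 'rV[R]_k -> 'rV[R]_n) (SF : set (set 'rV[R]_n)) :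
    set (set 'rV[R]_(k + n)) :=
  [set [set x + y | x in graph_cone Phi s & y in fiber_cone t]
     | s in SB & t in SF].

(** S_s = s^dual `&` M, where M = Z^k *)
Definition dual_monoid k (s : set 'rV[R]_k) : set 'rV[int]_k :=
  [set m | forall x, s x -> 0 <= pairing (real_of m) x].

End Fans.

(** * Toric varieties over C = R[i]

    Points of the affine toric variety U_s = Spec C[S_s] are the monoid
    morphisms from S_s to C (under product), extended by zero to M so that equal
    points are equal functions. *)

Record aff_toric (R : realType) k (s : set 'rV[R]_k) := AffToric {
  aff_val :> 'rV[int]_k -> R[i];
  aff_val0 : aff_val 0 = 1;
  aff_valD : forall m m', dual_monoid s m -> dual_monoid s m' ->
    aff_val (m + m') = aff_val m * aff_val m';
  aff_val_out : forall m, ~ dual_monoid s m -> aff_val m = 0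
}.

Lemma dual_monoid0 (R : realType) k (s : set 'rV[R]_k) : dual_monoid s 0.
Proof.
by move=> x _; rewrite /pairing big1// => i _; rewrite !mxE mul0r.
Qed.

Lemma dual_monoidD (R : realType) k (s : set 'rV[R]_k) m m' :
  dual_monoid s m -> dual_monoid s m' -> dual_monoid s (m + m').
Proof.
move=> sm sm' x sx; have := addr_ge0 (sm x sx) (sm' x sx).
rewrite /pairing -big_split/=; congr (_ <= _); apply: eq_bigr => i _.
by rewrite !mxE intrD mulrDl.
Qed.

Section AffToric.
Context {R : realType} k (s : set 'rV[R]_k).

(** The elements of C[S_s], as functions on U_s *)
Definition aff_gen (V : set (aff_toric s)) (a : aff_toric s -> R[i]) :=
  V = setT /\ exists (r : nat) (c : 'I_r -> R[i]) (m : 'I_r -> 'rV[int]_k),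
    (forall i, dual_monoid s (m i)) /\ a = fun x => \sum_(i < r) c i * x (m i).

Let aff_cst c : aff_gen setT (fun=> c).
Proof.
split=> //; exists 1%N, (fun=> c), (fun=> 0); split.
  by move=> _; exact: dual_monoid0.
by apply/funext => x; rewrite big_ord1 aff_val0 mulr1.
Qed.

Let affD U V a b : aff_gen U a -> aff_gen V b ->
  aff_gen (U `&` V) (fun x => a x + b x).
Proof.
move=> [-> [r [c [m [sm ->]]]]] [-> [r' [c' [m' [sm' ->]]]]].
split; first by rewrite setIT.
exists (r + r')%N,
  (fun i => match fintype.split i with inl j => c j | inr j => c' j end),
  (fun i => match fintype.split i with inl j => m j | inr j => m' j end).
split; first by move=> i; case: (fintype.split i).
apply/funext => x; rewrite big_split_ord; congr (_ + _); apply: eq_bigr => i _.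
  by rewrite (unsplitK (inl i)).
by rewrite (unsplitK (inr i)).
Qed.

Let affM U V a b : aff_gen U a -> aff_gen V b ->
  aff_gen (U `&` V) (fun x => a x * b x).
Proof.
move=> [-> [r [c [m [sm ->]]]]] [-> [r' [c' [m' [sm' ->]]]]].
split; first by rewrite setIT.
exists #|{: 'I_r * 'I_r'}|,
  (fun i => c (enum_val i).1 * c' (enum_val i).2),
  (fun i => m (enum_val i).1 + m' (enum_val i).2).
split; first by move=> i; exact: dual_monoidD.
apply/funext => x; rewrite big_distrlr/= pair_bigA/=.
rewrite (reindex (fun i : 'I_#|{: 'I_r * 'I_r'}| => enum_val i))/=; last first.
  by exists enum_rank => i _; rewrite ?enum_valK ?enum_rankK.
by apply: eq_bigr => i _; rewrite mulrACA aff_valD.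
Qed.

HB.instance Definition _ := gen_eqMixin (aff_toric s).
HB.instance Definition _ := gen_choiceMixin (aff_toric s).
HB.instance Definition _ := isGeneratedFunSpace.Build R[i] (aff_toric s)
  aff_cst affD affM.

End AffToric.

(** The torus with character lattice M = Z^k, i.e. T = Hom(M, C^* ) = Spec C[M];
    this is U_s for s = {0}.  The value of t at m is the character t^m. *)
Definition torus (R : realType) k := aff_toric [set 0 : 'rV[R]_k].

Lemma dual_monoid_torus (R : realType) k m : dual_monoid [set 0 : 'rV[R]_k] m.
Proof.
by move=> x /= ->; rewrite /pairing big1// => i _; rewrite !mxE mulr0.
Qed.

Section TorusAction.
Context {R : realType} {k : nat}.

Fact torus_one_out (m : 'rV[int]_k) :
  ~ dual_monoid [set 0 : 'rV[R]_k] m -> 1 = 0 :> R[i].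
Proof. by case; exact: dual_monoid_torus. Qed.

Definition torus_one : torus R k :=
  AffToric (aff_val := fun=> 1) erefl
    (fun _ _ _ _ => esym (mulr1 1)) torus_one_out.

Section AffAct.
Variables (s : set 'rV[R]_k) (t : torus R k) (x : aff_toric s).

Fact aff_act0 : t 0 * x 0 = 1.
Proof. by rewrite !aff_val0 mulr1. Qed.

Fact aff_actD m m' : dual_monoid s m -> dual_monoid s m' ->
  t (m + m') * x (m + m') = (t m * x m) * (t m' * x m').
Proof.
move=> sm sm'; rewrite (aff_valD x sm sm') mulrACA; congr (_ * _).
by apply: aff_valD; exact: dual_monoid_torus.
Qed.

Fact aff_act_out m : ~ dual_monoid s m -> t m * x m = 0.
Proof. by move=> sm; rewrite (aff_val_out x sm) mulr0. Qed.

(** (t x)(m) = t^m x(m); for s = {0} this is the group law of the torus. *)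
Definition aff_act : aff_toric s :=
  AffToric (aff_val := fun m => t m * x m) aff_act0 aff_actD aff_act_out.

End AffAct.

Definition torus_mul (t u : torus R k) : torus R k := aff_act t u.

Definition regular_action (X : funSpaceType R[i]) (act : torus R k -> X -> X) :=
  [/\ forall x, act torus_one x = x,
      forall t u x, act (torus_mul t u) x = act t (act u x) &
      morphism (fun v : vprod (torus R k : funSpaceType R[i]) X => act v.1 v.2)].

End TorusAction.

(** X_S: the U_s, s in S, glued along U_(s `&` s'). *)
Section ToricVariety.
Context {R : realType} k (S : set (set 'rV[R]_k)).

Definition toric_charts : Type := {s : S & aff_toric (set_val s)}.

Definition glued (p q : toric_charts) :=
  exists z : aff_toric (set_val (projT1 p) `&` set_val (projT1 q)),
    (forall m, dual_monoid (set_val (projT1 p)) m -> projT2 p m = z m) /\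
    (forall m, dual_monoid (set_val (projT1 q)) m -> projT2 q m = z m).

Definition toric_variety : Type := quot glued.

(** Independent of the representative, as the gluing is equivariant *)
Definition toric_act (t : torus R k) (x : toric_variety) : toric_variety :=
  let p := of_quot x in to_quot glued (existT _ (projT1 p) (aff_act t (projT2 p))).

(** The T-variety X is the toric variety of the fan S. *)
Definition is_toric_variety (X : funSpaceType R[i]) (act : torus R k -> X -> X) :=
  regular_action act /\
  exists f : X -> toric_variety,
    isomorphism f /\ forall t x, f (act t x) = toric_act t (f x).

End ToricVariety.

Section Bundles.
Context {R : realType} {n : nat}.
Local Notation T := (torus R n : funSpaceType R[i]).

(** Zariski-locally trivial, with equivariant trivialisations
    theta : p^-1(U) -> U x T of inverse psi. *)
Definition principal_bundle (B E : funSpaceType R[i]) (p : E -> B)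
    (act : torus R n -> E -> E) :=
  [/\ variety E, regular_action act, morphism p,
      forall t x, p (act t x) = p x &
      forall b, exists (U : set B) (theta : E -> vprod B T) (psi : vprod B T -> E),
        [/\ (open U /\ U b),
            morphism_on (p @^-1` U) theta,
            morphism_on ([set u | U u.1] : set (vprod B T)) psi,
            (forall x, U (p x) -> (theta x).1 = p x /\ psi (theta x) = x) &
            (forall u t, U u -> p (psi (u, t)) = u /\ theta (psi (u, t)) = (u, t)) /\
            (forall t x, U (p x) ->
               (theta (act t x)).2 = torus_mul t (theta x).2)]].

(** E x_T X = (E x X) / T, for the diagonal action *)
Definition diag_orbit (E X : funSpaceType R[i]) (actE : torus R n -> E -> E)
    (actX : torus R n -> X -> X) (u v : vprod E X) :=
  exists t, v = (actE t u.1, actX t u.2).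

Definition assoc_bundle (E X : funSpaceType R[i]) (actE : torus R n -> E -> E)
    (actX : torus R n -> X -> X) : Type := quot (diag_orbit actE actX).

End Bundles.

(* Main.v *)
(**
Line bundles on an affine toric variety U_s are trivial. Over the torus this
holds because polynomial rings are factorial: a trivialization over the
complement of a hypersurface extends across its prime components one at a time.
Multiplied by a suitable character, the trivialization over the torus extends
without zeros or poles to the distinguished point of U_s; Newton polytopes and
limits along the generators of s show that it then extends to all of U_s.

Hence E has a section e_s over each chart U_s. A unit on the torus is a constant
times a character, so after rescaling e_s differs from a fixed section over the
torus by characters, i.e. by an integral linear map, whose negative is Phi on s.
On the overlap of two charts the quotient of the sections is a unit, so the two
linear maps agree on the common face. In the trivializations given by the e_s
the associated bundle is glued from the products U_s x U_t in the way in which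
the toric variety of the twisted product is glued from the charts of its cones.
*)

From HB Require Import structures.
Require Import Defs.
From mathcomp Require Import all_boot all_order all_algebra.
From mathcomp Require Import all_classical all_reals topology normedtype.
From mathcomp Require Import complex.
From mathcomp Require Import ring lra.
From mathcomp Require mpoly.
Import (canonicals, coercions) mpoly.
Import mpoly (Multinom, addmC, ltmc_le_add, mcoeff, mcoeff0, mcoeffB,
  mcoeffC, mcoeffD, mcoeffMX, mcoeffX, mcoeffZ, mcoeff_eq0, mcoeff_msupp,
  memN_msupp_eq0, meval, meval0, meval1, mevalB, mevalC, mevalD, mevalM,
  mevalX, mevalZ, mnm0, mnm0E, mnm1, mnm1E, mnmDE, mnmE, mnmP, mnm_add,
  mnm_muln, mnmwiden_ordmax, mnmwiden_widen, mpoly, mpolyC, mpolyC0, mpolyCM,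
  mpolyP, mpolyX, mpolyX0, mpolyXD, mpolyXn, mpolyind, msupp, msupp0, msupp1,
  msuppD_le, msuppM_le, msuppX, msuppZ, msupp_eq0, msupp_uniq, mul_mpolyC,
  mulm0n, mulmS, mulmnE, multinom, muni, muniC, muniE, mwiden, mwidenC,
  mwidenX).

Set Implicit Arguments.
Unset Strict Implicit.
Unset Printing Implicit Defensive.
Import Order.TTheory GRing.Theory Num.Theory.
Import numFieldNormedType.Exports.
Local Open Scope classical_set_scope.
Local Open Scope ring_scope.
Local Open Scope complex_scope.

(** * Factorial rings and Gauss's lemma *)

(** Over the torus factoriality lets a trivialization cross one prime at a time. This fails on U_s,
    which need not be factorial: a divisor on the boundary need not be principal, so local
    triviality has to be used there. It is used at the distinguished point, where it determines the
    correcting character. The chart around that point, the nonvanishing locus of some [ho], is not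
    invariant under the torus, so the trivialization cannot simply be translated to the rest of U_s.
    The substitute is that [ho] has a term of weight zero in the direction of every generator v_i,
    hence a general limit point in each direction v_i lies in that chart. This controls the
    exponents of the trivialization along all generators, and the exponents decide whether a Laurent
    polynomial is regular on U_s. A principal bundle is treated as n line bundles, one for each
    coordinate of the fibre torus. The sign of Phi comes from duality: the sections differ by m' ->
    m' M on characters, and the cones of the twisted product must have as dual monoid the pairs (m,
    m') with m - m' M in S_s and m' in S_t. *)

Section Factorial.
Variable R : idomainType.
Implicit Types a b p u : R.

Definition divides a b := exists c, b = a * c.

Definition prime_elt p :=
  [/\ p != 0, p \isn't a GRing.unit &
      forall a b, divides p (a * b) -> divides p a \/ divides p b].

(** The factors are prime rather than merely irreducible, so uniqueness of the factorization is
    built in. *)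
Definition prime_factorization a := exists u (s : seq R),
  [/\ u \is a GRing.unit, forall p, p \in s -> prime_elt p &
      a = u * \prod_(p <- s) p].

Definition factorial_ring := forall a, a != 0 -> prime_factorization a.

Lemma forall_in_cons (T : eqType) (Q : T -> Prop) x (s : seq T) :
  (forall y, y \in x :: s -> Q y) -> Q x /\ forall y, y \in s -> Q y.
Proof.
by move=> H; split=> [|y ys]; apply: H; rewrite inE ?eqxx ?ys ?orbT.
Qed.

Lemma divides_mull a b c : divides a b -> divides a (c * b).
Proof. by move=> [d ->]; exists (c * d); rewrite mulrCA. Qed.

Lemma divides_mulr a b c : divides a b -> divides a (b * c).
Proof. by rewrite mulrC; exact: divides_mull. Qed.

Lemma divides_trans a b c : divides a b -> divides b c -> divides a c.
Proof. by move=> [d ->] [e ->]; exists (d * e); rewrite mulrA. Qed.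

Lemma prime_unit p u : prime_elt p -> u \is a GRing.unit -> ~ divides p u.
Proof. by move=> [_ /negP pU _] uU [c uE]; move: uU; rewrite uE unitrM => /andP[]. Qed.

Lemma prime_dvd_prime p q : prime_elt p -> prime_elt q -> divides p q ->
  divides q p.
Proof.
move=> pP [q0 qU qP] [w qE].
have [|//|[v wE]] := qP p w; first by exists 1; rewrite mulr1.
exfalso; case: pP => _ /negP + _; apply.
have : p * v = 1.
  by apply: (mulfI q0); rewrite mulr1 {2}qE wE mulrCA.
by move/(congr1 (fun x => x \is a GRing.unit)); rewrite unitr1 unitrM => /andP[].
Qed.

End Factorial.

(** * Transport of factoriality along ring isomorphisms *)

Section FactorialIso.
Variables (A B : idomainType) (f : {rmorphism A -> B}) (g : {rmorphism B -> A}).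
Hypotheses (fK : cancel f g) (gK : cancel g f).

Lemma divides_iso a b : divides a b <-> divides (f a) (f b).
Proof.
split=> -[c E]; first by exists (f c); rewrite E rmorphM.
by exists (g c); rewrite -(fK b) E rmorphM fK.
Qed.

Lemma unit_iso a : (f a \is a GRing.unit) = (a \is a GRing.unit).
Proof.
apply/idP/idP => [fU|/(rmorph_unit f)//].
by rewrite -(fK a); exact: rmorph_unit.
Qed.

Lemma prime_iso a : prime_elt a <-> prime_elt (f a).
Proof.
have f0 x : (f x == 0) = (x == 0) by rewrite -(rmorph0 f) (can_eq fK).
split=> -[a0 aU aP].
  split; rewrite ?f0 ?unit_iso// => b c.
  by rewrite -(gK b) -(gK c) -rmorphM -!divides_iso; exact: aP.
split; rewrite -?f0 -?unit_iso// => b c.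
by rewrite !divides_iso rmorphM; exact: aP.
Qed.

Lemma factorial_iso : factorial_ring B -> factorial_ring A.
Proof.
move=> fB a a0; have [|u [s [uU sP aE]]] := fB (f a).
  by rewrite -(rmorph0 f) (can_eq fK).
exists (g u), (map g s); split.
- by rewrite -unit_iso gK.
- by move=> p /mapP[q /sP qP ->]; apply/prime_iso; rewrite gK.
- by rewrite big_map -rmorph_prod -rmorphM -aE fK.
Qed.

End FactorialIso.

(** * Polynomials over a factorial ring *)

Section Gauss.
Variable R : idomainType.
Hypothesis fR : factorial_ring R.
Implicit Types (f g h : {poly R}) (p c : R).

Lemma divides_polyC p f : divides p%:P f <-> forall i, divides p f`_i.
Proof.
split=> [[g ->] i|H]; first by exists g`_i; rewrite coefCM.
have [g gE] := choice H; exists (\poly_(i < size f) g i); apply/polyP => i.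
rewrite coefCM coef_poly; case: ltnP => fi; first exact: gE.
by rewrite mulr0 nth_default.
Qed.

Lemma min_coef_ndivides p f : ~ divides p%:P f -> exists i,
  ~ divides p f`_i /\ forall j, (j < i)%N -> divides p f`_j.
Proof.
move=> pf; have ex : exists i, `[< ~ divides p f`_i >].
  apply: contrapT => H; apply/pf/divides_polyC => i.
  by apply: contrapT => pfi; apply: H; exists i; apply/asboolP.
case: (ex_minnP ex) => i /asboolP pfi imin; exists i; split=> // j ji.
apply: contrapT => pfj; move: (imin j); rewrite leqNgt ji => H.
by have := H (asboolT pfj).
Qed.

Lemma divides_sum p (I : Type) (r : seq I) (P : pred I) (F : I -> R) :
  (forall i, P i -> divides p (F i)) -> divides p (\sum_(i <- r | P i) F i).
Proof.
move=> pF; apply: (big_ind (divides p)) => //.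
  by exists 0; rewrite mulr0.
by move=> _ _ [a ->] [b ->]; exists (a + b); rewrite mulrDr.
Qed.

Lemma divides_addl p a b : divides p (a + b) -> divides p b -> divides p a.
Proof.
by move=> [c abE] [d bE]; exists (c - d); rewrite mulrBr -abE -bE addrK.
Qed.

(** If [p] divides neither factor, let [i] and [j] be the lowest positions of coefficients that it
    does not divide; then it does not divide coefficient [i + j] of the product. *)
Lemma prime_polyC p : prime_elt p -> prime_elt p%:P.
Proof.
move=> pP; have [p0 pU pM] := pP; split.
- by rewrite polyC_eq0.
- by rewrite poly_unitE coefC eqxx negb_and pU orbT.
move=> f g pfg.
have [|pf] := pselect (divides p%:P f); first by left.
have [|pg] := pselect (divides p%:P g); first by right.
have [i [pfi ltfi]] := min_coef_ndivides pf.
have [j [pgj ltgj]] := min_coef_ndivides pg.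
exfalso; have /divides_polyC/(_ (i + j)%N) := pfg.
have ij : (i < (i + j).+1)%N by rewrite ltnS leq_addr.
(* Every other term of this coefficient has an index below [i] in [f] or below [j] in [g]. *)
rewrite coefM (bigD1 (Ordinal ij))//= addKn => /divides_addl H.
suff /H/pM[] : divides p (\sum_(l < (i + j).+1 | l != Ordinal ij) f`_l * g`_(i + j - l)) by [].
apply: divides_sum => l li.
have [lti|] := ltnP l i; first exact/divides_mulr/ltfi.
rewrite leq_eqVlt => /orP[/eqP il|il].
  by case/eqP: li; apply: val_inj.
apply/divides_mull/ltgj.
by rewrite ltn_subLR ?ltn_add2r// -ltnS.
Qed.

Definition primitive f := forall p, prime_elt p -> ~ divides p%:P f.

(** The prime factors of the constant remain prime in [{poly R}], so each of them cancels against
    [g] or against [h]. *)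
Lemma mul_seq_polyC (u : R) (s : seq R) g h f :
  u \is a GRing.unit -> (forall p, p \in s -> prime_elt p) ->
  (u * \prod_(p <- s) p)%:P * f = g * h ->
  exists g' h' v w, [/\ f = g' * h', g = v%:P * g', h = w%:P * h', v != 0 & w != 0].
Proof.
move=> uU; elim: s g h => [|p s IHs] g h sP.
  rewrite big_nil mulr1 => fE; exists (u^-1%:P * g), h, u, 1; split.
  - by rewrite -mulrA -fE mulrA -polyCM mulVr// mul1r.
  - by rewrite mulrA -polyCM divrr// mul1r.
  - by rewrite mul1r.
  - by apply: contraTneq uU => ->; rewrite unitr0.
  - exact: oner_neq0.
have [pP {}sP] := forall_in_cons sP.
have [p0 _ _] := pP; have pC0 : p%:P != 0 :> {poly R} by rewrite polyC_eq0.
rewrite big_cons mulrCA polyCM -mulrA => E.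
have [_ _ /(_ g h)[|[g' gE]|[h' hE]]] := prime_polyC pP.
- by rewrite -E; eexists.
- have [|g'' [h'' [v [w [fE g'E h'E v0 w0]]]]] := IHs g' h sP.
    by apply: (mulfI pC0); rewrite E gE mulrA.
  by exists g'', h'', (p * v), w; split; rewrite ?mulf_neq0// gE g'E polyCM mulrA.
- have [|g'' [h'' [v [w [fE g'E h'E v0 w0]]]]] := IHs g h' sP.
    by apply: (mulfI pC0); rewrite E hE mulrCA.
  by exists g'', h'', v, (p * w); split; rewrite ?mulf_neq0// hE h'E polyCM mulrA.
Qed.

(** Gauss's lemma: a factorization over the fraction field can be rescaled to
    one over R. *)
Lemma mul_polyC_split c g h f : c != 0 -> c%:P * f = g * h ->
  exists g' h' v w, [/\ f = g' * h', g = v%:P * g', h = w%:P * h', v != 0 & w != 0].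
Proof.
by move=> c0 E; have [u [s [uU sP cE]]] := fR c0;
  apply: (mul_seq_polyC uU sP); rewrite -cE.
Qed.

(** No prime factor of [c] divides the primitive [f], so all of them cancel against [h]. *)
Lemma primitive_cancel c f g h : primitive f -> c != 0 ->
  c%:P * g = f * h -> divides f g.
Proof.
move=> fP c0; have [u [s [uU sP ->]]] := fR c0 => {c c0}.
elim: s h sP => [|p s IHs] h sP.
  rewrite big_nil mulr1 => E; exists (u^-1%:P * h).
  by rewrite mulrCA -E mulrA -polyCM mulVr// mul1r.
have [pP {}sP] := forall_in_cons sP.
have [p0 _ _] := pP; have pC0 : p%:P != 0 :> {poly R} by rewrite polyC_eq0.
rewrite big_cons mulrCA polyCM -mulrA => E.
have [_ _ /(_ f h)[|/(fP p pP)//|[h' hE]]] := prime_polyC pP.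
  by rewrite -E; eexists.
by apply: (IHs h' sP); apply: (mulfI pC0); rewrite E hE mulrCA.
Qed.

Lemma primitive_part f : f != 0 ->
  exists c f', [/\ c != 0, f = c%:P * f' & primitive f'].
Proof.
move=> f0; have lf0 : lead_coef f != 0 by rewrite lead_coef_eq0.
have [u [s [uU sP lfE]]] := fR lf0.
(* A prime dividing all coefficients divides the leading one. [t] lists the prime factors of the
   leading coefficient still to be tried, [d] is the product of those found not to divide [g]. *)
suff H (t : seq R) g d : (forall p, p \in t -> prime_elt p) -> g != 0 ->
    (forall p, prime_elt p -> divides p%:P g -> ~ divides p d) ->
    lead_coef g = u * (d * \prod_(p <- t) p) ->
    exists c f', [/\ c != 0, g = c%:P * f' & primitive f'].
  apply: (H s f 1) => //; last by rewrite mul1r.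
  by move=> p pP _; apply: prime_unit => //; exact: unitr1.
elim: t g d => [|q t IHt] g d tP g0 dP lgE.
  exists 1, g; split; rewrite ?mul1r ?oner_neq0// => p pP pg.
  have : divides p (u * d).
    by rewrite big_nil mulr1 in lgE; rewrite -lgE; move/divides_polyC: pg; apply.
  have [_ _ pM] := pP => /pM[]; last exact: dP.
  exact: prime_unit.
have [qP {}tP] := forall_in_cons tP.
have [q0 qU qM] := qP.
have [[g' gE]|qg] := pselect (divides q%:P g).
  have g'0 : g' != 0 by apply: contraNneq g0 => g'0; rewrite gE g'0 mulr0.
  have [|||c [f' [c0 g'E f'P]]] := IHt g' d tP.
  - by [].
  - by move=> p pP [h hE]; apply: (dP p pP); exists (q%:P * h); rewrite gE hE mulrCA.
  - apply: (mulfI q0); move: lgE; rewrite gE lead_coefM lead_coefC => ->.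
    by rewrite big_cons; rewrite !(mulrCA q).
  - exists (q * c), f'; split=> //; first exact: mulf_neq0.
    by rewrite gE g'E polyCM mulrA.
apply: (IHt g (d * q)) => //; last by rewrite lgE big_cons !mulrA.
move=> p pP pg; have [_ _ pM] := pP; move=> /pM[]; first exact: dP.
move=> /(prime_dvd_prime pP qP)[w pE]; apply: qg.
apply: divides_trans pg; exists w%:P; by rewrite pE polyCM.
Qed.

(** Pseudo-divisibility is divisibility over the fraction field. *)
Lemma dvdp_divides f g : f %| g <-> exists2 c, c != 0 & divides f (c%:P * g).
Proof.
split=> [/Pdiv.Idomain.dvdpP[[c h] /= c0 E]|[c c0 [h E]]].
  by exists c => //; exists h; rewrite mul_polyC E mulrC.
by rewrite -(Pdiv.Idomain.dvdpZr _ _ c0) -mul_polyC E Pdiv.Idomain.dvdp_mulr.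
Qed.

Lemma primitive_dvdp f g : primitive f -> f %| g -> divides f g.
Proof. by move=> fP /dvdp_divides[c c0 [h]]; exact: primitive_cancel. Qed.

Lemma primitive_irreducible_prime f : primitive f -> (1 < size f)%N ->
  (forall g h, f = g * h -> (size g <= 1)%N \/ (size h <= 1)%N) -> prime_elt f.
Proof.
move=> fP f1 irrf; have f0 : f != 0 by rewrite -size_poly_gt0 ltnW.
split=> //.
  by rewrite poly_unitE; apply: contraTN f1 => /andP[/eqP->].
move=> g h [k ghE].
have [fg|nfg] := boolP (f %| g); first by left; exact: primitive_dvdp.
right; apply: primitive_dvdp => //.
have cfg : Pdiv.Idomain.coprimep f g.
  rewrite Pdiv.Idomain.coprimep_def.
  have /dvdp_divides[c c0 [e E]] := Pdiv.Idomain.dvdp_gcdl f g.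
  have dg := Pdiv.Idomain.dvdp_gcdr f g; move: E dg; set d := gcdp _ _ => E dg.
  (* The gcd divides [f] over the fraction field only; Gauss's lemma turns it into a factor [d'] of
     [f] of the same degree. If the cofactor [e'] were constant, [f] would divide [g]. *)
  have [d' [e' [v [w [fE dE eE v0 w0]]]]] := mul_polyC_split c0 E.
  have sd : size d = size d' by rewrite dE mul_polyC size_scale.
  have d0 : d != 0 by rewrite Pdiv.Idomain.gcdp_eq0 negb_and f0.
  rewrite eqn_leq size_poly_gt0 d0 andbT sd.
  have [//|e'1] := irrf _ _ fE; exfalso; case/negP: nfg.
  have e'0 : e' != 0 by apply: contraNneq f0 => e'0; rewrite fE e'0 mulr0.
  have [z z0 e'E] : exists2 z, z != 0 & e' = z%:P.
    exists e'`_0; last exact: size1_polyC.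
    by rewrite -polyC_eq0 -size1_polyC.
  rewrite fE e'E mulrC mul_polyC Pdiv.Idomain.dvdpZl//.
  by rewrite -(Pdiv.Idomain.dvdpZl _ _ v0) -mul_polyC -dE.
rewrite -(Pdiv.Idomain.Gauss_dvdpr h cfg).
by apply/dvdp_divides; exists 1; [exact: oner_neq0|exists k; rewrite mul1r].
Qed.

(** Induction on the degree: the content factors in [R], and the primitive part either splits into
    two factors of smaller degree or is prime. *)
Lemma factorial_poly : factorial_ring {poly R}.
Proof.
have fC c : c != 0 -> prime_factorization c%:P.
  move=> c0; have [u [s [uU sP ->]]] := fR c0.
  exists u%:P, (map polyC s); split.
  - have u0 : u != 0 by apply: contraTneq uU => ->; rewrite unitr0.
    by rewrite poly_unitE size_polyC coefC/= uU andbT u0.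
  - by move=> p /mapP[q /sP qP ->]; exact: prime_polyC.
  - by rewrite big_map polyCM rmorph_prod.
have fM (f g : {poly R}) :
    prime_factorization f -> prime_factorization g -> prime_factorization (f * g).
  move=> [u [s [uU sP ->]]] [v [t [vU tP ->]]]; exists (u * v), (s ++ t); split.
  - by rewrite unitrM uU.
  - by move=> p; rewrite mem_cat => /orP[/sP|/tP].
  - by rewrite big_cat/= mulrACA.
move=> f; have [m] := ubnP (size f); elim: m f => // m IHm f sf f0.
have [c [f' [c0 fE f'P]]] := primitive_part f0.
have f'0 : f' != 0 by apply: contraNneq f0 => f'0; rewrite fE f'0 mulr0.
have sf' : size f = size f' by rewrite fE mul_polyC size_scale.
rewrite fE; apply: (fM); first exact: fC.
have [f1|f1] := leqP (size f') 1.
  rewrite (size1_polyC f1); apply: (fC).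
  by rewrite -polyC_eq0 -size1_polyC.
have [[g [h [f'E g1 h1]]]|irr] := pselect (exists g h,
    [/\ f' = g * h, (1 < size g)%N & (1 < size h)%N]).
  have g0 : g != 0 by rewrite -size_poly_gt0 ltnW.
  have h0 : h != 0 by rewrite -size_poly_gt0 ltnW.
  have sgh : (size f').+1 = (size g + size h)%N.
    by rewrite f'E size_mul// prednK// addn_gt0 ltnW.
  move: sf; rewrite sf' ltnS => sf.
  rewrite f'E; apply: (fM); apply: (IHm) => //.
    by apply: leq_trans sf; rewrite -ltnS sgh -(addn2 (size g)) leq_add2l.
  by apply: leq_trans sf; rewrite -ltnS sgh -(add2n (size h)) leq_add2r.
exists 1, [:: f']; split; rewrite ?unitr1 ?big_seq1 ?mul1r//.
move=> p; rewrite inE => /eqP ->; apply: primitive_irreducible_prime => // g h gh.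
case: (leqP (size g) 1) => g1; first by left.
by case: (leqP (size h) 1) => h1; [right|case: irr; exists g, h].
Qed.

End Gauss.

(** * Polynomial rings over an algebraically closed field *)

Section Nullstellensatz.
Variables (C : closedFieldType) (R : idomainType) (X : Type).

Definition separating (ev : X -> R -> C) :=
  forall a, a != 0 -> exists x, ev x a != 0.

(** The Nullstellensatz for principal primes: what vanishes on V(p) is a multiple of [p]. *)
Definition prime_null (ev : X -> R -> C) := forall p h, prime_elt p ->
  ~ divides p h -> exists x, ev x p = 0 /\ ev x h != 0.

End Nullstellensatz.

(** * The Nullstellensatz for principal primes when one variable is added *)

Section NullstellensatzPoly.
Variables (C : closedFieldType) (R : idomainType) (X : Type).
Variable ev : X -> {rmorphism R -> C}.
Hypothesis fR : factorial_ring R.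
Hypothesis sep : separating ev.
Hypothesis nullR : prime_null ev.

Definition ev_poly (xz : X * C) (f : {poly R}) : C := (map_poly (ev xz.1) f).[xz.2].

Lemma ev_polyM xz f g : ev_poly xz (f * g) = ev_poly xz f * ev_poly xz g.
Proof. by rewrite /ev_poly rmorphM hornerM. Qed.

Lemma ev_polyD xz f g : ev_poly xz (f + g) = ev_poly xz f + ev_poly xz g.
Proof. by rewrite /ev_poly rmorphD hornerD. Qed.

Lemma ev_polyC xz c : ev_poly xz c%:P = ev xz.1 c.
Proof. by rewrite /ev_poly map_polyC hornerC. Qed.

Lemma ev_poly_neq0 x (f : {poly R}) i : ev x f`_i != 0 -> exists z, ev_poly (x, z) f != 0.
Proof.
move=> fx; have /closed_nonrootP[z] : map_poly (ev x) f != 0.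
  by apply: contraNneq fx => f0; rewrite -coef_map f0 coef0.
by rewrite rootE => fz; exists z.
Qed.

Lemma separating_poly : separating ev_poly.
Proof.
move=> f; rewrite -lead_coef_eq0 => /sep[x] /ev_poly_neq0[z fz].
by exists (x, z).
Qed.

Lemma prime_primitive (f : {poly R}) : (1 < size f)%N -> prime_elt f -> primitive f.
Proof.
move=> f1 [f0 _ fM] p pP [g fE]; have [p0 _ _] := pP.
have sg : size f = size g by rewrite fE mul_polyC size_scale.
have [|[h pE]|[h gE]] := fM p%:P g.
- by exists 1; rewrite mulr1.
- have h0 : h != 0 by apply: contraNneq p0 => h0; rewrite -polyC_eq0 pE h0 mulr0.
  have := size_polyC p; rewrite pE size_mul// p0 => sE.
  move: f1; rewrite ltnNge; case/negP.
  have := size_poly_gt0 h; rewrite h0 => h1.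
  by move: sE h1; case: (size h) => // m; rewrite addnS/=; case: (size f) => [|[|]].
- apply: (prime_unit pP (unitr1 R)).
  have : p%:P * h = 1.
    by apply: (mulfI f0); rewrite mulr1 mulrCA -gE -fE.
  move=> /(congr1 (fun q : {poly R} => q`_0)); rewrite coefCM coef1 => E.
  by exists h`_0; rewrite E.
Qed.

(** A prime of degree 0 is handled in [R], on a coefficient of [h] that it does not divide. A prime
    [f] of positive degree is coprime to [h] over the fraction field, so a combination of [f] and
    [h] is a nonzero constant [r]; at a zero of [f] over a point where [r] does not vanish, [h]
    cannot vanish. *)
Lemma prime_null_poly : prime_null ev_poly.
Proof.
move=> f h fP nfh; have [f0 fU fM] := fP.
have [f1|f1] := leqP (size f) 1.
  have fE := size1_polyC f1; move: (f`_0) fE => c fE; subst f.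
  have cP : prime_elt c.
    split; first by rewrite -polyC_eq0.
      apply: contra fU => cU; rewrite poly_unitE size_polyC coefC/= cU andbT.
      by move: f0; rewrite polyC_eq0 => ->.
    move=> a b [d abE]; have [|/divides_polyC/(_ 0%N)|/divides_polyC/(_ 0%N)] := fM a%:P b%:P.
    - by exists d%:P; rewrite -!polyCM abE.
    - by rewrite coefC/=; left.
    - by rewrite coefC/=; right.
  have [i nci] : exists i, ~ divides c h`_i.
    apply: contrapT => H; apply/nfh/divides_polyC => i; apply: contrapT => ?.
    by apply: H; exists i.
  have [x [cx hx]] := nullR cP nci; have [z hz] := ev_poly_neq0 hx.
  by exists (x, z); rewrite ev_polyC.
have fprim := prime_primitive f1 fP.
have ndfh : ~~ (f %| h) by apply/negP => /(primitive_dvdp fR fprim).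
have : Pdiv.Idomain.coprimep f h.
  rewrite Pdiv.Idomain.coprimep_def.
  have := Pdiv.Idomain.dvdp_gcdr f h.
  have /dvdp_divides[c c0 [e E]] := Pdiv.Idomain.dvdp_gcdl f h.
  move: E; set d := gcdp _ _ => E dh.
  have d0 : d != 0 by rewrite Pdiv.Idomain.gcdp_eq0 negb_and f0.
  have [|[w dE]|[w eE]] := fM d e; first by exists c%:P; rewrite -E mulrC.
    case/negP: ndfh; apply: Pdiv.Idomain.dvdp_trans dh.
    by apply/dvdp_divides; exists 1; rewrite ?oner_neq0//; exists w; rewrite mul1r.
  have dw : d * w = c%:P.
    by apply: (mulfI f0); rewrite mulrCA -eE -E mulrC.
  have w0 : w != 0 by apply: contraNneq c0 => w0; rewrite -polyC_eq0 -dw w0 mulr0.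
  have := size_polyC c; rewrite c0 -dw size_mul// => sE.
  have := size_poly_gt0 w; rewrite w0; have := size_poly_gt0 d; rewrite d0.
  by move: sE; case: (size d) (size w) => [|[|m]] [|[|m']]//; rewrite ?addnS.
move=> /Pdiv.Idomain.Bezout_coprimepP[[u v]/= /Pdiv.Idomain.eqp_size].
rewrite size_poly1 => s1.
have E := size1_polyC (eq_leq s1); move: (_`_0) E => r E.
have r0 : r != 0 by rewrite -polyC_eq0 -E -size_poly_gt0 s1.
have lf0 : lead_coef f != 0 by rewrite lead_coef_eq0.
(* Where its leading coefficient does not vanish, [f] keeps its positive degree and so has a root
   over the point. *)
have [x] := sep (mulf_neq0 r0 lf0).
rewrite rmorphM mulf_eq0 negb_or => /andP[rx lx].
have /closed_rootP[z] : size (map_poly (ev x) f) != 1%N.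
  by rewrite size_map_poly_id0// gtn_eqF.
rewrite rootE => /eqP fz; exists (x, z); split=> //.
apply: contraNneq rx => hz.
by rewrite -(ev_polyC (x, z)) -E ev_polyD !ev_polyM hz /ev_poly/= fz !mulr0 addr0.
Qed.

End NullstellensatzPoly.

(** * Polynomial rings in n variables *)

Section MPoly.
Variable (C : closedFieldType).

Lemma mpoly_morph_eq n (A : nzRingType) (f g : {rmorphism mpoly n C -> A}) :
  (forall c, f (mpolyC n c) = g (mpolyC n c)) ->
  (forall m, f (mpolyX C m) = g (mpolyX C m)) -> f =1 g.
Proof.
move=> fgC fgX p; elim/mpolyind: p => [|c m p _ _ IHp].
  by rewrite !rmorph0.
by rewrite !rmorphD IHp -mul_mpolyC !rmorphM/= fgC fgX.
Qed.

Section Uni.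
Variable (n : nat).
Local Notation P := (mpoly n C).
Local Notation muni := (@muni n C).
Local Notation mwiden := (@mwiden n C).
Local Notation Xmax := (mpolyX C (mnm1 (@ord_max n))).
Local Notation of_uni := (horner_eval Xmax \o map_poly mwiden).

Lemma muniX (m : multinom n.+1) : muni (mpolyX C m) =
  (mpolyX C (Multinom [tuple m (widen_ord (leqnSn n) i) | i < n]))
  *: 'X^(m ord_max).
Proof. by rewrite muniE msuppX big_seq1 mcoeffX eqxx scale1r. Qed.

Lemma of_uniK : cancel muni of_uni.
Proof.
suff : of_uni \o muni =1 idfun by [].
apply: mpoly_morph_eq => [c|m]/=.
  by rewrite muniC map_polyC/= mwidenC /horner_eval hornerC.
rewrite muniX -mul_polyC rmorphM /= map_polyC map_polyXn /horner_eval.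
rewrite hornerM hornerC hornerXn/= mwidenX mpolyXn -mpolyXD.
congr mpolyX; apply/mnmP => i.
rewrite mnmDE mulmnE mnm1E.
case: (unliftP ord_max i) => [j|] ->.
  have -> : lift ord_max j = widen_ord (leqnSn n) j by apply: ord_inj; rewrite lift_max.
  rewrite mnmwiden_widen mnmE -val_eqE/= gtn_eqF// mul0n addn0//.
by rewrite mnmwiden_ordmax eqxx mul1n add0n.
Qed.

Lemma muniK : cancel of_uni muni.
Proof.
have muniw a : muni (mwiden a) = a%:P.
  have : muni \o mwiden =1 polyC.
    apply: mpoly_morph_eq => [c|m]/=; first by rewrite mwidenC muniC.
    rewrite mwidenX muniX mnmwiden_ordmax expr0 alg_polyC.
    congr (mpolyX C _)%:P; apply/mnmP => i.
    by rewrite mnmE mnmwiden_widen.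
  by apply.
have muniXmax : muni Xmax = 'X.
  rewrite muniX mnm1E eqxx expr1.
  have -> : Multinom [tuple mnm1 (@ord_max n) (widen_ord (leqnSn n) i) | i < n] = mnm0.
    apply/mnmP => i; rewrite mnmE mnm1E mnm0E.
    by rewrite -val_eqE/= eq_sym ltn_eqF.
  by rewrite mpolyX0 scale1r.
elim/poly_ind => [|f c IHf]; first by rewrite !rmorph0.
by rewrite !(rmorphD, rmorphM)/= IHf map_polyC map_polyX /horner_eval hornerX hornerC muniXmax muniw.
Qed.

Definition extend_point (v : 'I_n -> C) (z : C) (i : 'I_n.+1) : C :=
  oapp v z (unlift ord_max i).

Definition mevalr m (v : 'I_m -> C) : {rmorphism mpoly m C -> C} :=
  meval v.

Lemma ev_poly_muni v z p :
  ev_poly (@mevalr n) (v, z) (muni p) = meval (extend_point v z) p.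
Proof.
suff : [eta horner_eval z \o map_poly (mevalr v) \o muni]
    =1 mevalr (extend_point v z) by apply.
apply: mpoly_morph_eq => [c|m]/=.
  by rewrite muniC map_polyC/= /horner_eval hornerC !mevalC.
rewrite muniX -mul_polyC rmorphM /= map_polyC map_polyXn /horner_eval.
rewrite hornerM hornerC hornerXn /mevalr !mevalX big_ord_recr/=; congr (_ * _).
  rewrite mevalX; apply: eq_bigr => i _; rewrite mnmE; congr (_ ^+ _).
  rewrite /extend_point.
  have -> : widen_ord (leqnSn n) i = lift ord_max i by apply: ord_inj; rewrite lift_max.
  by rewrite liftK.
by rewrite /extend_point unlift_none.
Qed.

End Uni.

Lemma mpoly0_unit (a : mpoly 0 C) : a != 0 -> a \is a GRing.unit.
Proof.
have aE : a = mpolyC 0 (mcoeff mnm0 a).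
  apply/mpolyP => m; rewrite mcoeffC.
  have -> : m = mnm0 by apply/mnmP => -[].
  by rewrite eqxx mulr1.
move=> a0; apply/unitrP; exists (mpolyC 0 (mcoeff mnm0 a)^-1).
have c0 : mcoeff mnm0 a != 0.
  by apply: contraNneq a0 => c0; rewrite aE c0 mpolyC0.
by rewrite {2 3}aE -!mpolyCM mulVf// mulfV.
Qed.

(** Proved jointly by induction on the number of variables: the third statement needs all three with
    one variable less. *)
Lemma mpoly_package n :
  [/\ factorial_ring (mpoly n C), separating (@mevalr n) &
      prime_null (@mevalr n)].
Proof.
elim: n => [|n [fP sepP nullP]].
  split.
  - move=> a /mpoly0_unit aU; exists a, [::]; split=> //.
    by rewrite big_nil mulr1.
  - move=> a /mpoly0_unit aU; exists (fun=> 0).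
    by rewrite -unitfE rmorph_unit.
  (* Vacuous, as every nonzero constant is a unit and there are no primes. *)
  - by move=> p h [/mpoly0_unit ->].
split.
- apply: factorial_iso (@of_uniK n) (@muniK n) _; exact: factorial_poly.
- move=> a a0; have [|[v z]] := @separating_poly C _ _ (@mevalr n) sepP (muni a).
    by rewrite -(rmorph0 (@muni n C)) (can_eq (@of_uniK n)).
  by rewrite ev_poly_muni => az; exists (extend_point v z).
- move=> p h pP ph.
  have [||[v z]] := @prime_null_poly C _ _ (@mevalr n) fP sepP nullP (muni p) (muni h).
  + by rewrite -(prime_iso (@of_uniK n) (@muniK n)).
  + by rewrite -(divides_iso (@of_uniK n)).
  + by rewrite !ev_poly_muni => H; exists (extend_point v z).
Qed.

End MPoly.

(** * Exponents and Newton polytopes *)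

Section Exponents.
Context {R : realType} {k : nat}.

Lemma pairingDl (m m' x : 'rV[R]_k) : pairing (m + m') x = pairing m x + pairing m' x.
Proof. by rewrite /pairing -big_split; apply: eq_bigr => i _; rewrite mxE mulrDl. Qed.

Lemma pairingDr (m x x' : 'rV[R]_k) : pairing m (x + x') = pairing m x + pairing m x'.
Proof. by rewrite /pairing -big_split; apply: eq_bigr => i _; rewrite mxE mulrDr. Qed.

Lemma pairingZr a (m x : 'rV[R]_k) : pairing m (a *: x) = a * pairing m x.
Proof. by rewrite /pairing big_distrr; apply: eq_bigr => i _; rewrite mxE mulrCA. Qed.

Lemma pairingZl a (m x : 'rV[R]_k) : pairing (a *: m) x = a * pairing m x.
Proof. by rewrite /pairing big_distrr; apply: eq_bigr => i _; rewrite mxE -mulrA. Qed.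

Lemma pairing0l (x : 'rV[R]_k) : pairing 0 x = 0.
Proof. by rewrite -(scale0r 0) pairingZl mul0r. Qed.

Lemma pairing0r (x : 'rV[R]_k) : pairing x 0 = 0.
Proof. by rewrite -(scale0r 0) pairingZr mul0r. Qed.

Lemma pairingNl (m x : 'rV[R]_k) : pairing (- m) x = - pairing m x.
Proof. by rewrite -scaleN1r pairingZl mulN1r. Qed.

Lemma pairingNr (m x : 'rV[R]_k) : pairing m (- x) = - pairing m x.
Proof. by rewrite -scaleN1r pairingZr mulN1r. Qed.

Lemma pairing_sumr (m : 'rV[R]_k) (I : Type) (r : seq I) (P : pred I) F :
  pairing m (\sum_(i <- r | P i) F i) = \sum_(i <- r | P i) pairing m (F i).
Proof.
apply: (big_morph (pairing m)) => [x y|]; first exact: pairingDr.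
exact: pairing0r.
Qed.

Lemma pairing_suml (m : 'rV[R]_k) (I : Type) (r : seq I) (P : pred I) F :
  pairing (\sum_(i <- r | P i) F i) m = \sum_(i <- r | P i) pairing (F i) m.
Proof.
apply: (big_morph (fun x => pairing x m) _ (pairing0l m)) => x y.
exact: pairingDl.
Qed.

Lemma real_ofD (m m' : 'rV[int]_k) : real_of (m + m') = real_of m + real_of m' :> 'rV[R]_k.
Proof. by apply/rowP => i; rewrite !mxE intrD. Qed.

Lemma real_ofN (m : 'rV[int]_k) : real_of (- m) = - real_of m :> 'rV[R]_k.
Proof. by apply/rowP => i; rewrite !mxE intrN. Qed.

Lemma real_of0 : real_of (0 : 'rV[int]_k) = 0 :> 'rV[R]_k.
Proof. by apply/rowP => i; rewrite !mxE. Qed.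

(** For integral [v] this is the order of the character [m] along the one-parameter subgroup [v]. *)
Definition wt (v : 'rV[R]_k) (m : 'rV[int]_k) : R := pairing (real_of m) v.

Lemma wtD v m m' : wt v (m + m') = wt v m + wt v m'.
Proof. by rewrite /wt real_ofD pairingDl. Qed.

Lemma wtN v m : wt v (- m) = - wt v m.
Proof. by rewrite /wt real_ofN pairingNl. Qed.

Lemma wtB v m m' : wt v (m - m') = wt v m - wt v m'.
Proof. by rewrite wtD wtN. Qed.

Lemma wt0 v : wt v 0 = 0.
Proof. by rewrite /wt real_of0 pairing0l. Qed.

Lemma wt0v m : wt 0 m = 0.
Proof. exact: pairing0r. Qed.

Lemma wt_sum (I : Type) (r : seq I) (P : pred I) F m :
  wt (\sum_(i <- r | P i) F i) m = \sum_(i <- r | P i) wt (F i) m.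
Proof. exact: pairing_sumr. Qed.

Lemma wtMn v m N : wt v (m *+ N) = N%:R * wt v m.
Proof.
elim: N => [|N IHN]; first by rewrite mulr0n wt0 mul0r.
by rewrite mulrS wtD IHN -natr1 mulrDl mul1r addrC.
Qed.

Definition expo (m : multinom k) : 'rV[int]_k := \row_j (m j)%:Z.

Lemma expoD m m' : expo (mnm_add m m') = expo m + expo m'.
Proof. by apply/rowP => i; rewrite !mxE mnmDE PoszD. Qed.

Lemma expo0 : expo mnm0 = 0.
Proof. by apply/rowP => i; rewrite !mxE mnm0E. Qed.

(** A common denominator for finitely many Laurent monomials. *)
Lemma expo_shift (s : seq 'rV[int]_k) : exists b, forall m, m \in s ->
  exists m', expo m' = m + expo b.
Proof.
elim: s => [|m s [b IHs]]; first by exists mnm0.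
exists (mnm_add (Multinom [tuple absz (m 0 i) | i < k]) b) => n.
rewrite inE => /predU1P[->|/IHs[n' n'E]].
  exists (mnm_add (Multinom [tuple absz (m 0 i + (absz (m 0 i))%:Z) | i < k]) b).
  rewrite !expoD addrA; congr (_ + _); apply/rowP => i; rewrite !mxE !mnmE.
  by rewrite gez0_abs// abszE -lerBlDr sub0r lerNnormlW.
exists (mnm_add (Multinom [tuple absz (m 0 i) | i < k]) n').
by rewrite !expoD n'E addrCA.
Qed.

End Exponents.

(** * Terms of least weight in a product *)

Section MinTerm.
Context {R : realType} {k : nat} {C : idomainType}.
Local Notation P := (mpoly k C).
Local Notation supp := (@msupp k C).
Implicit Types (p q : P) (v : 'rV[R]_k).

(** Ties are broken by the monomial order, which is compatible with addition; thus the least term is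
    unique and the least terms of two factors multiply without cancellation. *)
Definition wt_le v (m m' : multinom k) :=
  wt v (expo m) < wt v (expo m') \/
  wt v (expo m) = wt v (expo m') /\ (m <= m')%O.

Lemma wt_le_min v (s : seq (multinom k)) : s != [::] ->
  exists2 m, m \in s & forall m', m' \in s -> wt_le v m m'.
Proof.
elim: s => // m s IHs _; have [->|/IHs[n ns nmin]] := eqVneq s [::].
  exists m; rewrite ?mem_head// => m'; rewrite inE => /eqP ->.
  by right.
have [mn|nm|E] := ltgtP (wt v (expo m)) (wt v (expo n)).
- exists m; rewrite ?mem_head// => m'; rewrite inE => /predU1P[->|/nmin[]].
  + by right.
  + by left; apply: lt_trans mn _.
  + by move=> [E _]; left; rewrite -E.
- exists n; rewrite ?inE ?ns ?orbT// => m'; rewrite inE => /predU1P[->|/nmin//].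
  by left.
have [mn|nm] := leP m n.
- exists m; rewrite ?mem_head// => m'; rewrite inE => /predU1P[->|/nmin[]].
  + by right.
  + by move=> lt; left; rewrite E.
  + by move=> [E' nm']; right; split; [rewrite E|exact: le_trans mn _].
exists n; rewrite ?inE ?ns ?orbT// => m'; rewrite inE => /predU1P[->|/nmin//].
by right; split=> //; exact: ltW.
Qed.

Lemma min_term_unique v (m1 m2 n1 n2 : multinom k) :
  wt_le v m1 n1 -> wt_le v m2 n2 ->
  mnm_add n1 n2 = mnm_add m1 m2 -> n1 = m1.
Proof.
move=> m1n1 m2n2 E.
have wE : wt v (expo n1) + wt v (expo n2) = wt v (expo m1) + wt v (expo m2).
  by rewrite -!wtD -!expoD E.
have le1 : wt v (expo m1) <= wt v (expo n1) by case: m1n1 => [/ltW|[-> _]].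
have le2 : wt v (expo m2) <= wt v (expo n2) by case: m2n2 => [/ltW|[-> _]].
have mn1 : (m1 <= n1)%O.
  case: m1n1 => [lt1|[]//]; have := ltr_leD lt1 le2; by rewrite wE ltxx.
have mn2 : (m2 <= n2)%O.
  case: m2n2 => [lt2|[]//]; have := ler_ltD le1 lt2; by rewrite wE ltxx.
apply/eqP/negPn/negP; rewrite eq_sym => ne1.
have lt1 : (m1 < n1)%O by rewrite lt_neqAle ne1.
by have := ltmc_le_add lt1 mn2; rewrite E ltxx.
Qed.

(** By uniqueness no other pair of terms contributes to the coefficient at [m1 + m2], which is
    therefore a product of two nonzero coefficients. *)
Lemma min_term_mul v p q m1 m2 : m1 \in supp p -> m2 \in supp q ->
  (forall m, m \in supp p -> wt_le v m1 m) ->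
  (forall m, m \in supp q -> wt_le v m2 m) ->
  mnm_add m1 m2 \in supp (p * q).
Proof.
move=> m1p m2q m1min m2min; rewrite mcoeff_msupp.
set c := mcoeff m1 p; pose p' := p - c *: mpolyX C m1.
have -> : p = c *: mpolyX C m1 + p' by rewrite addrC subrK.
rewrite mulrDl mcoeffD -scalerAl mcoeffZ mulrC.
rewrite (mulrC (mpolyX _ _)) mcoeffMX.
rewrite (_ : mcoeff _ (p' * q) = 0) ?addr0; last first.
  apply/eqP; rewrite mcoeff_eq0; apply/negP => /msuppM_le.
  move=> /allpairsP[[n1 n2] /= [n1p' n2q E]].
  have n1p : n1 \in supp p.
    move: n1p'; rewrite /p' !mcoeff_msupp mcoeffB mcoeffZ mcoeffX.
    have [<-|_] := eqVneq m1 n1; first by rewrite -/c mulr1 subrr eqxx.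
    by rewrite mulr0 subr0.
  have n1m1 := min_term_unique (m1min _ n1p) (m2min _ n2q) (esym E).
  move: n1p'; rewrite n1m1 /p' mcoeff_msupp mcoeffB mcoeffZ mcoeffX.
  by rewrite eqxx mulr1 subrr eqxx.
by apply: mulf_neq0; rewrite -?mcoeff_msupp.
Qed.

Lemma wt_min_mul v p q : p != 0 -> q != 0 -> exists m1 m2,
  [/\ m1 \in supp p, m2 \in supp q, mnm_add m1 m2 \in supp (p * q),
      forall m, m \in supp p -> wt v (expo m1) <= wt v (expo m) &
      forall m, m \in supp q -> wt v (expo m2) <= wt v (expo m)].
Proof.
rewrite -!msupp_eq0 => /(wt_le_min v)[m1 m1p m1min] /(wt_le_min v)[m2 m2q m2min].
exists m1, m2; split=> //; first exact: min_term_mul m1min m2min.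
  by move=> m /m1min[/ltW|[-> _]].
by move=> m /m2min[/ltW|[-> _]].
Qed.

(** The Newton polytope of a product is a Minkowski sum. If all directions [v i] attain their
    minimum on it together, they do so on both summands. [m1 + m2] is compared with [m0] only
    through these weights. *)
Lemma supp_vertex (r : nat) (v : 'I_r -> 'rV[R]_k) p q m0 : p * q != 0 ->
  m0 \in supp (p * q) ->
  (forall i m, m \in supp (p * q) -> wt (v i) (expo m0) <= wt (v i) (expo m)) ->
  exists m1 m2,
  [/\ m1 \in supp p, m2 \in supp q,
      forall i m, m \in supp p -> wt (v i) (expo m1) <= wt (v i) (expo m),
      forall i m, m \in supp q -> wt (v i) (expo m2) <= wt (v i) (expo m) &
      forall i, wt (v i) (expo m1) + wt (v i) (expo m2) = wt (v i) (expo m0)].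
Proof.
move=> pq0 m0pq m0min.
have [p0 q0] : p != 0 /\ q != 0 by move: pq0; rewrite mulf_eq0 negb_or => /andP[].
(* A minimum of the sum of the v_i on the support of the product is a common
   minimum, because m0 is one. *)
have [m1 [m2 [m1p m2q m12 m1min m2min]]] := wt_min_mul (\sum_i v i) p0 q0.
have key i : wt (v i) (expo m1) + wt (v i) (expo m2) = wt (v i) (expo m0).
  pose d i := wt (v i) (expo m1) + wt (v i) (expo m2) - wt (v i) (expo m0).
  have d0 j : 0 <= d j.
    by rewrite /d subr_ge0 -wtD -expoD; exact: m0min.
  have /eqP : \sum_j d j = 0.
    apply/eqP; rewrite eq_le sumr_ge0 ?andbT//.
    have /allpairsP[[n1 n2] /= [n1p n2q m0E]] := msuppM_le m0pq.
    rewrite /d sumrB big_split/= -!wt_sum subr_le0 m0E expoD wtD.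
    exact: lerD (m1min _ n1p) (m2min _ n2q).
  rewrite psumr_eq0// => /allP/(_ i (mem_index_enum i))/eqP/eqP.
  by rewrite subr_eq0 => /eqP.
exists m1, m2; split=> // i.
- have [n1 [n2 [n1p n2q n12 n1min n2min]]] := wt_min_mul (v i) p0 q0.
  have := m0min i _ n12; rewrite -key expoD wtD => le12 m mp.
  have := n1min m mp; have := n2min _ m2q; lra.
- have [n1 [n2 [n1p n2q n12 n1min n2min]]] := wt_min_mul (v i) p0 q0.
  have := m0min i _ n12; rewrite -key expoD wtD => le12 m mp.
  have := n2min m mp; have := n1min _ m1p; lra.
Qed.

End MinTerm.

(** * Line bundles on the torus *)

Section TorusPicard.
Variables (C : closedFieldType) (k : nat).
Local Notation P := (mpoly k C).
Local Notation ev z p := (meval z p).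
Implicit Types (p q a c d : P) (z : 'I_k -> C).

Let fP : factorial_ring P. Proof. by have [] := mpoly_package C k. Qed.

Lemma mpoly_sep p : p != 0 -> exists z, ev z p != 0.
Proof. by have [_ sepP _] := mpoly_package C k; exact: sepP. Qed.

Lemma mpoly_eq0 q p : q != 0 -> (forall z, ev z q != 0 -> ev z p = 0) -> p = 0.
Proof.
move=> q0 H; apply/eqP/negPn/negP => p0.
have [z] := mpoly_sep (mulf_neq0 q0 p0).
by rewrite mevalM mulf_eq0 negb_or => /andP[/H -> /eqP].
Qed.

Lemma mpoly_eq q p p' : q != 0 -> (forall z, ev z q != 0 -> ev z p = ev z p') -> p = p'.
Proof.
move=> q0 H; apply/eqP; rewrite -subr_eq0; apply/eqP; apply: mpoly_eq0 q0 _ => z qz.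
by rewrite mevalB H// subrr.
Qed.

Lemma divides_ev a c z : divides a c -> ev z c != 0 -> ev z a != 0.
Proof. by move=> [d ->]; rewrite mevalM mulf_eq0 negb_or => /andP[]. Qed.

Lemma divides_neq0 a c : divides a c -> c != 0 -> a != 0.
Proof. by move=> [d ->]; rewrite mulf_eq0 negb_or => /andP[]. Qed.

Lemma divides_mul a a' c c' : divides a c -> divides a' c' -> divides (a * a') (c * c').
Proof. by move=> [d ->] [d' ->]; exists (d * d'); rewrite mulrACA. Qed.

Lemma divides_exp a c n : divides a c -> divides (a ^+ n) (c ^+ n).
Proof. by move=> [d ->]; exists (d ^+ n); rewrite exprMn. Qed.

Lemma divides_exp2l a m n : (m <= n)%N -> divides (a ^+ m) (a ^+ n).
Proof. by move=> mn; exists (a ^+ (n - m)); rewrite -exprD subnKC. Qed.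

(** By the Nullstellensatz each prime factor of [a] divides [q]; the exponent is the number of these
    factors. *)
Lemma divides_pow_nonvanishing a q : a != 0 ->
  (forall z, ev z q != 0 -> ev z a != 0) -> exists N, divides a (q ^+ N).
Proof.
move=> a0 aq; have [u [s [uU sP aE]]] := fP a0.
have sq p : p \in s -> divides p q.
  move=> ps; apply: contrapT => pq; have [_ _ nullP] := mpoly_package C k.
  have [z [pz qz]] := nullP _ _ (sP p ps) pq.
  have := aq z qz; rewrite aE (big_rem p)//= !mevalM.
  by rewrite (_ : ev z p = 0)// mul0r mulr0 eqxx.
exists (size s); suff [d dE] : divides (\prod_(p <- s) p) (q ^+ size s).
  exists (u^-1 * d); rewrite aE dE mulrACA divrr// mul1r//.
elim: s sq {sP aE} => [|p s IHs] sq; first by rewrite big_nil; exists 1; rewrite mulr1.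
rewrite big_cons exprS; apply: divides_mul; first by apply: sq; rewrite mem_head.
by apply: IHs => r rs; apply: sq; rewrite inE rs orbT.
Qed.

Definition no_common_prime a c := forall p, prime_elt p -> divides p a -> ~ divides p c.

Lemma no_common_primeC a c : no_common_prime a c -> no_common_prime c a.
Proof. by move=> H p pP pc pa; exact: H pa pc. Qed.

Lemma lowest_terms a c : a != 0 -> exists a' c' d,
  [/\ a = a' * d, c = c' * d & no_common_prime a' c'].
Proof.
move=> a0; have [u [s [uU sP ->]]] := fP a0.
elim: s c sP => [|p s IHs] c sP.
  exists u, c, 1; rewrite big_nil !mulr1; split=> // p pP /prime_unit.
  by move=> /(_ pP uU).
have [pP {}sP] := forall_in_cons sP.
have [[c1 cE]|npc] := pselect (divides p c).
  have [a' [c' [d [aE c1E H]]]] := IHs c1 sP.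
  exists a', c', (p * d); split=> //.
    by rewrite big_cons mulrCA aE mulrCA.
  by rewrite cE c1E mulrCA.
have [a' [c' [d [aE cE H]]]] := IHs c sP.
exists (p * a'), c', d; split=> //.
  by rewrite big_cons mulrCA aE mulrA.
move=> r rP; have [_ _ rM] := rP; move=> /rM[rp|/H]; last by apply.
move=> rc; apply: npc; rewrite cE; apply: divides_mulr.
by apply: divides_trans rc; exact: prime_dvd_prime.
Qed.

(** Each prime factor of [c] divides [a * b] but not [a], so it can be cancelled from [b]. *)
Lemma coprime_divides a c b : c != 0 -> no_common_prime a c -> divides c (a * b) -> divides c b.
Proof.
move=> c0; have [u [s [uU sP ->]]] := fP c0 => {c c0}.
elim: s b sP => [|p s IHs] b sP ac.
  by move=> _; exists (u^-1 * b); rewrite big_nil mulr1 mulrA divrr// mul1r.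
have [pP {}sP] := forall_in_cons sP.
have [p0 _ pM] := pP.
rewrite big_cons mulrCA in ac *.
move=> -[d E]; have [|pa|[b' bE]] := pM a b.
- by rewrite E -mulrA; eexists.
- by case: (ac p pP pa); eexists.
rewrite bE; apply: divides_mul; first by exists 1; rewrite mulr1.
apply: IHs => //.
  by move=> r rP ra rc; apply: (ac r rP ra); exact: divides_mull.
exists d; apply: (mulfI p0); rewrite mulrCA -bE E; by rewrite !mulrA.
Qed.

(** An invertible regular function on D(q), given by its values on points; the values off D(q) are
    arbitrary. *)
Definition regular_unit q (f : ('I_k -> C) -> C) := forall z, ev z q != 0 ->
  exists a b, [/\ ev z a != 0, ev z b != 0 &
    forall w, ev w q != 0 -> ev w b != 0 -> f w * ev w b = ev w a].

(** One fraction in lowest terms serves at all points: its numerator and denominator divide those of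
    every local representation, so they have no zeros on D(q). *)
Lemma regular_unit_frac q f : q != 0 -> regular_unit q f -> exists a c N,
  [/\ divides a (q ^+ N), divides c (q ^+ N) &
      forall z, ev z q != 0 -> f z * ev z c = ev z a].
Proof.
move=> q0 fq; have [z0 qz0] := mpoly_sep q0.
have [a0 [b0 [a0z b0z f0E]]] := fq z0 qz0.
have a00 : a0 != 0 by apply: contraNneq a0z => ->; rewrite meval0.
have b00 : b0 != 0 by apply: contraNneq b0z => ->; rewrite meval0.
have [a [c [d [aE cE ac]]]] := lowest_terms b0 a00.
have [an0 dn0] : a != 0 /\ d != 0.
  by move: a00; rewrite aE mulf_eq0 negb_or => /andP[].
have cn0 : c != 0 by move: b00; rewrite cE mulf_eq0 negb_or => /andP[].
have H z : ev z q != 0 -> [/\ ev z a != 0, ev z c != 0 & f z * ev z c = ev z a].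
  move=> qz; have [a1 [b1 [a1z b1z f1E]]] := fq z qz.
  have b1n0 : b1 != 0 by apply: contraNneq b1z => ->; rewrite meval0.
  have E : a * b1 = c * a1.
    apply: (@mpoly_eq (q * (d * (c * b1)))); first by rewrite !mulf_neq0.
    move=> w; rewrite !mevalM !mulf_eq0 !negb_or => /and4P[qw dw cw b1w].
    rewrite -f1E//; have := f0E w qw; rewrite aE cE !mevalM.
    move=> /(_ (mulf_neq0 cw dw)); rewrite mulrA => /(mulIf dw) <-.
    ring.
  have cb : divides c b1 by apply: (coprime_divides cn0 ac); exists a1.
  have aa : divides a a1.
    by apply: (coprime_divides an0 (no_common_primeC ac)); exists b1.
  have az := divides_ev aa a1z; have cz := divides_ev cb b1z.
  split=> //; apply: (mulIf b1z).
  by have := congr1 (meval z) E; rewrite !mevalM -f1E// => ->; ring.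
have [N1 aN] := divides_pow_nonvanishing an0 (fun z qz => let: And3 h _ _ := H z qz in h).
have [N2 cN] := divides_pow_nonvanishing cn0 (fun z qz => let: And3 _ h _ := H z qz in h).
exists a, c, (N1 + N2)%N; split.
- by apply: divides_trans aN _; apply: divides_exp2l; rewrite leq_addr.
- by apply: divides_trans cN _; apply: divides_exp2l; rewrite leq_addl.
- by move=> z /H[].
Qed.

Lemma prime_valuation p a : prime_elt p -> a != 0 ->
  exists e a', a = p ^+ e * a' /\ ~ divides p a'.
Proof.
move=> pP a0; have [u [s [uU sP ->]]] := fP a0.
elim: s sP => [|r s IHs] sP.
  exists 0%N, u; rewrite big_nil mulr1 expr0 mul1r; split=> //; exact: prime_unit.
have [rP {}sP] := forall_in_cons sP.
have [e [a' [E pa']]] := IHs sP.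
rewrite big_cons mulrCA E; have [_ _ pM] := pP.
have [pr|npr] := pselect (divides p r).
  have [w rE] := pr; exists e.+1, (w * a'); rewrite rE exprS; split; first by ring.
  move=> /pM[[v wE]|//]; have [r0 _ _] := rP; have [p0 _ _] := pP.
  have := prime_dvd_prime pP rP pr => -[x pE]; have w0 : w != 0.
    by apply: contraNneq r0 => w0; rewrite rE w0 mulr0.
  have wx : w * x = 1.
    by apply: (mulfI p0); rewrite mulr1 mulrA -rE -pE.
  apply: (@prime_unit _ p w pP); last by exists v.
  by apply/unitrP; exists x; rewrite mulrC wx.
exists e, (r * a'); rewrite mulrCA; split=> // /pM[//|]; exact: pa'.
Qed.

Lemma prime_coprime_pow p a n : prime_elt p -> ~ divides p a -> no_common_prime (p ^+ n) a.
Proof.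
move=> pP pa r rP; have [_ _ rM] := rP; elim: n => [|n IHn].
  by rewrite expr0 => /(prime_unit rP); rewrite unitr1 => /(_ isT).
rewrite exprS => /rM[rp ra|/IHn//]; apply: pa.
by apply: divides_trans ra; exact: prime_dvd_prime.
Qed.

Lemma eq_prime_exp p a a' e e' : prime_elt p -> ~ divides p a -> ~ divides p a' ->
  p ^+ e * a = p ^+ e' * a' -> e = e'.
Proof.
move=> pP pa pa'; have [p0 _ _] := pP.
wlog le : e e' a a' pa pa' / (e <= e')%N => [H E|E].
  by have [?|/ltnW ?] := leqP e e'; [exact: (H _ _ a a')|symmetry; exact: (H _ _ a' a)].
apply/eqP; rewrite eqn_leq le leqNgt; apply/negP => lt; apply: pa.
have : p ^+ e * a = p ^+ e * (p ^+ (e' - e) * a') by rewrite mulrA -exprD subnKC.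
move/(mulfI (expf_neq0 e p0)) ->; apply: divides_mulr.
have : (0 < e' - e)%N by rewrite subn_gt0.
by case: (e' - e)%N => // n _; rewrite exprS; eexists.
Qed.

(** * Line bundles on D([X]), given by cocycles on a cover by the sets D([q i]) *)

Section Cocycle.
Variables (I : Type) (X : P) (q : I -> P) (f : I -> I -> ('I_k -> C) -> C).
Hypothesis q0 : forall i, q i != 0.
Hypothesis Xq : forall i, divides X (q i).
Hypothesis cover : forall z, ev z X != 0 -> exists i, ev z (q i) != 0.
Hypothesis fU : forall i j, regular_unit (q i * q j) (f i j).
Hypothesis fM : forall i j l z, ev z (q i) != 0 -> ev z (q j) != 0 -> ev z (q l) != 0 ->
  f i j z * f j l z = f i l z.

(** The rational functions a_i / c_i trivialize the cocycle f over D(r). *)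
Definition coboundary_on (r : P) (a c : I -> P) :=
  (forall i, exists N, divides (a i) ((r * q i) ^+ N) /\ divides (c i) ((r * q i) ^+ N)) /\
  (forall i j z, ev z r != 0 -> ev z (q i) != 0 -> ev z (q j) != 0 ->
    f i j z * ev z (c i * a j) = ev z (a i * c j)).

Lemma coboundary_nz (r : P) (a c : I -> P) i : r != 0 -> coboundary_on r a c -> a i != 0 /\ c i != 0.
Proof.
move=> r0 [H _]; have [N [aN cN]] := H i.
have rq : (r * q i) ^+ N != 0 by rewrite expf_neq0// mulf_neq0.
by split; apply: divides_neq0 rq.
Qed.

(** All quotients [a i / c i] are scaled by the same p^(g - e), which does not change the coboundary
    relation over D(p r); being polynomial, the relation extends to D(r) by density. *)
Lemma coboundary_enlarge p (r : P) (a c a' c' : I -> P) e g : prime_elt p -> r != 0 ->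
  coboundary_on (p * r) a c ->
  (forall i, exists N, divides (a' i) ((r * q i) ^+ N) /\ divides (c' i) ((r * q i) ^+ N)) ->
  (forall i, a' i * (c i * p ^+ e) = c' i * (a i * p ^+ g)) ->
  coboundary_on r a' c'.
Proof.
move=> [p0 _ _] r0 ac dvd' E; split=> // i j z rz qi qj.
have pr0 : p * r != 0 by rewrite mulf_neq0.
have [a0 c0] := (fun i => (coboundary_nz i pr0 ac).1, fun i => (coboundary_nz i pr0 ac).2).
have [_ acf] := ac.
have qij : ev z (q i * q j) != 0 by rewrite mevalM mulf_neq0.
have [al [be [az bz fE]]] := fU qij.
have be0 : be != 0 by apply: contraNneq bz => ->; rewrite meval0.
have F : al * (c' i * a' j) = be * (a' i * c' j).
  apply: (@mpoly_eq (p * r * (q i * q j * (be * (c i * (a i * (c j * a j))))))).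
    by rewrite !mulf_neq0.
  move=> w; rewrite !mevalM !mulf_eq0 !negb_or -!andbA.
  move=> /and5P[pw rw qiw qjw /and5P[bw ciw aiw cjw ajw]].
  have := acf i j w; rewrite !mevalM mulf_neq0// => /(_ isT qiw qjw) fE1.
  have := fE w; rewrite mevalM mulf_neq0// => /(_ isT bw) <-.
  have Ei := congr1 (meval w) (E i); have Ej := congr1 (meval w) (E j).
  rewrite !(mevalM, rmorphXn)/= in Ei Ej.
  have pe0 : ev w p ^+ e != 0 by rewrite expf_neq0.
  have pg0 : ev w p ^+ g != 0 by rewrite expf_neq0.
  apply: (mulIf (mulf_neq0 (mulf_neq0 ciw pe0) (mulf_neq0 ajw pg0))).
  transitivity (ev w be * (f i j w * (ev w (c i) * ev w (a j))) *
    (ev w (a' j) * ev w (c' i) * ev w p ^+ e * ev w p ^+ g)); first by ring.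
  rewrite fE1.
  transitivity (ev w be * (ev w (a' i) * (ev w (c i) * ev w p ^+ e)) *
    (ev w (c' j) * (ev w (a j) * ev w p ^+ g))); last by ring.
  by rewrite Ei -Ej; ring.
apply: (mulIf bz); transitivity (f i j z * ev z be * ev z (c' i * a' j)); first by ring.
by rewrite fE// -!mevalM F mulrC.
Qed.

(** Multiplying the trivialization by a power of p extends it across V(p). *)
Lemma coboundary_prime p (r : P) (a c : I -> P) : prime_elt p -> r != 0 ->
  coboundary_on (p * r) a c -> exists a' c' : I -> P, coboundary_on r a' c'.
Proof.
move=> pP r0 ac; have [p0 pnU pM] := pP; have pr0 : p * r != 0 by rewrite mulf_neq0.
have acN := ac.1; have acf := ac.2.
(* On a chart with [p] dividing [q i] the element [p] is already invertible, so only the exponents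
   change. *)
have dvdp i : divides p (q i) -> exists N, divides (p * r * q i) ((r * q i) ^+ N).
  move=> [d qE]; exists 2%N; rewrite expr2 {2}qE; exists (r * d); by rewrite qE; ring.
(* In the first case V(p) does not meet D(X), and the given trivialization serves. *)
have [pX|npX] := pselect (divides p X).
  exists a, c; apply: (@coboundary_enlarge p r a c a c 0 0) => // i; last by rewrite !mulr1 mulrC.
  have [N [aN cN]] := acN i.
  have [M qM] := dvdp i (divides_trans pX (Xq i)).
  exists (M * N)%N; rewrite exprM; split.
    by apply: divides_trans aN _; exact: divides_exp.
  by apply: divides_trans cN _; exact: divides_exp.
have [_ _ nullP] := mpoly_package C k.
have [z [pz Xz]] := nullP _ _ pP npX.
(* A chart that meets V(p). The factor p^(ec - ea) cancels the order of [a o / c o] along V(p), and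
   with it the order in every other chart that meets V(p). *)
have [o qoz] := cover Xz.
have npo : ~ divides p (q o).
  by move=> [d qE]; move: qoz; rewrite qE mevalM (_ : ev z p = 0)// mul0r eqxx.
have nz i := coboundary_nz i pr0 ac.
have [ea [a1 [aE pa1]]] := prime_valuation pP (nz o).1.
have [ec [c1 [cE pc1]]] := prime_valuation pP (nz o).2.
suff H i : exists ac' : P * P, (exists N, divides ac'.1 ((r * q i) ^+ N) /\
      divides ac'.2 ((r * q i) ^+ N)) /\
      ac'.1 * (c i * p ^+ ea) = ac'.2 * (a i * p ^+ ec).
  have [ac' ac'P] := choice H.
  exists (fun i => (ac' i).1), (fun i => (ac' i).2).
  by apply: (@coboundary_enlarge p r a c _ _ ea ec) => // i; have [] := ac'P i.
have [N [aN cN]] := acN i.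
have [pqi|npqi] := pselect (divides p (q i)).
  have [M qM] := dvdp i pqi.
  exists (a i * p ^+ ec, c i * p ^+ ea); split; last by rewrite /=; ring.
  have pMN e : divides (p ^+ e) ((r * q i) ^+ e).
    by apply: divides_exp; exact: divides_mull.
  have H b e : divides b ((p * r * q i) ^+ N) -> (e <= ea + ec)%N ->
      divides (b * p ^+ e) ((r * q i) ^+ (M * N + (ea + ec))).
    move=> bN le; rewrite exprD exprM; apply: divides_mul.
      by apply: divides_trans bN _; exact: divides_exp.
    by apply: divides_trans (pMN e) _; exact: divides_exp2l.
  by exists (M * N + (ea + ec))%N; split; apply: H => //; rewrite ?leq_addr ?leq_addl.
have [eai [ai1 [aiE pai1]]] := prime_valuation pP (nz i).1.
have [eci [ci1 [ciE pci1]]] := prime_valuation pP (nz i).2.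
exists (ai1, ci1) => /=; split.
  have H b b1 e : b = p ^+ e * b1 -> b != 0 -> ~ divides p b1 ->
      divides b ((p * r * q i) ^+ N) -> divides b1 ((r * q i) ^+ N).
    move=> bE b0 pb1 bN; apply: (@coprime_divides (p ^+ N)).
    - by apply: contraNneq b0 => b10; rewrite bE b10 mulr0.
    - exact: prime_coprime_pow.
    - rewrite -exprMn mulrA; apply: divides_trans bN; by exists (p ^+ e); rewrite bE mulrC.
  by have [ai0 ci0] := nz i; exists N; split; [apply: (H _ _ _ aiE)|apply: (H _ _ _ ciE)].
have [al [be [M [alM beM fE]]]] := regular_unit_frac (mulf_neq0 (q0 i) (q0 o)) (@fU i o).
have E : a i * c o * be = c i * a o * al.
  apply: (@mpoly_eq (p * r * (q i * q o))); first by rewrite !mulf_neq0.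
  move=> w; rewrite !mevalM !mulf_eq0 !negb_or -!andbA => /and4P[pw rw qiw qow].
  have := acf i o w; rewrite !mevalM mulf_neq0// => /(_ isT qiw qow) <-.
  by rewrite -fE ?mevalM ?mulf_neq0//; ring.
have npd d : divides d ((q i * q o) ^+ M) -> ~ divides p d.
  move=> dM pd; have := divides_trans pd dM.
  elim: M {alM beM dM fE} => [|M IHM]; first by rewrite expr0 => /(prime_unit pP); rewrite unitr1 => /(_ isT).
  by rewrite exprS => /pM[/pM[]|].
have npM b d : ~ divides p b -> ~ divides p d -> ~ divides p (b * d).
  by move=> pb pd /pM[].
(* The transition function [f i o] has order 0 along V(p): its numerator and denominator divide a
   power of [q i * q o], which is prime to [p]. *)
have e_eq : (eai + ec = eci + ea)%N.
  apply: (@eq_prime_exp p (ai1 * (c1 * be)) (ci1 * (a1 * al))) => //.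
  - by apply: (npM) => //; apply: (npM) => //; exact: (npd) beM.
  - by apply: (npM) => //; apply: (npM) => //; exact: (npd) alM.
  - move: E; rewrite aiE cE ciE aE !exprD => E.
    transitivity (p ^+ eai * ai1 * (p ^+ ec * c1) * be); first by ring.
    by rewrite E; ring.
rewrite aiE ciE.
transitivity (ai1 * ci1 * p ^+ (eci + ea)); first by rewrite exprD; ring.
by rewrite -e_eq exprD; ring.
Qed.

Lemma coboundary_unit_prod (u : P) (s : seq P) (a c : I -> P) : u \is a GRing.unit ->
  (forall p, p \in s -> prime_elt p) -> coboundary_on (u * \prod_(p <- s) p) a c ->
  exists a' c' : I -> P, coboundary_on u a' c'.
Proof.
move=> uU; elim: s a c => [|p s IHs] a c sP.
  by rewrite big_nil mulr1; exists a, c.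
have [pP {}sP] := forall_in_cons sP.
rewrite big_cons mulrCA => /(coboundary_prime pP)[].
  rewrite mulf_neq0//; first by apply: contraTneq uU => ->; rewrite unitr0.
  by rewrite prodf_seq_neq0; apply/allP => r rs; have [] := sP r rs.
by move=> a' [c' ac']; exact: IHs ac'.
Qed.

(** Line bundles on the torus are trivial. *)
Lemma torus_cocycle (o : I) : exists a c : I -> P,
  (forall i, exists N, divides (a i) (q i ^+ N) /\ divides (c i) (q i ^+ N)) /\
  (forall i j z, ev z (q i) != 0 -> ev z (q j) != 0 ->
    f i j z * ev z (c i * a j) = ev z (a i * c j)).
Proof.
have H i : exists ac : P * P, exists N, [/\ divides ac.1 ((q i * q o) ^+ N),
    divides ac.2 ((q i * q o) ^+ N) &
    forall z, ev z (q i * q o) != 0 -> f i o z * ev z ac.2 = ev z ac.1].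
  have [a [c [N]]] := regular_unit_frac (mulf_neq0 (q0 i) (q0 o)) (@fU i o).
  by exists (a, c), N.
have [ac acP] := choice H.
(* Over D([q o]) the transition functions to the chart [o] are themselves a trivialization; the
   prime factors of [q o] are then removed one by one. *)
have aco : coboundary_on (q o) (fun i => (ac i).1) (fun i => (ac i).2).
  split=> [i|i j z oz iz jz].
    by have [N [aN cN _]] := acP i; exists N; rewrite (mulrC (q o)).
  have [_ [_ _ fi]] := acP i; have [M [aM _ fj]] := acP j.
  have qjz : ev z (q j * q o) != 0 by rewrite mevalM mulf_neq0.
  have qiz : ev z (q i * q o) != 0 by rewrite mevalM mulf_neq0.
  rewrite !mevalM -(fi z qiz) -(fj z qjz) -(@fM i j o)//; ring.
have [u [s [uU sP qE]]] := fP (q0 o).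
rewrite qE in aco; have [a [c [dvd acf]]] := coboundary_unit_prod uU sP aco.
exists a, c; split=> [i|i j z iz jz].
  have [N [aN cN]] := dvd i; exists N.
  have uq : divides ((u * q i) ^+ N) (q i ^+ N).
    apply: divides_exp; exists u^-1; by rewrite mulrAC divrr// mul1r.
  by split; exact: divides_trans uq.
apply: acf => //; have := rmorph_unit (@mevalr C k z) uU.
by rewrite unitfE.
Qed.

End Cocycle.

End TorusPicard.

(** * Cones and fans *)

Section RationalCones.
Context {R : realType} {k : nat}.
Implicit Types (s t : set 'rV[R]_k) (m : 'rV[int]_k).
Local Notation rof := (@real_of R _).

Lemma dual_monoid_sub s t : t `<=` s -> dual_monoid s `<=` dual_monoid t.
Proof. by move=> ts m sm x /ts; exact: sm. Qed.

Section Generators.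
Variables (r : nat) (v : 'I_r -> 'rV[int]_k) (s : set 'rV[R]_k).
Hypothesis sE : s = [set x | exists2 c : 'I_r -> R, (forall i, 0 <= c i) &
                                         x = \sum_(i < r) c i *: real_of (v i)].

Lemma cone_gen i : s (rof (v i)).
Proof.
rewrite sE /=; exists (fun j => (j == i)%:R); first by move=> j; rewrite ler0n.
rewrite (bigD1 i)//= eqxx scale1r big1 ?addr0// => j /negPf->.
by rewrite scale0r.
Qed.

Lemma dual_monoid_gen m : dual_monoid s m <-> forall i, 0 <= wt (rof (v i)) m.
Proof.
split=> [sm i|H x]; first exact/sm/cone_gen.
rewrite sE => -[c c0 ->]; rewrite pairing_sumr sumr_ge0// => i _.
by rewrite pairingZr mulr_ge0//; exact: H.
Qed.

End Generators.

Lemma finite_pos_lb (I : finType) (f : I -> R) : (forall i, 0 < f i) ->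
  exists2 d, 0 < d & forall i, d <= f i.
Proof.
move=> f0; exists (\big[Order.min/1]_i f i).
  by elim/big_ind: _ => // x y x0 y0; rewrite lt_min x0.
by move=> i; rewrite (bigD1 i)//= ge_min lexx.
Qed.

Lemma rat_approx (x d : R) : 0 < d -> exists q : rat, `|ratr q - x| < d.
Proof.
move=> d0; have [|q /andP[]] := @rat_in_itvoo _ (x - d) (x + d).
  by rewrite ltrBlDr -addrA ltrDl addr_gt0.
rewrite !bnd_simp => xq qx; exists q.
by rewrite ltr_distl qx andbT xq.
Qed.

Lemma rat_denominator (n : nat) (q : 'rV[rat]_n) : exists2 N : nat, (0 < N)%N &
  exists m : 'rV[int]_n, map_mx intr m = N%:R *: q.
Proof.
pose D i := absz (denq (q 0 i)).
exists (\prod_i D i)%N.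
  by rewrite prodn_gt0// => i; rewrite absz_gt0 denq_neq0.
have H i : exists m : int, m%:~R = (\prod_i D i)%N%:R * q 0 i.
  exists (numq (q 0 i) * (\prod_(j | j != i) D j)%N%:Z).
  rewrite [in RHS](bigD1 i)//= natrM intrM.
  have -> : (D i)%:R = (denq (q 0 i))%:~R :> rat.
    by rewrite pmulrn /D absz_denq.
  by rewrite mulrAC [X in _ = X * _]mulrC -numqE mulrC.
have [m mE] := choice H; exists (\row_i m i).
by apply/rowP => i; rewrite !mxE mE.
Qed.

(** A face cut out by a real linear form is cut out by an integral one: the
    forms vanishing on the generators in the face make up a rational subspace,
    in which the rational points are dense. *)
Lemma face_integral s t : rational_cone s -> face t s -> exists m,
  dual_monoid s m /\ t = s `&` [set x | wt x m = 0].
Proof.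
move=> [[r [v sE]] _] [m0 m0s tE].
pose I := [pred i : 'I_r | pairing m0 (rof (v i)) == 0].
(* The columns are the generators on the face, zero elsewhere. The forms vanishing on the face make
   up the left kernel, which has a rational basis [K]; [c] is the vector of coordinates of [m0]. *)
pose A : 'M[rat]_(k, r) := \matrix_(j, i) if I i then (v i 0 j)%:~R else 0.
pose AR := map_mx (ratr : rat -> R) A.
have m0A : m0 *m AR = 0.
  apply/rowP => i; rewrite !mxE; have [iI|iI] := boolP (I i).
    transitivity (pairing m0 (rof (v i))); last exact/eqP.
    by apply: eq_bigr => j _; rewrite !mxE iI ratr_int.
  by rewrite big1// => j _; rewrite !mxE (negPf iI) rmorph0 mulr0.
have /submxP[c cE] : (m0 <= map_mx (ratr : rat -> R) (kermx A))%MS.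
  by rewrite map_kermx; apply/sub_kermxP.
set K := kermx A in cE; pose KR := map_mx (ratr : rat -> R) K.
pose b j i := pairing (row j KR) (rof (v i)).
have pE (d : 'rV[R]_k) i : pairing (d *m KR) (rof (v i)) = \sum_j d 0 j * b j i.
  rewrite mulmx_sum_row pairing_suml; apply: eq_bigr => j _.
  by rewrite pairingZl.
have pI (d : 'rV[R]_k) i : I i -> pairing (d *m KR) (rof (v i)) = 0.
  move=> iI; have : d *m KR *m AR = 0.
    rewrite -mulmxA -map_mxM.
    by rewrite /K mulmx_ker map_mx0 mulmx0.
  move=> /rowP/(_ i); rewrite !mxE => E; rewrite -[RHS]E.
  by apply: eq_bigr => j _; congr (_ * _); rewrite !mxE iI ratr_int.
have [d d0 dle] : exists2 d, 0 < d & forall i, ~~ I i -> d <= pairing m0 (rof (v i)).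
  have [|d d0 dle] := @finite_pos_lb _ (fun i => if I i then 1 else pairing m0 (rof (v i))).
    move=> i; case: ifPn => // iI; rewrite lt_neqAle eq_sym iI/=.
    by apply: m0s; exact: cone_gen sE i.
  by exists d => // i iI; have := dle i; rewrite (negPf iI).
(* Moving each coordinate by less than [d / M] changes the values on the generators by less than
   [d], so those off the face stay positive. The summand 1 makes [M] positive and the estimate
   strict. *)
pose M := 1 + \sum_j \sum_i `|b j i|.
have M0 : 0 < M.
  by rewrite ltr_pwDl// sumr_ge0// => j _; apply: sumr_ge0.
have /choice[q qE] : forall j, exists q : rat, `|ratr q - c 0 j| < d / M.
  by move=> j; apply: rat_approx; rewrite divr_gt0.
have [N N0 [m mE]] := rat_denominator ((\row_j q j) *m K).
have wtE i : wt (rof (v i)) m = N%:R * \sum_j ratr (q j) * b j i.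
  rewrite /wt; have -> : real_of m = N%:R *: ((\row_j ratr (q j)) *m KR).
    have := congr1 (map_mx (ratr : rat -> R)) mE.
    rewrite map_mxZ map_mxM/= ratr_nat => E.
    transitivity (map_mx (ratr : rat -> R) (map_mx intr m)).
      by apply/rowP => j; rewrite !mxE ratr_int.
    by rewrite E; congr (_ *: (_ *m _)); apply/rowP => j; rewrite !mxE.
  by rewrite pairingZl pE; congr (_ * _); apply: eq_bigr => j _; rewrite mxE.
have wt0 i : I i -> wt (rof (v i)) m = 0.
  move=> iI; rewrite wtE; have := pI (\row_j ratr (q j)) i iI; rewrite pE.
  under eq_bigr do rewrite mxE.
  by move=> ->; rewrite mulr0.
have wtp i : ~~ I i -> 0 < wt (rof (v i)) m.
  move=> iI; rewrite wtE mulr_gt0 ?ltr0n//.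
  have := dle i iI; rewrite cE pE => dle'.
  have lt : `|\sum_j ratr (q j) * b j i - \sum_j c 0 j * b j i| < d.
    rewrite -sumrB; apply: le_lt_trans (ler_norm_sum _ _ _) _.
    have : \sum_j `|ratr (q j) * b j i - c 0 j * b j i| <= d / M * \sum_j \sum_i `|b j i|.
      rewrite mulr_sumr; apply: ler_sum => j _; rewrite -mulrBl normrM.
      apply: ler_pM => //; first by rewrite ltW// qE.
      by rewrite (bigD1 i)//= lerDl sumr_ge0.
    move=> /le_lt_trans; apply; rewrite -mulrA gtr_pMr//.
    by rewrite mulrC ltr_pdivrMr// mul1r ltrDr.
  by move: lt; rewrite ltr_norml => /andP[]; lra.
exists m; split.
  apply/(dual_monoid_gen sE) => i; have [/wt0->//|/wtp/ltW//] := boolP (I i).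
rewrite tE; apply/seteqP; split=> x [sx /= x0]; split=> //=.
  move: x0 (sx); rewrite {1}sE => + [e e0 xE]; rewrite xE wt_sum pairing_sumr => /eqP.
  rewrite psumr_eq0; last first.
    by move=> i _; rewrite pairingZr mulr_ge0//; apply: m0s; exact: cone_gen sE i.
  move=> /allP H; rewrite big1// => i _.
  have := H i (mem_index_enum i); rewrite /= pairingZr mulf_eq0 => /orP[/eqP->|/wt0 iI].
    by rewrite scale0r wt0v.
  by rewrite /wt pairingZr [X in _ * X]iI mulr0.
move: x0 (sx); rewrite {1}sE => + [e e0 xE]; rewrite xE wt_sum pairing_sumr => /eqP.
have wge i : 0 <= wt (rof (v i)) m.
  by have [/wt0->//|/wtp/ltW//] := boolP (I i).
rewrite psumr_eq0; last by move=> i _; rewrite /wt pairingZr mulr_ge0//; exact: wge.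
move=> /allP H; rewrite big1// => i _.
have := H i (mem_index_enum i); rewrite /= /wt pairingZr mulf_eq0 => /orP[/eqP->|i0].
  by rewrite scale0r pairing0r.
rewrite pairingZr; have [/eqP->|/wtp] := boolP (I i); first by rewrite mulr0.
by rewrite /wt (eqP i0) ltxx.
Qed.

(** On generators in the face [u] is already nonnegative; on the others [m] is positive, and a large
    multiple of it compensates [u]. So the dual monoid of the face arises by inverting [m]. *)
Lemma face_localization s m u : rational_cone s -> dual_monoid s m ->
  dual_monoid (s `&` [set x | wt x m = 0]) u -> exists N, dual_monoid s (u + m *+ N).
Proof.
move=> [[r [v sE]] _] sm tu.
have H i : exists N : nat, 0 <= wt (rof (v i)) u + N%:R * wt (rof (v i)) m.
  have := sm _ (cone_gen sE i); rewrite -/(wt _ _) le_eqVlt => /orP[/eqP m0|m0].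
    exists 0%N; rewrite mul0r addr0; apply: tu; split=> //; exact: cone_gen sE i.
  exists (Num.bound `|- wt (rof (v i)) u / wt (rof (v i)) m|).
  rewrite -lerBlDl sub0r -ler_pdivrMr//.
  exact/ltW/(le_lt_trans (ler_norm _))/archi_boundP/normr_ge0.
have [N NP] := choice H; exists (\sum_i N i)%N.
apply/(dual_monoid_gen sE) => i; rewrite wtD wtMn.
apply: le_trans (NP i) _; rewrite lerD2l ler_wpM2r//.
  by apply: sm; exact: cone_gen sE i.
by rewrite ler_nat (bigD1 i)//= leq_addr.
Qed.

End RationalCones.

(** * Closedness of rational cones, and continuity on a union of cones *)

Section Closedness.
Context {R : realType}.

Lemma continuous_row (T : topologicalType) n (f : T -> 'rV[R]_n) :
  (forall j, continuous (fun t => f t 0 j)) -> continuous f.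
Proof.
move=> fj x U [P PU sPU].
have : nbhs x [set y | forall i j, P i j (f y i j)]; last apply: filterS.
  apply: filter_forall => i; apply: filter_forall => j; rewrite ord1.
  by apply: fj; rewrite -(ord1 i); exact: PU.
by move=> y Py; exact: sPU.
Qed.

Lemma continuous_mulmx k n (A : 'M[R]_(k, n)) : continuous (fun x : 'rV[R]_k => x *m A).
Proof.
apply: continuous_row => j.
have -> : (fun x : 'rV[R]_k => (x *m A) 0 j) = (fun x => \sum_i x 0 i * A i j).
  by apply/funext => x; rewrite mxE.
apply: continuous_big => [|i _ x]; first exact: add_continuous.
by apply: (@continuousM R _ (fun y : 'rV[R]_k => y 0 i) (fun=> A i j)); [exact: coord_continuous|exact: cst_continuous].
Qed.

Lemma closed_pairing_ge0 k (m : 'rV[R]_k) : closed [set x | 0 <= pairing m x].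
Proof.
have -> : [set x | 0 <= pairing m x] = (fun x => pairing m x) @^-1` [set y | 0 <= y] by [].
apply: preimage_closed; last exact: closed_ge.
suff H : continuous (fun x => pairing m x) by move=> x _; exact: H.
apply: continuous_big => [|i _ x]; first exact: add_continuous.
by apply: (@continuousM R _ (fun=> m 0 i) (fun y : 'rV[R]_k => y 0 i)); [exact: cst_continuous|exact: coord_continuous].
Qed.

(** By Fourier-Motzkin elimination. *)
Lemma cone_inequalities k r (w : 'I_r -> 'rV[R]_k) : exists M : seq 'rV[R]_k,
  forall x, (exists2 c : 'I_r -> R, (forall i, 0 <= c i) & x = \sum_i c i *: w i) <->
            (forall m, m \in M -> 0 <= pairing m x).
Proof.
elim: r w => [|r IHr] w.
  (* Without generators the cone is {0}, cut out by the coordinates and their negatives. *)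
  exists ([seq delta_mx 0 j | j <- enum 'I_k] ++ [seq - delta_mx 0 j | j <- enum 'I_k]) => x.
  have pE j : pairing (delta_mx 0 j) x = x 0 j.
    rewrite /pairing (bigD1 j)//= mxE !eqxx mul1r big1 ?addr0// => i /negPf ij.
    by rewrite mxE ij andbF mul0r.
  split=> [[c _ ->] m _|H]; first by rewrite big_ord0 pairing0r.
  exists (fun=> 0) => //; rewrite big_ord0; apply/rowP => j; rewrite mxE.
  have H1 : 0 <= x 0 j by rewrite -pE H// mem_cat map_f// mem_enum.
  have H2 : x 0 j <= 0.
    rewrite -oppr_ge0 -pE -pairingNl H// mem_cat; apply/orP; right.
    by apply: map_f; rewrite mem_enum.
  by apply/eqP; rewrite eq_le H1 H2.
have [M MP] := IHr (w \o lift ord0); pose w0 := w ord0.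
pose a m := pairing m w0.
(* A coefficient c >= 0 is sought such that [x - c *: w0] satisfies [M]. Forms negative on [w0]
   bound c from below, positive ones from above. The combinations vanish on [w0] and say that the
   bounds are compatible. *)
exists ([seq m <- M | 0 <= a m] ++
  [seq a m *: m' - a m' *: m | m <- [seq m <- M | 0 < a m], m' <- [seq m <- M | a m < 0]]) => x.
have sumE (c : 'I_r.+1 -> R) : \sum_i c i *: w i =
    c ord0 *: w0 + \sum_i c (lift ord0 i) *: (w \o lift ord0) i.
  by rewrite big_ord_recl.
split.
  move=> [c c0 xE] m; rewrite mem_cat => /orP[|/allpairsP[[m1 m2] /= []]].
    rewrite mem_filter => /andP[am mM]; rewrite xE sumE pairingDr addr_ge0//.
      by rewrite pairingZr mulr_ge0.
    by apply: (MP _).1 mM; exists (fun i => c (lift ord0 i)).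
  rewrite !mem_filter => /andP[am1 m1M] /andP[am2 m2M] ->.
  have H m' : m' \in M -> c ord0 * a m' <= pairing m' x.
    move=> m'M; rewrite xE sumE pairingDr pairingZr lerDl.
    by apply: (MP _).1 m'M; exists (fun i => c (lift ord0 i)).
  rewrite pairingDl pairingNl !pairingZl.
  have := ler_wpM2l (ltW am1) (H _ m2M).
  have := ler_wnM2l (ltW am2) (H _ m1M).
  nra.
(* The largest lower bound, with 0 included because the coefficient must be nonnegative. *)
move=> H; pose c0 := \big[Order.max/0]_(m <- [seq m <- M | a m < 0]) (pairing m x / a m).
have c00 : 0 <= c0.
  by rewrite /c0; elim/big_rec: _ => // m y _ y0; rewrite le_max y0 orbT.
have c0le m : m \in M -> a m < 0 -> pairing m x / a m <= c0.
  move=> mM am; have : m \in [seq m <- M | a m < 0] by rewrite mem_filter am.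
  rewrite /c0; elim: [seq _ <- _ | _] => // m' s IHs; rewrite inE big_cons.
  by move=> /predU1P[->|/IHs]; rewrite le_max ?lexx// => ->; rewrite orbT.
have lec0 m : m \in M -> 0 < a m -> c0 <= pairing m x / a m.
  move=> mM am; rewrite /c0 big_seq; elim/big_ind: _ => [|y z ym zm|m'].
  - apply: divr_ge0 (ltW am); apply: H; rewrite mem_cat mem_filter ltW//= mM//.
  - by rewrite ge_max ym.
  rewrite mem_filter => /andP[am' m'M].
  have := H (a m *: m' - a m' *: m).
  rewrite mem_cat (_ : (_ \in [seq _ | _ <- _, _ <- _]) = true) ?orbT; last first.
    by apply/allpairsP; exists (m, m'); rewrite /= !mem_filter am am'.
  move=> /(_ isT); rewrite pairingDl pairingNl !pairingZl.
  set U := pairing m x / a m; set D := pairing m' x / a m'.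
  have -> : pairing m' x = D * a m' by rewrite divfK// lt_eqF.
  have -> : pairing m x = U * a m by rewrite divfK// gt_eqF.
  have am'm : a m * a m' < 0 by rewrite pmulr_rlt0.
  have -> : a m * (D * a m') - a m' * (U * a m) = (a m * a m') * (D - U) by ring.
  by rewrite nmulr_rge0// subr_le0.
have [c' c'0 E] : exists2 c : 'I_r -> R, (forall i, 0 <= c i) &
    x - c0 *: w0 = \sum_i c i *: (w \o lift ord0) i.
  apply/MP => m mM; rewrite pairingDr pairingNr pairingZr -/(a m) subr_ge0.
  have [am|am|am] := ltgtP (a m) 0.
  - by rewrite -ler_ndivrMr//; exact: c0le.
  - by rewrite -ler_pdivlMr//; exact: lec0.
  - by rewrite am mulr0; apply: H; rewrite mem_cat mem_filter am lexx mM.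
exists (fun i => oapp c' c0 (unlift ord0 i)).
  by move=> i; case: unliftP => [j|] _ /=.
rewrite sumE unlift_none/=; under eq_bigr do rewrite liftK/=.
by rewrite -E addrC subrK.
Qed.

Lemma closed_rational_cone k (s : set 'rV[R]_k) : rational_cone s -> closed s.
Proof.
move=> [[r [v ->]] _]; have [M MP] := cone_inequalities (fun i => real_of (v i)).
have -> : [set x | exists2 c : 'I_r -> R, (forall i, 0 <= c i) & x = \sum_(i < r) c i *: real_of (v i)]
    = \bigcap_(m in [set m | m \in M]) [set x | 0 <= pairing m x].
  by apply/seteqP; split=> x /=; [move=> /MP|move=> H; apply/MP].
by apply: closed_bigI => m _; exact: closed_pairing_ge0.
Qed.

(** Pasting over a finite closed cover; for the cones of a fan it yields continuity on the support
    from linearity on each cone. *)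
Lemma within_bigcup_continuous (T U : topologicalType) (S : set (set T)) (f : T -> U) :
  finite_set S -> (forall s, S s -> closed s) ->
  (forall s, S s -> {within s, continuous f}) ->
  {within \bigcup_(s in S) s, continuous f}.
Proof.
move=> /finite_seqP[l ->]; elim: l => [|s l IHl] cS fS.
  by rewrite classical_sets.set_nil bigcup_set0; apply: continuous_subspace0.
have -> : [set` s :: l] = s |` [set` l].
  by apply/seteqP; split=> t /=; rewrite inE => /predU1P.
rewrite bigcup_setU1; apply: withinU_continuous.
- by apply: cS; rewrite /= mem_head.
- apply: closed_bigcup; first exact: finite_seq.
  by move=> t tl; apply: cS; rewrite /= inE tl orbT.
- by apply: fS; rewrite /= mem_head.
- by apply: IHl => t tl; [apply: cS|apply: fS]; rewrite /= inE tl orbT.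
Qed.

End Closedness.

Section Fans.
Context {R : realType} {k : nat}.
Implicit Types (S : set (set 'rV[R]_k)).

Lemma rational_cone0 (s : set 'rV[R]_k) : rational_cone s -> s 0.
Proof.
by move=> [[r [v ->]] _]; exists (fun=> 0) => //; rewrite big1// => i _; rewrite scale0r.
Qed.

Lemma fan_cone S s : fan S -> S s -> rational_cone s.
Proof. by move=> [_ _ H _ _]; exact: H. Qed.

(** The zero cone is a face of any ray, cut out by pairing with the generator of the ray. If there
    are no rays, spanning forces the whole space to be zero. *)
Lemma fan_zero S : fan S -> rays_span S -> S [set 0].
Proof.
move=> fS spanS; have [_ [s Ss] cS faceS _] := fS.
have [[t [St [v v0 tE]]]|nray] := pselect (exists t, S t /\ ray t).
  apply: (faceS t) => //; exists v; first by move=> x; rewrite tE => -[a a0 ->];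
    rewrite pairingZr mulr_ge0// sumr_ge0// => i _; rewrite -expr2 sqr_ge0.
  apply/seteqP; split=> x /=; first move=> ->.
    by split; [exact: rational_cone0 (cS _ St)|exact: pairing0r].
  move=> [+ x0]; rewrite tE => -[a a0 xE]; move: x0; rewrite xE pairingZr => /eqP.
  rewrite mulf_eq0.
  move=> /orP[/eqP->|]; first by rewrite scale0r.
  rewrite psumr_eq0; last by move=> i _; rewrite -expr2 sqr_ge0.
  move=> /allP H; case/eqP: v0; apply/rowP => i; have := H i (mem_index_enum i).
  by rewrite /= mulf_eq0 orbb mxE => /eqP.
have E x : x = 0 :> 'rV[R]_k.
  have [[|r] [c [w [H ->]]]] := spanS x; first by rewrite big_ord0.
  by have [t [St rt _]] := H ord0; case: nray; exists t.
suff <- : s = [set 0] by [].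
by apply/seteqP; split=> x; rewrite /= (E x)// => _; exact: rational_cone0 (cS _ Ss).
Qed.

End Fans.

(** * Spaces with functions and affine toric varieties *)

Arguments regfun_open {K s U f}.
Arguments regfun_glue {K s U f}.
Arguments regfun_restr {K s U V f}.
Arguments regfun_cst {K s U}.
Arguments regfunD {K s U f g}.
Arguments regfunM {K s U f g}.
Arguments regfunV {K s U f}.

Section FunSpaces.
Context {K : fieldType}.
Implicit Types X Y Z : funSpaceType K.

Lemma regfun_eq X (U : set X) (f g : X -> K) : (forall x, U x -> f x = g x) ->
  regfun U g -> regfun U f.
Proof.
move=> fg rg; apply: regfun_glue => x Ux.
by exists U, g; split.
Qed.

Lemma regfun_local X (U : set X) (f : X -> K) :
  (forall x, U x -> exists V, [/\ V x, V `<=` U & regfun V f]) -> regfun U f.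
Proof.
move=> H; apply: regfun_glue => x /H[V [Vx VU rf]].
by exists V, f; split.
Qed.

Lemma regfun_sum X (U : set X) (I : finType) (f : I -> X -> K) : open U ->
  (forall i, regfun U (f i)) -> regfun U (fun x => \sum_i f i x).
Proof.
move=> oU rf.
have -> : (fun x => \sum_i f i x) = \sum_i f i by apply/funext => x; rewrite fct_sumE.
elim/big_ind: _ => // [|g h]; first exact: regfun_cst.
exact: regfunD.
Qed.

Lemma regfun_prod X (U : set X) (I : finType) (f : I -> X -> K) : open U ->
  (forall i, regfun U (f i)) -> regfun U (fun x => \prod_i f i x).
Proof.
move=> oU rf; suff H (s : seq I) : regfun U (fun x => \prod_(i <- s) f i x) by [].
elim: s => [|i s IHs].
  by apply: regfun_eq (regfun_cst 1 oU) => x _; rewrite big_nil.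
by apply: regfun_eq (regfunM (rf i) IHs) => x _; rewrite big_cons.
Qed.

Lemma regfun_exp X (U : set X) (f : X -> K) n : regfun U f -> regfun U (fun x => f x ^+ n).
Proof.
move=> rf; elim: n => [|n IHn].
  exact: regfun_eq (regfun_cst 1 (regfun_open rf)).
by apply: regfun_eq (regfunM rf IHn) => x _; rewrite exprS.
Qed.

Lemma regfun_inv X (U : set X) (f : X -> K) : regfun U f -> (forall x, U x -> f x != 0) ->
  regfun U (fun x => (f x)^-1).
Proof.
move=> rf f0; have := regfunV rf; congr regfun.
by apply/seteqP; split=> [x []|x Ux] //; split=> //; exact: f0.
Qed.

Lemma morphism_on_open X Y (U : set X) (f : X -> Y) V :
  morphism_on U f -> open V -> open (U `&` f @^-1` V).
Proof. by move=> mf oV; exact: regfun_open (mf V _ (regfun_cst 0 oV)). Qed.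

Lemma morphism_on_sub X Y (U V : set X) (f : X -> Y) : open V -> V `<=` U ->
  morphism_on U f -> morphism_on V f.
Proof.
move=> oV VU mf W g rg; apply: regfun_restr (mf W g rg).
  have -> : V `&` f @^-1` W = V `&` (U `&` f @^-1` W).
    by apply/seteqP; split=> x [Vx] => [Wx|[_ Wx]]; split=> //; split=> //; exact: VU.
  by apply: openI => //; exact: morphism_on_open mf (regfun_open rg).
by move=> x [/VU ? ?]; split.
Qed.

Lemma morphism_on_local X Y (U : set X) (f : X -> Y) :
  (forall x, U x -> exists V, [/\ V x, V `<=` U & morphism_on V f]) -> morphism_on U f.
Proof.
move=> H W g rg; apply: regfun_local => x [/H[V [Vx VU mf]] Wx].
exists (V `&` f @^-1` W); split=> //; last exact: mf.
by move=> y [/VU ? ?]; split.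
Qed.

Lemma morphism_on_eq X Y (U : set X) (f g : X -> Y) : (forall x, U x -> f x = g x) ->
  morphism_on U g -> morphism_on U f.
Proof.
move=> fg mg W h rh.
have -> : U `&` f @^-1` W = U `&` g @^-1` W.
  by apply/seteqP; split=> x [Ux /=]; rewrite fg.
by apply: regfun_eq (mg W h rh) => x [Ux _] /=; rewrite fg.
Qed.

Lemma morphism_on_comp X Y Z (U : set X) (V : set Y) (f : X -> Y) (g : Y -> Z) :
  morphism_on U f -> morphism_on V g -> morphism_on (U `&` f @^-1` V) (g \o f).
Proof. by move=> mf mg W h /mg/mf; rewrite preimage_setI setIA. Qed.

Lemma morphism_comp X Y Z (U : set X) (f : X -> Y) (g : Y -> Z) :
  morphism_on U f -> morphism g -> morphism_on U (g \o f).
Proof.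
by move=> mf mg; have := morphism_on_comp mf mg; rewrite preimage_setT setIT.
Qed.

Lemma morphism_regfun X Y (f : X -> Y) V g : morphism f -> regfun V g ->
  regfun (f @^-1` V) (g \o f).
Proof. by move=> mf /mf; rewrite setTI. Qed.

Lemma morphism_open X Y (f : X -> Y) V : morphism f -> open V -> open (f @^-1` V).
Proof. by move=> mf /(morphism_on_open mf); rewrite setTI. Qed.

Lemma vprod_regfunP X Y (W : set (vprod X Y)) (h : vprod X Y -> K) : regfun W h <->
  forall u, W u -> exists V a b, [/\ prod_gen V a, prod_gen V b, V u, b u != 0 &
    forall y, V y -> b y != 0 -> W y /\ h y = a y / b y].
Proof. by []. Qed.

Lemma prod_gen_regfun X Y (U : set X) (V : set Y) (f : X -> K) (g : Y -> K) :
  regfun U f -> regfun V g -> regfun (U `*` V : set (vprod X Y)) (fun u => f u.1 * g u.2).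
Proof.
move=> rf rg; apply/vprod_regfunP => u UVu.
have gen (a : X -> K) (b : Y -> K) : regfun U a -> regfun V b ->
    prod_gen (U `*` V) (fun u : vprod X Y => a u.1 * b u.2).
  move=> ra rb; exists U, V, 1%N, (fun=> a), (fun=> b); split=> //.
    by split; [exact: regfun_open rf|exact: regfun_open rg].
  by apply/funext => y; rewrite big_ord1.
exists (U `*` V), (fun u => f u.1 * g u.2), (fun=> 1 * 1); split=> //.
- exact: gen.
- by apply: (gen (fun=> 1) (fun=> 1)); apply: regfun_cst; [exact: regfun_open rf|exact: regfun_open rg].
- by rewrite mulr1 oner_neq0.
- by move=> y UVy _; rewrite mulr1 divr1.
Qed.

Lemma vprod_fst X Y : morphism (fst : vprod X Y -> X).
Proof.
move=> U f rf; rewrite setTI.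
have := prod_gen_regfun rf (regfun_cst (1 : K) (@openT Y)).
rewrite (_ : _ `*` _ = fst @^-1` U); last by apply/seteqP; split=> u // [].
by apply: regfun_eq => u _; rewrite mulr1.
Qed.

Lemma vprod_snd X Y : morphism (snd : vprod X Y -> Y).
Proof.
move=> U f rf; rewrite setTI.
have := prod_gen_regfun (regfun_cst (1 : K) (@openT X)) rf.
rewrite (_ : _ `*` _ = snd @^-1` U); last by apply/seteqP; split=> u // [].
by apply: regfun_eq => u _; rewrite mul1r.
Qed.

(** The universal property of the product: the generating functions pull back to sums of products of
    regular functions. *)
Lemma morphism_pair X Y Z (U : set Z) (f : Z -> X) (g : Z -> Y) :
  morphism_on U f -> morphism_on U g ->
  morphism_on U (fun z => (f z, g z) : vprod X Y).
Proof.
move=> mf mg W h /vprod_regfunP rh; apply: regfun_glue => z [Uz /= Wz].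
have [V [a [b [ga gb Vz bz abV]]]] := rh _ Wz.
have rgen c : prod_gen V c -> regfun (U `&` (fun z => (f z, g z) : vprod X Y) @^-1` V)
    (fun z => c (f z, g z)).
  move=> [A [B [r [f' [g' [VE [oA oB] rf' rg' ->]]]]]].
  have VE' : U `&` (fun z => (f z, g z) : vprod X Y) @^-1` V = (U `&` f @^-1` A) `&` (U `&` g @^-1` B).
    by rewrite VE; apply/seteqP; split=> [y [Uy [/= ? ?]]|y [[Uy ?] [_ ?]]].
  have oV : open ((U `&` f @^-1` A) `&` (U `&` g @^-1` B)).
    by apply: openI; exact: morphism_on_open.
  rewrite VE'; apply: regfun_sum => // i; apply: regfunM.
    by apply: regfun_restr (mf _ _ (rf' i)) => // y [].
  by apply: regfun_restr (mg _ _ (rg' i)) => // y [].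
have ra := rgen _ ga; have rb := rgen _ gb.
have rbV := regfunV rb.
exists (U `&` (fun z => (f z, g z) : vprod X Y) @^-1` V `&` [set z | b (f z, g z) != 0]),
  (fun z => a (f z, g z) * (b (f z, g z))^-1); split=> //.
- by move=> y [[Uy Vy] /= b_y]; split=> //; have [] := abV _ Vy b_y.
- apply: regfunM => //; apply: regfun_restr ra; first exact: regfun_open rbV.
  by move=> y [].
- by move=> y [[Uy Vy] /= b_y]; have [] := abV _ Vy b_y.
Qed.

End FunSpaces.

(** * Regular functions on affine toric varieties *)

Section AffineToric.
Context {R : realType} {k : nat}.
Implicit Types (s t : set 'rV[R]_k) (m u : 'rV[int]_k).

Lemma aff_eq s (x y : aff_toric s) : (forall m, dual_monoid s m -> x m = y m) -> x = y.
Proof.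
move=> H; have {}H : aff_val x = aff_val y.
  apply/funext => m; have [/H//|sm] := pselect (dual_monoid s m).
  by rewrite !aff_val_out.
case: x y H => x x0 xD xo [y y0 yD yo] /= E; subst y.
by congr AffToric; exact: Prop_irrelevance.
Qed.

(** The coordinate ring C[S_s] *)
Definition aff_poly s (a : aff_toric s -> R[i]) := aff_gen setT a.

Lemma aff_polyP s (a : aff_toric s -> R[i]) : aff_poly a <->
  exists (r : nat) (c : 'I_r -> R[i]) (m : 'I_r -> 'rV[int]_k),
    (forall i, dual_monoid s (m i)) /\ a = fun x => \sum_(i < r) c i * x (m i).
Proof. by split=> [[]|]. Qed.

Lemma aff_regfunP s (W : set (aff_toric s)) (f : aff_toric s -> R[i]) : regfun W f <->
  forall x, W x -> exists a b, [/\ aff_poly a, aff_poly b, b x != 0 &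
    forall y, b y != 0 -> W y /\ f y = a y / b y].
Proof.
split=> [rf x Wx|H].
  have [V [a [b [[-> ga] [_ gb] _ bx abV]]]] := rf x Wx.
  by exists a, b; split=> // y b_y; exact: abV.
move=> x Wx; have [a [b [ga gb bx abV]]] := H x Wx.
by exists setT, a, b; split=> // y _; exact: abV.
Qed.

Lemma aff_openP s (W : set (aff_toric s)) : open W <->
  forall x, W x -> exists a, [/\ aff_poly a, a x != 0 & forall y, a y != 0 -> W y].
Proof.
split=> [oW x Wx|H].
  have [V [a [[-> ga] _ ax aW]]] := oW x Wx.
  by exists a; split=> // y; exact: aW.
move=> x Wx; have [a [ga ax aW]] := H x Wx.
by exists setT, a; split=> // y _; exact: aW.
Qed.

Lemma aff_poly_char s m : dual_monoid s m -> aff_poly (fun x : aff_toric s => x m).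
Proof.
move=> sm; apply/aff_polyP; exists 1%N, (fun=> 1), (fun=> m); split=> //.
by apply/funext => x; rewrite big_ord1 mul1r.
Qed.

Lemma aff_poly_sum s (I : finType) (c : I -> R[i]) (m : I -> 'rV[int]_k) :
  (forall i, dual_monoid s (m i)) ->
  aff_poly (fun x : aff_toric s => \sum_i c i * x (m i)).
Proof.
move=> sm; apply/aff_polyP; exists #|I|, (c \o enum_val), (m \o enum_val).
split=> [i|]; first exact: sm.
apply/funext => x; rewrite (reindex (fun i : 'I_#|I| => enum_val i))//.
by exists enum_rank => i _; rewrite ?enum_valK ?enum_rankK.
Qed.

Lemma aff_polyM s (a b : aff_toric s -> R[i]) : aff_poly a -> aff_poly b ->
  aff_poly (fun x => a x * b x).
Proof.
move=> /aff_polyP[r [c [m [sm ->]]]] /aff_polyP[r' [c' [m' [sm' ->]]]].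
have -> : (fun x : aff_toric s => (\sum_(i < r) c i * x (m i)) * (\sum_(i < r') c' i * x (m' i))) =
    (fun x => \sum_(i : 'I_r * 'I_r') (c i.1 * c' i.2) * x (m i.1 + m' i.2)).
  apply/funext => x; rewrite big_distrlr/= pair_bigA/=.
  by apply: eq_bigr => i _; rewrite mulrACA (aff_valD x (sm _) (sm' _)).
by apply: aff_poly_sum => i; exact: dual_monoidD.
Qed.

Lemma aff_poly_cst s c : aff_poly (fun _ : aff_toric s => c).
Proof.
have -> : (fun=> c) = (fun x : aff_toric s => \sum_(i : 'I_1) c * x 0).
  by apply/funext => x; rewrite big_ord1 aff_val0 mulr1.
by apply: aff_poly_sum => _; exact: dual_monoid0.
Qed.

Lemma aff_poly_exp s (a : aff_toric s -> R[i]) n : aff_poly a -> aff_poly (fun x => a x ^+ n).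
Proof.
move=> ga; elim: n => [|n IHn]; first exact: aff_poly_cst.
have -> : (fun x => a x ^+ n.+1) = (fun x => a x * a x ^+ n).
  by apply/funext => x; rewrite exprS.
exact: aff_polyM.
Qed.

Lemma aff_poly_regfun s (a : aff_toric s -> R[i]) : aff_poly a -> regfun setT a.
Proof.
move=> ga; apply/aff_regfunP => x _; exists a, (fun=> 1); split=> //.
- exact: aff_poly_cst.
- exact: oner_neq0.
- by move=> y _; rewrite divr1.
Qed.

Lemma aff_char_regfun s m : regfun setT (fun x : aff_toric s => x m).
Proof.
have [sm|sm] := pselect (dual_monoid s m); first exact/aff_poly_regfun/aff_poly_char.
by apply: regfun_eq (regfun_cst 0 openT) => x _; rewrite aff_val_out.
Qed.

(** The characters in S_s span the coordinate ring, whose quotients are locally all regular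
    functions. *)
Lemma morphism_to_aff (Z : funSpaceType R[i]) s (U : set Z) (f : Z -> aff_toric s) :
  open U -> (forall m, dual_monoid s m -> regfun U (fun z => f z m)) -> morphism_on U f.
Proof.
move=> oU rf W g /aff_regfunP rg.
have rpoly a : aff_poly a -> regfun U (a \o f).
  move=> /aff_polyP[r [c [m [sm ->]]]] /=; apply: regfun_sum => // i.
  by apply: regfunM; [exact: regfun_cst|exact: rf].
apply: regfun_glue => z [Uz /= Wz]; have [a [b [ga gb bz abW]]] := rg _ Wz.
have rb := rpoly b gb; have rbV := regfunV rb.
exists (U `&` [set z | b (f z) != 0]), (fun z => a (f z) * (b (f z))^-1); split=> //.
- by move=> y [Uy /= b_y]; split=> //; have [] := abW _ b_y.
- apply: regfunM => //; apply: regfun_restr (rpoly a ga); last by move=> y [].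
  exact: regfun_open rbV.
- by move=> y [Uy /= b_y]; have [] := abW _ b_y.
Qed.

Lemma aff_poly_open s (a : aff_toric s -> R[i]) : aff_poly a -> open [set x | a x != 0].
Proof. by move=> ga; apply/aff_openP => x ax; exists a; split. Qed.

End AffineToric.

(** * The maps U_t -> U_s for t inside s, and localization at a face *)

Section AffineRestriction.
Context {R : realType} {k : nat}.
Implicit Types (s t : set 'rV[R]_k) (m u : 'rV[int]_k).

Section Restriction.
Variables (s t : set 'rV[R]_k) (ts : t `<=` s) (x : aff_toric t).

Let val m := if pselect (dual_monoid s m) then x m else 0.

Fact aff_restr0 : val 0 = 1.
Proof.
by rewrite /val; case: pselect => [h|h]; [exact: aff_val0|case: h; exact: dual_monoid0].
Qed.

Fact aff_restrD m m' : dual_monoid s m -> dual_monoid s m' -> val (m + m') = val m * val m'.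
Proof.
move=> sm sm'; have smm := dual_monoidD sm sm'; rewrite /val.
do 3! [case: pselect => //= ?]; apply: aff_valD; exact: dual_monoid_sub ts _ _.
Qed.

Fact aff_restr_out m : ~ dual_monoid s m -> val m = 0.
Proof. by rewrite /val; case: pselect. Qed.

(** The toric morphism U_t -> U_s: a monoid morphism on the larger monoid S_t is restricted to S_s
    and again extended by zero. *)
Definition aff_restr : aff_toric s := AffToric aff_restr0 aff_restrD aff_restr_out.

Lemma aff_restrE m : dual_monoid s m -> aff_restr m = x m.
Proof. by move=> sm; rewrite /= /val; case: pselect. Qed.

End Restriction.

Lemma aff_restr_morphism s t (ts : t `<=` s) : morphism (aff_restr ts).
Proof.
apply: morphism_to_aff; first exact: openT.
move=> m sm; apply: (@regfun_eq _ _ _ _ (fun x : aff_toric t => x m)).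
  by move=> x _; exact: aff_restrE.
exact: aff_char_regfun.
Qed.

Section Face.
Variables (s t : set 'rV[R]_k) (m : 'rV[int]_k).
Hypotheses (sc : rational_cone s) (sm : dual_monoid s m).
Hypothesis tE : t = s `&` [set x | wt x m = 0].

Lemma face_sub : t `<=` s. Proof. by rewrite tE => x []. Qed.

Let tm : dual_monoid t m. Proof. exact: dual_monoid_sub face_sub _ sm. Qed.

Let tNm : dual_monoid t (- m).
Proof.
by move=> x; rewrite tE => -[_ /= x0]; rewrite -/(wt x (- m)) wtN x0 oppr0.
Qed.

(** Both [m] and [- m] are nonnegative on the face, so the character is a unit there. *)
Lemma aff_face_neq0 (x : aff_toric t) : x m != 0.
Proof.
have : x m * x (- m) = 1 by rewrite -aff_valD// subrr aff_val0.
by move=> E; apply/eqP => x0; move: E; rewrite x0 mul0r => /eqP; rewrite eq_sym oner_eq0.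
Qed.

Lemma dual_monoidMn (w : set 'rV[R]_k) u N : dual_monoid w u -> dual_monoid w (u *+ N).
Proof.
move=> wu; elim: N => [|N IHN]; first by rewrite mulr0n; exact: dual_monoid0.
by rewrite mulrS; exact: dual_monoidD.
Qed.

Lemma aff_valX (w : set 'rV[R]_k) (x : aff_toric w) u N : dual_monoid w u -> x (u *+ N) = x u ^+ N.
Proof.
move=> wu; elim: N => [|N IHN]; first by rewrite mulr0n aff_val0.
by rewrite mulrS exprS aff_valD// ?IHN//; exact: dual_monoidMn.
Qed.

Lemma face_loc u : dual_monoid t u -> exists N, dual_monoid s (u + m *+ N).
Proof. by rewrite tE; exact: face_localization. Qed.

Section Extension.
Variables (x : aff_toric s) (xm : x m != 0).

Let val u := if pselect (dual_monoid t u) is left tu then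
  let N := projT1 (cid (face_loc tu)) in x (u + m *+ N) / x m ^+ N else 0.

Let valE u N : dual_monoid t u -> dual_monoid s (u + m *+ N) ->
  val u = x (u + m *+ N) / x m ^+ N.
Proof.
move=> tu suN; rewrite /val; case: pselect => // tu'; case: cid => N' /= suN'.
apply/eqP; rewrite eqr_div ?expf_neq0// -!aff_valX// -!aff_valD//; try exact: dual_monoidMn.
by rewrite addrAC.
Qed.

Fact aff_ext0 : val 0 = 1.
Proof.
rewrite (@valE 0 0); first by rewrite mulr0n addr0 aff_val0 expr0 divr1.
  exact: dual_monoid0.
by rewrite mulr0n addr0; exact: dual_monoid0.
Qed.

Fact aff_extD u u' : dual_monoid t u -> dual_monoid t u' -> val (u + u') = val u * val u'.
Proof.
move=> tu tu'; have [N sN] := face_loc tu; have [N' sN'] := face_loc tu'.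
have E : u + u' + m *+ (N + N') = (u + m *+ N) + (u' + m *+ N') by rewrite mulrnDr addrACA.
rewrite (valE tu sN) (valE tu' sN') (@valE (u + u') (N + N')).
- by rewrite E aff_valD// exprD mulf_div.
- exact: dual_monoidD.
- by rewrite E; exact: dual_monoidD.
Qed.

Fact aff_ext_out u : ~ dual_monoid t u -> val u = 0.
Proof. by rewrite /val; case: pselect. Qed.

(** A point of U_s at which the character [m] does not vanish extends to S_t by x(u + N m) / x(m)^N,
    whatever N is used. Thus U_t is a principal open subset of U_s. *)
Definition aff_ext : aff_toric t := AffToric aff_ext0 aff_extD aff_ext_out.

Lemma aff_extK : aff_restr face_sub aff_ext = x.
Proof.
apply: aff_eq => u su; rewrite aff_restrE//= (@valE u 0) ?mulr0n ?addr0//.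
  by rewrite expr0 divr1.
exact: dual_monoid_sub face_sub _ su.
Qed.

End Extension.

Lemma aff_restr_face_inj : injective (aff_restr face_sub).
Proof.
move=> x y xy; apply: aff_eq => u tu; have [N sN] := face_loc tu.
have E v : aff_restr face_sub x v = aff_restr face_sub y v by rewrite xy.
have := E (u + m *+ N); have := E m; rewrite !aff_restrE// => xym.
have tN : dual_monoid t (m *+ N) by exact: dual_monoidMn.
rewrite !aff_valD// !aff_valX// xym => /mulIf; apply.
by rewrite expf_neq0// aff_face_neq0.
Qed.

Lemma aff_poly_face a : aff_poly a -> exists N b, aff_poly b /\
  forall x : aff_toric t, b (aff_restr face_sub x) = a x * x m ^+ N.
Proof.
move=> /aff_polyP[r [c [u [tu ->]]]].
have /choice[N NP] : forall i, exists N, dual_monoid s (u i + m *+ N).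
  by move=> i; exact: face_loc.
have sN i : dual_monoid s (u i + m *+ (\sum_j N j)%N).
  rewrite (bigD1 i)//= mulrnDr addrA; apply: dual_monoidD => //.
  exact: dual_monoidMn.
exists (\sum_j N j)%N, (fun x => \sum_i c i * x (u i + m *+ (\sum_j N j)%N)).
split; first exact: aff_poly_sum.
move=> x; rewrite mulr_suml; apply: eq_bigr => i _; rewrite aff_restrE//.
by rewrite aff_valD// ?aff_valX// ?mulrA//; exact: dual_monoidMn.
Qed.

Lemma aff_restr_face_open (U : set (aff_toric t)) : open U -> open (aff_restr face_sub @` U).
Proof.
move=> /aff_openP oU; apply/aff_openP => _ [x Ux <-].
have [a [ga ax aU]] := oU x Ux; have [N [b [gb bE]]] := aff_poly_face ga.
(* The factor [y m] confines the open set to the image of U_t. *)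
exists (fun y => b y * y m); split.
- by apply: aff_polyM => //; exact: aff_poly_char.
- by rewrite bE aff_restrE// !mulf_neq0// ?expf_neq0// aff_face_neq0.
move=> y; rewrite mulf_eq0 negb_or => /andP[b_y ym].
exists (aff_ext ym); last exact: aff_extK.
apply: aU; have := bE (aff_ext ym); rewrite aff_extK => E.
by move: b_y; rewrite E mulf_eq0 negb_or => /andP[].
Qed.

Lemma aff_restr_face_regfun (U : set (aff_toric t)) (g : aff_toric s -> R[i]) :
  regfun U (g \o aff_restr face_sub) -> regfun (aff_restr face_sub @` U) g.
Proof.
move=> /aff_regfunP rg; apply/aff_regfunP => _ [x Ux <-].
have [a [b [ga gb bx abU]]] := rg x Ux.
have [N [a' [ga' a'E]]] := aff_poly_face ga; have [M [b' [gb' b'E]]] := aff_poly_face gb.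
have gm : aff_poly (fun x : aff_toric s => x m) by exact: aff_poly_char.
(* The exponents [N] and [M] are exchanged to balance the two denominators; the successors make the
   new denominator vanish off the image of U_t. *)
exists (fun y => a' y * y m ^+ M.+1), (fun y => b' y * y m ^+ N.+1).
split; [by apply: aff_polyM => //; exact: aff_poly_exp|by apply: aff_polyM => //; exact: aff_poly_exp| |].
  by rewrite b'E aff_restrE// !mulf_neq0// ?expf_neq0// ?aff_face_neq0.
move=> y; rewrite mulf_eq0 negb_or expf_eq0/= => /andP[b_y ym].
have yE := aff_extK ym; move: (aff_ext ym) yE => z zE; subst y.
have bz : b z != 0 by move: b_y; rewrite b'E mulf_eq0 negb_or => /andP[].
have [Uz gz] := abU z bz; split; first by exists z.
have zm := aff_face_neq0 z.
rewrite aff_restrE// in ym *; have {}gz : g (aff_restr face_sub z) = a z / b z := gz.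
rewrite gz a'E b'E.
have pN := expf_neq0 N ym; have pM := expf_neq0 M ym; rewrite !exprS.
by field; rewrite bz ym pN pM.
Qed.

End Face.
End AffineRestriction.

(** * Charts of toric varieties *)

Section QuotPoints.
Variables (X : Type) (e : X -> X -> Prop).

Lemma quot_eq (C D : quot e) : proj1_sig C = proj1_sig D -> C = D.
Proof.
case: C D => [C CP] [D DP] /= E; subst D; congr exist; exact: Prop_irrelevance.
Qed.

Lemma of_quotK (C : quot e) : to_quot e (of_quot C) = C.
Proof. by apply: quot_eq; rewrite /of_quot /=; case: cid. Qed.

Hypotheses (erefl : forall x, e x x) (esym : forall x y, e x y -> e y x).
Hypothesis etrans : forall x y z, e x y -> e y z -> e x z.

Lemma to_quotP x y : to_quot e x = to_quot e y <-> e x y.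
Proof.
split=> [E|xy]; last first.
  apply: quot_eq; apply/funext => z; apply/propext; split; last exact: etrans xy.
  exact/etrans/esym.
have := congr1 (@proj1_sig _ _) E => /= {}E.
by have := erefl y; rewrite -E.
Qed.

End QuotPoints.

Section ToricVarieties.
Context {R : realType} {k : nat}.
Implicit Types (s t : set 'rV[R]_k).
Variable S : set (set 'rV[R]_k).

Definition cone_index s (Ss : S s) : S := exist _ s (mem_set Ss).

Definition chart_point s (Ss : S s) (x : aff_toric s) : toric_charts S :=
  existT (fun i : S => aff_toric (set_val i)) (cone_index Ss) x.

Definition chart s (Ss : S s) (x : aff_toric s) : toric_variety S :=
  to_quot (@glued R k S) (chart_point Ss x).

Lemma toric_charts_case (p : toric_charts S) : exists s (Ss : S s) x, p = chart_point Ss x.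
Proof.
case: p => [[s Ss] x]; exists s, (set_mem Ss), x.
rewrite /chart_point /cone_index; have E := Prop_irrelevance (mem_set (set_mem Ss)) Ss.
rewrite E. reflexivity.
Qed.

Lemma glued_chartP s t (Ss : S s) (St : S t) x y : glued (chart_point Ss x) (chart_point St y) <->
  exists z : aff_toric (s `&` t), x = aff_restr (@subIsetl _ s t) z /\ y = aff_restr (@subIsetr _ s t) z.
Proof.
split=> [[z [/= xz yz]]|[z [-> ->]]].
  exists z; split; apply: aff_eq => m sm; rewrite aff_restrE//; [exact: xz|exact: yz].
by exists z; split=> m sm; exact: aff_restrE.
Qed.

Hypothesis fanS : fan S.

Lemma glued_refl (p : toric_charts S) : glued p p.
Proof.
have [s [Ss [x ->]]] := toric_charts_case p; apply/glued_chartP.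
have ss : s `<=` s `&` s by rewrite setIid.
by exists (aff_restr ss x); split; apply: aff_eq => m sm; rewrite !aff_restrE ?setIid.
Qed.

Lemma glued_sym (p q : toric_charts S) : glued p q -> glued q p.
Proof.
have [s [Ss [x ->]]] := toric_charts_case p; have [t [St [y ->]]] := toric_charts_case q.
move=> /glued_chartP[z [xE yE]]; apply/glued_chartP.
have st : s `&` t `<=` t `&` s by rewrite setIC.
exists (aff_restr st z).
by rewrite xE yE; split; apply: aff_eq => m sm; rewrite !aff_restrE//;
  apply: dual_monoid_sub sm; [exact: subIsetl|exact: subIsetr].
Qed.

Lemma fan_face_integral s t : S s -> S t -> exists m, dual_monoid s m /\ s `&` t = s `&` [set x | wt x m = 0].
Proof.
move=> Ss St; have [_ _ _ _ faceI] := fanS; have [f1 _] := faceI _ _ Ss St.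
exact: face_integral (fan_cone fanS Ss) f1.
Qed.

(** In U_s2 the two overlaps are the nonvanishing loci of characters [m] and [n]. A point in both
    lies in that of [m + n], which is the affine toric variety of the triple intersection. *)
Lemma glued_trans (p q r : toric_charts S) : glued p q -> glued q r -> glued p r.
Proof.
have [s1 [Ss1 [x ->]]] := toric_charts_case p; have [s2 [Ss2 [y ->]]] := toric_charts_case q.
have [s3 [Ss3 [z ->]]] := toric_charts_case r.
move=> /glued_chartP[a [xE yE]] /glued_chartP[b [yE' zE]]; apply/glued_chartP.
have [m [sm tE]] := fan_face_integral Ss2 Ss1; have [n [sn uE]] := fan_face_integral Ss2 Ss3.
have wE : s1 `&` s2 `&` s3 = s2 `&` [set x | wt x (m + n) = 0].
  apply/seteqP; split=> v.
    move=> [[s1v s2v] s3v]; split=> //=; rewrite wtD.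
    have [_ /= ->] : (s2 `&` [set x | wt x m = 0]) v by rewrite -tE.
    have [_ /= ->] : (s2 `&` [set x | wt x n = 0]) v by rewrite -uE.
    by rewrite addr0.
  move=> [sv /=]; rewrite wtD => /eqP; rewrite paddr_eq0; [|exact: sm|exact: sn].
  move=> /andP[/eqP m0 /eqP n0].
  have [_ s1v] : (s2 `&` s1) v by rewrite tE.
  have [_ s3v] : (s2 `&` s3) v by rewrite uE.
  by [].
have ym : y m != 0.
  have E : s1 `&` s2 = s2 `&` [set x | wt x m = 0] by rewrite setIC.
  by rewrite yE aff_restrE//; exact: aff_face_neq0 sm E a.
have yn : y n != 0 by rewrite yE' aff_restrE//; exact: aff_face_neq0 sn uE b.
have smn := dual_monoidD sm sn.
have ymn : y (m + n) != 0 by rewrite aff_valD// mulf_neq0.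
pose c := aff_ext (fan_cone fanS Ss2) smn wE ymn.
have cE : aff_restr (face_sub wE) c = y by exact: aff_extK.
have s12 : s1 `&` s2 `&` s3 `<=` s1 `&` s2 by exact: subIsetl.
have s23 : s1 `&` s2 `&` s3 `<=` s2 `&` s3 by move=> v [[]].
have s13 : s1 `&` s2 `&` s3 `<=` s1 `&` s3 by move=> v [[]].
have aE : a = aff_restr s12 c.
  have E : s1 `&` s2 = s2 `&` [set x | wt x m = 0] by rewrite setIC.
  apply: (aff_restr_face_inj (fan_cone fanS Ss2) sm (tE := E)).
  have -> : aff_restr (face_sub E) a = y.
    by rewrite yE; apply: aff_eq => u su; rewrite !aff_restrE.
  rewrite -cE; apply: aff_eq => u su; rewrite !aff_restrE//.
  exact: dual_monoid_sub (@subIsetr _ _ _) _ su.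
have bE : b = aff_restr s23 c.
  apply: (aff_restr_face_inj (fan_cone fanS Ss2) sn (tE := uE)).
  have -> : aff_restr (face_sub uE) b = y.
    by rewrite yE'; apply: aff_eq => u su; rewrite !aff_restrE.
  rewrite -cE; apply: aff_eq => u su; rewrite !aff_restrE//.
  exact: dual_monoid_sub (@subIsetl _ _ _) _ su.
exists (aff_restr s13 c); rewrite xE zE aE bE; split; apply: aff_eq => u su; rewrite !aff_restrE//;
  by apply: dual_monoid_sub su => v [].
Qed.

Lemma chart_eqP s t (Ss : S s) (St : S t) x y : chart Ss x = chart St y <->
  exists z : aff_toric (s `&` t), x = aff_restr (@subIsetl _ s t) z /\ y = aff_restr (@subIsetr _ s t) z.
Proof.
rewrite /chart -glued_chartP.
exact: (to_quotP glued_refl glued_sym glued_trans).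
Qed.

Lemma toric_variety_case (p : toric_variety S) : exists s (Ss : S s) x, p = chart Ss x.
Proof.
rewrite -(of_quotK p); have [s [Ss [x ->]]] := toric_charts_case (of_quot p).
by exists s, Ss, x.
Qed.

Lemma chart_inj s (Ss : S s) : injective (chart Ss).
Proof. by move=> x y /chart_eqP[z [-> ->]]; apply: aff_eq => m sm; rewrite !aff_restrE. Qed.

Lemma chart_irrelevance s (Ss Ss' : S s) x : chart Ss x = chart Ss' x.
Proof. by rewrite (Prop_irrelevance Ss Ss'). Qed.

Lemma chart_restr s t (Ss : S s) (St : S t) (ts : t `<=` s) x :
  chart Ss (aff_restr ts x) = chart St x.
Proof.
apply/chart_eqP; have tst : t `<=` s `&` t by move=> v tv; split=> //; exact: ts.
exists (aff_restr tst x); split; apply: aff_eq => m sm; rewrite !aff_restrE//.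
  by apply: dual_monoid_sub sm; exact: subIsetl.
by apply: dual_monoid_sub sm; exact: subIsetr.
Qed.

Lemma toric_regfunP (U : set (toric_variety S)) (f : toric_variety S -> R[i]) :
  regfun U f <-> forall s (Ss : S s), regfun (chart Ss @^-1` U) (f \o chart Ss).
Proof.
split=> [rf s Ss|H]; first exact: (rf (cone_index Ss)).
suff HS (i : S) : regfun ((to_quot (@glued R k S) \o existT (fun i : S => aff_toric (set_val i)) i) @^-1` U)
    (f \o (to_quot (@glued R k S) \o existT (fun i : S => aff_toric (set_val i)) i)) by exact: HS.
case: i => s Ss; have := H s (set_mem Ss); rewrite /chart /chart_point /cone_index.
by rewrite (Prop_irrelevance (mem_set (set_mem Ss)) Ss).
Qed.

Lemma toric_openP (U : set (toric_variety S)) :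
  open U <-> forall s (Ss : S s), open (chart Ss @^-1` U).
Proof.
split=> [oU s Ss|H].
  by have /toric_regfunP/(_ s Ss)/regfun_open := regfun_cst (0 : R[i]) oU.
have /regfun_open// : regfun U (fun _ : toric_variety S => 0 : R[i]).
by apply/toric_regfunP => s Ss; exact: regfun_cst (H s Ss).
Qed.

Lemma chart_morphism s (Ss : S s) : morphism (chart Ss).
Proof. by move=> U f /toric_regfunP rf; rewrite setTI; exact: rf. Qed.

Lemma chart_preimage s t (Ss : S s) (St : S t) (U : set (aff_toric s)) :
  chart St @^-1` (chart Ss @` U) =
  aff_restr (@subIsetr _ s t) @` (aff_restr (@subIsetl _ s t) @^-1` U).
Proof.
apply/seteqP; split=> [y /= [x Ux /chart_eqP[z [xE yE]]]|_ [z /= Uz <-]].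
  by exists z; [rewrite /= -xE|].
by exists (aff_restr (@subIsetl _ s t) z) => //; apply/chart_eqP; exists z.
Qed.

(** Seen in another chart U_t, the image of U_s is the overlap of the two charts, a localization of
    U_t at a face; this reduces openness and regularity to the affine case. *)
Lemma chart_open_immersion s (Ss : S s) : open_immersion (chart Ss).
Proof.
have face t (St : S t) : exists m (tm : dual_monoid t m) (tE : s `&` t = t `&` [set x | wt x m = 0]),
    @subIsetr _ s t = face_sub tE.
  have [m [tm tE]] := fan_face_integral St Ss; rewrite setIC in tE.
  by exists m, tm, tE; exact: Prop_irrelevance.
split.
- exact: chart_inj.
- exact: chart_morphism.
- move=> U oU; apply/toric_openP => t St; rewrite chart_preimage.
  have [m [tm [tE ->]]] := face t St.
  apply: (aff_restr_face_open (fan_cone fanS St) tm).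
  apply: (@morphism_open _ _ _ (aff_restr (@subIsetl _ s t)) U _ oU); exact: aff_restr_morphism.
- move=> U g oU rg; apply/toric_regfunP => t St; rewrite chart_preimage.
  have [m [tm [tE E]]] := face t St; rewrite E.
  apply: (aff_restr_face_regfun (fan_cone fanS St) tm).
  apply: (@regfun_eq _ _ _ _ ((g \o chart Ss) \o aff_restr (@subIsetl _ s t))); last first.
    by apply: (@morphism_regfun _ _ _ (aff_restr (@subIsetl _ s t)) U _ _ rg); exact: aff_restr_morphism.
  move=> z Uz; rewrite /comp.
  congr g; symmetry; apply/chart_eqP; exists z; split=> //.
  by rewrite E.
Qed.

Definition chart_dom s (Ss : S s) : set (toric_variety S) := range (chart Ss).

Lemma chart_dom_open s (Ss : S s) : open (chart_dom Ss).
Proof. by have [_ _ H _] := chart_open_immersion Ss; apply: H; exact: openT. Qed.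

Lemma toric_char_regfun s (Ss : S s) (f : toric_variety S -> R[i]) m :
  (forall x, f (chart Ss x) = x m) -> regfun (chart_dom Ss) f.
Proof.
move=> fE; have [_ _ _ H] := chart_open_immersion Ss; apply: H; first exact: openT.
apply: (@regfun_eq _ _ _ _ (fun x : aff_toric s => x m)); last exact: aff_char_regfun.
by move=> x _; exact: fE.
Qed.

Lemma morphism_to_toric (Z : funSpaceType R[i]) (U : set Z) (f : Z -> toric_variety S) :
  (forall z, U z -> exists V s (Ss : S s) (w : Z -> aff_toric s), [/\ V z, V `<=` U,
     morphism_on V w & forall y, V y -> f y = chart Ss (w y)]) ->
  morphism_on U f.
Proof.
move=> H; apply: morphism_on_local => z /H[V [s [Ss [w [Vz VU mw fw]]]]].
exists V; split=> //; apply: morphism_on_eq fw _.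
exact: morphism_comp mw (@chart_morphism s Ss).
Qed.

Lemma aff_act_restr s t (ts : t `<=` s) (u : torus R k) x :
  aff_act u (aff_restr ts x) = aff_restr ts (aff_act u x).
Proof.
apply: aff_eq => m sm; rewrite [RHS]aff_restrE//.
by transitivity (u m * aff_restr ts x m) => //; rewrite aff_restrE.
Qed.

Lemma toric_act_chart (u : torus R k) s (Ss : S s) x :
  toric_act u (chart Ss x) = chart Ss (aff_act u x).
Proof.
rewrite /toric_act; move: (of_quotK (chart Ss x)).
have [t [St [y ->]]] := toric_charts_case (of_quot (chart Ss x)).
rewrite -/(chart St y) => /chart_eqP[z [-> ->]].
rewrite -/(chart_point St (aff_act u (aff_restr (@subIsetl _ t s) z))) -/(chart St _).
by apply/chart_eqP; exists (aff_act u z); rewrite !aff_act_restr.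
Qed.

Lemma torus_char_regfun (m : 'rV[int]_k) : regfun setT (fun u : torus R k => u m).
Proof. exact: aff_char_regfun. Qed.

Lemma toric_regular_action : regular_action (@toric_act R k S).
Proof.
split.
- move=> p; have [s [Ss [x ->]]] := toric_variety_case p; rewrite toric_act_chart.
  by congr chart; apply: aff_eq => m sm /=; rewrite mul1r.
- move=> t u p; have [s [Ss [x ->]]] := toric_variety_case p; rewrite !toric_act_chart.
  by congr chart; apply: aff_eq => m sm /=; rewrite mulrA.
- apply: morphism_to_toric => -[u p] _; have [s [Ss [x pE]]] := toric_variety_case p.
  have /choice[w wE] : forall p, exists x, chart_dom Ss p -> p = chart Ss x.
    move=> q; have [[y _ <-]|nq] := pselect (chart_dom Ss q); first by exists y.
    by exists x.
  have oV := @morphism_open _ _ _ _ _ (@vprod_snd _ (torus R k) (toric_variety S))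
    (@chart_dom_open s Ss).
  exists (snd @^-1` chart_dom Ss), s, Ss, (fun v => aff_act v.1 (w v.2)); split=> //.
  + by exists x.
  + apply: morphism_to_aff => // m sm; apply: regfunM.
      apply: regfun_restr (morphism_regfun (@vprod_fst _ _ _) (torus_char_regfun m)) => //.
    have rw : regfun (chart_dom Ss) (fun p => w p m).
      apply: toric_char_regfun => y; congr (aff_val _ m).
      by apply: chart_inj; rewrite -wE//; exists y.
    exact: morphism_regfun (@vprod_snd _ _ _) rw.
  + by move=> [t q] /= /wE qE; rewrite {1}qE toric_act_chart.
Qed.

End ToricVarieties.

(** * Laurent polynomials on affine toric varieties *)

Section Laurent.
Context {R : realType} {k : nat}.
Local Notation C := R[i].
Local Notation P := (mpoly k C).
Local Notation supp := (@msupp k C).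
Local Notation T := (torus R k).
Implicit Types (p q A : P) (b : multinom k) (t : T).

Lemma torusD t m m' : t (m + m') = t m * t m'.
Proof. by apply: aff_valD; exact: dual_monoid_torus. Qed.

Lemma torus_neq0 t m : t m != 0.
Proof.
have : t m * t (- m) = 1 by rewrite -torusD subrr aff_val0.
by move=> E; apply/eqP => t0; move: E; rewrite t0 mul0r => /eqP; rewrite eq_sym oner_eq0.
Qed.

Lemma torusN t m : t (- m) = (t m)^-1.
Proof.
apply: (mulfI (torus_neq0 t m)); rewrite -torusD subrr aff_val0 mulfV//.
exact: torus_neq0.
Qed.

Lemma torusB t m m' : t (m - m') = t m / t m'.
Proof. by rewrite torusD torusN. Qed.

Definition tcoord t (j : 'I_k) : C := t (delta_mx 0 j).

Lemma torusMn t m n : t (m *+ n) = t m ^+ n.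
Proof. by apply: aff_valX; exact: dual_monoid_torus. Qed.

Lemma torus_sum t (I : Type) (r : seq I) (F : I -> 'rV[int]_k) :
  t (\sum_(i <- r) F i) = \prod_(i <- r) t (F i).
Proof.
by apply: (big_morph (aff_val t) (torusD t)); rewrite aff_val0.
Qed.

Lemma meval_mono t b : meval (tcoord t) (mpolyX C b) = t (expo b).
Proof.
rewrite mevalX; have -> : expo b = \sum_j (delta_mx 0 j *+ b j).
  apply/rowP => i; rewrite summxE (bigD1 i)//= big1 => [|j /negPf ji].
    by rewrite addr0 mxE mulmxnE mxE !eqxx /= pmulrn intz.
  by rewrite mulmxnE mxE eq_sym ji andbF mul0rn.
by rewrite torus_sum; apply: eq_bigr => j _; rewrite torusMn.
Qed.

(** Linear extension of a function on monomials that need not be multiplicative, such as the value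
    of a point of U_s, extended by zero, at a shifted exponent. *)
Definition lincomb (y : multinom k -> C) A : C := \sum_(m <- supp A) mcoeff m A * y m.

Lemma lincombE y A (l : seq (multinom k)) : uniq l -> {subset supp A <= l} ->
  lincomb y A = \sum_(m <- l) mcoeff m A * y m.
Proof.
move=> ul sl; rewrite [RHS](bigID (mem (supp A)))/= [X in _ + X]big1 ?addr0; last first.
  by move=> m mA; rewrite memN_msupp_eq0// mul0r.
rewrite -big_filter; apply: perm_big; apply: uniq_perm.
- exact: msupp_uniq.
- exact: filter_uniq.
- by move=> m; rewrite mem_filter; apply/idP/andP => [mA|[]//]; split=> //; exact: sl.
Qed.

Lemma lincombD y A B : lincomb y (A + B) = lincomb y A + lincomb y B.
Proof.
pose l := undup (supp A ++ supp B).
have ul : uniq l by exact: undup_uniq.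
rewrite (@lincombE y A l)//; last by move=> m mA; rewrite mem_undup mem_cat mA.
rewrite (@lincombE y B l)//; last by move=> m mA; rewrite mem_undup mem_cat mA orbT.
rewrite (@lincombE y _ l)//; last by move=> m /msuppD_le mA; rewrite mem_undup.
by rewrite -big_split; apply: eq_bigr => m _; rewrite mcoeffD mulrDl.
Qed.

Lemma lincombZX y c b : lincomb y (c *: mpolyX C b) = c * y b.
Proof.
rewrite (@lincombE y _ [:: b])//; first by rewrite big_seq1 mcoeffZ mcoeffX eqxx mulr1.
move=> m; rewrite mcoeff_msupp mcoeffZ mcoeffX.
by have [->|_] := eqVneq b m; rewrite ?mem_seq1 ?eqxx// mulr0 eqxx.
Qed.

Lemma lincomb0 y : lincomb y 0 = 0.
Proof. by rewrite (@lincombE y 0 [::])//; [rewrite big_nil|move=> m; rewrite mcoeff_msupp mcoeff0 eqxx]. Qed.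

Lemma lincombMX y A b : lincomb y (A * mpolyX C b) = lincomb (fun m => y (mnm_add m b)) A.
Proof.
elim/mpolyind: A => [|c m p _ _ IHp]; first by rewrite mul0r !lincomb0.
by rewrite mulrDl !lincombD IHp -scalerAl -mpolyXD !lincombZX.
Qed.

Lemma lincomb_meval t A : lincomb (fun m => t (expo m)) A = meval (tcoord t) A.
Proof.
elim/mpolyind: A => [|c m p _ _ IHp]; first by rewrite lincomb0 meval0.
by rewrite lincombD IHp lincombZX mevalD mevalZ meval_mono.
Qed.

Section TorusPoint.
Variables (z : 'I_k -> C) (z0 : forall j, z j != 0).

Let val (m : 'rV[int]_k) : C := \prod_j z j ^ m 0 j.

Fact torus_point0 : val 0 = 1.
Proof. by rewrite /val big1// => j _; rewrite mxE expr0z. Qed.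

Fact torus_pointD m m' : dual_monoid [set 0 : 'rV[R]_k] m -> dual_monoid [set 0 : 'rV[R]_k] m' ->
  val (m + m') = val m * val m'.
Proof.
by move=> _ _; rewrite /val -big_split; apply: eq_bigr => j _; rewrite mxE expfzDr.
Qed.

Fact torus_point_out m : ~ dual_monoid [set 0 : 'rV[R]_k] m -> val m = 0.
Proof. by case; exact: dual_monoid_torus. Qed.

Definition torus_point : T := AffToric torus_point0 torus_pointD torus_point_out.

Lemma tcoord_torus_point : tcoord torus_point = z.
Proof.
apply/funext => j; rewrite /tcoord /= /val (bigD1 j)//= mxE !eqxx expr1z big1 ?mulr1//.
by move=> i /negPf ij; rewrite mxE ij andbF expr0z.
Qed.

End TorusPoint.

(** The product of all variables, whose nonvanishing locus in C^k is the torus. *)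
Definition allX : P := mpolyX C (Multinom [tuple 1%N | i < k]).

Lemma meval_allX z : meval z allX = \prod_j z j.
Proof. by rewrite mevalX; apply: eq_bigr => j _; rewrite mnmE expr1. Qed.

Lemma allX_neq0 : allX != 0.
Proof. by rewrite -msupp_eq0 msuppX. Qed.

Lemma allX_point z : meval z allX != 0 -> exists t, tcoord t = z.
Proof.
rewrite meval_allX => /prodf_neq0 H; have z0 j : z j != 0 by exact: H.
by exists (torus_point z0); exact: tcoord_torus_point.
Qed.

Lemma meval_allX_coord t : meval (tcoord t) allX != 0.
Proof. by rewrite meval_mono torus_neq0. Qed.

Lemma mpoly_torus_eq q p p' : q != 0 -> (forall t, meval (tcoord t) q != 0 ->
  meval (tcoord t) p = meval (tcoord t) p') -> p = p'.
Proof.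
move=> q0 H; apply: (@mpoly_eq _ _ (allX * q)); first by rewrite mulf_neq0// allX_neq0.
move=> z; rewrite mevalM mulf_eq0 negb_or => /andP[/allX_point[t <-]].
exact: H.
Qed.

Lemma mpoly_torus_eq0 p : (forall t, meval (tcoord t) p = 0) -> p = 0.
Proof.
by move=> H; apply: (@mpoly_torus_eq 1); rewrite ?oner_neq0// => t _; rewrite H meval0.
Qed.

Lemma mpoly_torus_sep p : p != 0 -> exists t, meval (tcoord t) p != 0.
Proof.
move=> p0; apply: contrapT => H; case/eqP: p0; apply: mpoly_torus_eq0 => t.
by apply/eqP/negPn/negP => pt; apply: H; exists t.
Qed.

End Laurent.

(** * Laurent expansions of regular functions on U_s *)

Section AffineLaurent.
Context {R : realType} {k : nat} (s : set 'rV[R]_k).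
Hypothesis s0 : s 0.
Local Notation C := R[i].
Local Notation P := (mpoly k C).
Local Notation supp := (@msupp k C).
Local Notation T := (torus R k).
Implicit Types (p q A : P) (b : multinom k) (t : T) (h : aff_toric s -> C).

Lemma sub_zero_cone : [set 0] `<=` s. Proof. by move=> x ->. Qed.

Definition tor t : aff_toric s := aff_restr sub_zero_cone t.

Lemma torE t m : dual_monoid s m -> tor t m = t m.
Proof. exact: aff_restrE. Qed.

(** h restricts to the Laurent polynomial A / X^b on the torus. *)
Definition laurent h A b := forall t, h (tor t) * t (expo b) = meval (tcoord t) A.

Definition supp_in A b := forall m, m \in supp A -> dual_monoid s (expo m - expo b).

Definition laurent_fun A b (x : aff_toric s) : C :=
  lincomb (fun m => x (expo m - expo b)) A.

Lemma laurent_fun_poly A b : supp_in A b -> aff_poly (laurent_fun A b).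
Proof.
move=> sA; have -> : laurent_fun A b = (fun x : aff_toric s =>
    \sum_(i < size (supp A)) mcoeff (nth mnm0 (supp A) i) A *
      x (expo (nth mnm0 (supp A) i) - expo b)).
  by apply/funext => x; rewrite /laurent_fun /lincomb (big_nth mnm0) big_mkord.
by apply: aff_poly_sum => i; apply: sA; exact: mem_nth.
Qed.

Lemma laurent_funP A b : supp_in A b -> laurent (laurent_fun A b) A b.
Proof.
move=> sA t; rewrite -lincomb_meval /laurent_fun /lincomb mulr_suml big_seq [RHS]big_seq.
by apply: eq_bigr => m mA; rewrite torE; [rewrite -mulrA -torusD subrK|exact: sA].
Qed.

Lemma aff_poly_laurent_fun h : aff_poly h -> exists A b, supp_in A b /\ h = laurent_fun A b.
Proof.
move=> /aff_polyP[r [c [m [sm ->]]]].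
have [b bP] := expo_shift [seq m i | i <- enum 'I_r].
have /choice[m' m'E] : forall i, exists m', expo m' = m i + expo b.
  by move=> i; apply: bP; rewrite map_f// mem_enum.
exists (\sum_i c i *: mpolyX C (m' i)), b; split.
  move=> n; rewrite mcoeff_msupp raddf_sum/= => n0.
  have [i nE] : exists i, n = m' i.
    apply: contrapT => H; case/negP: n0; rewrite big1// => i _.
    rewrite mcoeffZ mcoeffX; case: eqP => [E|_]; last by rewrite mulr0.
    by case: H; exists i.
  by rewrite nE m'E addrK; exact: sm.
apply/funext => x; rewrite /laurent_fun.
rewrite (big_morph (lincomb _) (lincombD _) (lincomb0 _)).
by apply: eq_bigr => i _; rewrite lincombZX m'E addrK.
Qed.

Lemma laurent_exists h : aff_poly h -> exists A b, laurent h A b.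
Proof.
by move=> /aff_poly_laurent_fun[A [b [sA ->]]]; exists A, b; exact: laurent_funP.
Qed.

(** A polynomial is determined by its values on the torus, so two expansions of [h] agree after
    clearing denominators, and one of them has its exponents in S_s. *)
Lemma laurent_unique h A b : aff_poly h -> laurent h A b -> supp_in A b /\ h = laurent_fun A b.
Proof.
move=> /aff_poly_laurent_fun[A' [b' [sA' hE]]] hA.
have hA' : laurent h A' b' by rewrite hE; exact: laurent_funP.
have E : A * mpolyX C b' = A' * mpolyX C b.
  apply: (@mpoly_torus_eq R k 1); first exact: oner_neq0.
  by move=> t _; rewrite !mevalM -hA -hA' !meval_mono; ring.
split.
  move=> m mA; have : mnm_add m b' \in supp (A * mpolyX C b').
    by rewrite mcoeff_msupp addmC mcoeffMX -mcoeff_msupp.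
  rewrite E => /msuppM_le/allpairsP[[m1 m2] /= [m1A' + mE]].
  rewrite msuppX inE => /eqP m2b; rewrite m2b in mE.
  have -> : expo m - expo b = expo m1 - expo b'.
    apply/eqP; rewrite subr_eq addrAC eq_sym subr_eq -!expoD; apply/eqP.
    by congr expo; rewrite mE.
  exact: sA'.
have shift m c d : expo (mnm_add m d) - expo (mnm_add c d) = expo m - expo c.
  by rewrite !expoD opprD addrACA subrr addr0.
have laurent_shift B c d (x : aff_toric s) : laurent_fun B c x =
    lincomb (fun m => x (expo m - expo (mnm_add c d))) (B * mpolyX C d).
  by rewrite lincombMX; congr lincomb; apply/funext => m; rewrite shift.
by rewrite hE; apply/funext => x; rewrite (laurent_shift A' b' b) (laurent_shift A b b') E addmC.
Qed.

Lemma laurentX h A b n : laurent h A b -> laurent (fun x => h x ^+ n) (A ^+ n) (mnm_muln b n).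
Proof.
move=> hA; elim: n => [|n IHn] t.
  by rewrite !expr0 mulm0n expo0 aff_val0 mulr1 meval1.
by rewrite mulmS expoD torusD !exprS mevalM -hA -IHn; ring.
Qed.

Lemma laurent_eq0 h A b : aff_poly h -> laurent h A b -> A = 0 -> forall x, h x = 0.
Proof.
by move=> ph /(laurent_unique ph)[_ ->] -> x; rewrite /laurent_fun lincomb0.
Qed.

Lemma laurent_neq0 h A b x : aff_poly h -> laurent h A b -> h x != 0 -> A != 0.
Proof.
by move=> ph hA; apply: contraNneq => A0; rewrite (laurent_eq0 ph hA A0).
Qed.

(** The torus is dense in U_s, and so is the locus of the torus where a nonzero [g] does not
    vanish. *)
Lemma aff_poly_density h h' g x0 : aff_poly h -> aff_poly h' -> aff_poly g -> g x0 != 0 ->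
  (forall t, g (tor t) != 0 -> h (tor t) = h' (tor t)) -> h = h'.
Proof.
move=> ph ph' pg gx0 H.
have [A [b hA]] := laurent_exists ph; have [A' [b' hA']] := laurent_exists ph'.
have [G [c gG]] := laurent_exists pg.
have G0 := laurent_neq0 pg gG gx0.
have E : A * mpolyX C b' = A' * mpolyX C b.
  apply: (mpoly_torus_eq G0) => t; rewrite -gG mulf_eq0 negb_or => /andP[/H htE _].
  by rewrite !mevalM -hA -hA' !meval_mono htE; ring.
have hA1 : laurent h (A * mpolyX C b') (mnm_add b b').
  by move=> t; rewrite expoD torusD mevalM meval_mono -hA; ring.
have hA1' : laurent h' (A * mpolyX C b') (mnm_add b b').
  by move=> t; rewrite E expoD torusD mevalM meval_mono -hA'; ring.
by have [_ ->] := laurent_unique ph hA1; have [_ ->] := laurent_unique ph' hA1'.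
Qed.

Lemma aff_regfun_density (U : set (aff_toric s)) (f g : aff_toric s -> C) :
  regfun U f -> regfun U g -> (forall t, U (tor t) -> f (tor t) = g (tor t)) ->
  forall x, U x -> f x = g x.
Proof.
move=> /aff_regfunP rf /aff_regfunP rg fg x Ux.
have [a [b [pa pb bx ab]]] := rf x Ux; have [c [d [pc pd dx cd]]] := rg x Ux.
have [_ ->] := ab x bx; have [_ ->] := cd x dx; apply/eqP; rewrite eqr_div//; apply/eqP.
suff : (fun y => a y * d y) = (fun y => c y * b y) by move/(congr1 (fun h => h x)).
apply: (@aff_poly_density _ _ (fun y => b y * d y) x).
- exact: aff_polyM.
- exact: aff_polyM.
- exact: aff_polyM.
- exact: mulf_neq0.
move=> t; rewrite mulf_eq0 negb_or => /andP[bt dt].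
have [Ut] := ab _ bt; rewrite fg//; have [_ ->] := cd _ dt => /eqP.
by rewrite eqr_div// => /eqP <-.
Qed.

Section LimitPoint.
Variables (v : 'rV[R]_k) (sv : s v) (t : T).

Let val m : C := if `[< dual_monoid s m /\ wt v m = 0 >] then t m else 0.

Fact ray_limit0 : val 0 = 1.
Proof.
rewrite /val asboolT ?aff_val0//; split; first exact: dual_monoid0.
exact: wt0.
Qed.

Fact ray_limitD m m' : dual_monoid s m -> dual_monoid s m' -> val (m + m') = val m * val m'.
Proof.
move=> sm sm'.
have valT u : dual_monoid s u -> wt v u = 0 -> val u = t u by move=> su vu; rewrite /val asboolT.
have valF u : wt v u != 0 -> val u = 0.
  by move=> vu; rewrite /val asboolF// => -[_ /eqP]; rewrite (negPf vu).
have m0 : 0 <= wt v m by exact: sm.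
have m'0 : 0 <= wt v m' by exact: sm'.
have smm := dual_monoidD sm sm'.
have [vm|vm] := eqVneq (wt v m) 0.
  have [vm'|vm'] := eqVneq (wt v m') 0.
    by rewrite !valT ?torusD// wtD vm vm' addr0.
  by rewrite !(valF m') ?(valF (m + m')) ?mulr0// wtD vm add0r.
by rewrite (valF m)// mul0r valF// wtD paddr_eq0// (negPf vm).
Qed.

Fact ray_limit_out m : ~ dual_monoid s m -> val m = 0.
Proof. by move=> sm; rewrite /val asboolF// => -[]. Qed.

(** The limit at z = 0 of lambda_v(z) t, where lambda_v is the one-parameter
    subgroup v. *)
Definition ray_limit : aff_toric s := AffToric ray_limit0 ray_limitD ray_limit_out.

Lemma ray_limitE m : dual_monoid s m -> ray_limit m = if wt v m == 0 then t m else 0.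
Proof.
move=> sm; rewrite /= /val; case: eqP => vm; first by rewrite asboolT.
by rewrite asboolF// => -[].
Qed.

End LimitPoint.

(** Only terms of weight zero, relative to the denominator, survive in the limit. *)
Lemma ray_limit_neq0 v (sv : s v) t h A b : aff_poly h -> laurent h A b ->
  h (ray_limit sv t) != 0 -> exists2 m, m \in supp A & wt v (expo m) = wt v (expo b).
Proof.
move=> ph /(laurent_unique ph)[sA ->]; rewrite /laurent_fun /lincomb => h0.
apply: contrapT => H; case/negP: h0; rewrite big_seq big1// => m mA.
rewrite ray_limitE; last exact: sA.
by case: eqP => [E|_]; [case: H; exists m => //; apply/eqP; rewrite -subr_eq0 -wtB E|rewrite mulr0].
Qed.

(** The initial form of A in direction v, if the minimum is attained at b *)
Definition initial (v : 'rV[R]_k) b A : P :=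
  \sum_(m <- supp A | wt v (expo m) == wt v (expo b)) mcoeff m A *: mpolyX C m.

Lemma initial_neq0 (v : 'rV[R]_k) b A m : m \in supp A -> wt v (expo m) = wt v (expo b) -> initial v b A != 0.
Proof.
move=> mA mb; apply: contraTneq mA => i0; rewrite -mcoeff_eq0.
have := congr1 (mcoeff m) i0; rewrite raddf_sum/= mcoeff0.
have [mA|mA] := boolP (m \in supp A); last by rewrite mcoeff_eq0.
rewrite big_mkcond (bigD1_seq m)//=.
rewrite mb eqxx mcoeffZ mcoeffX eqxx mulr1 big1 ?addr0 => [->//|n /negPf nm].
by case: ifP => // _; rewrite mcoeffZ mcoeffX nm mulr0.
Qed.

Lemma ray_limit_initial v (sv : s v) t h A b : aff_poly h -> laurent h A b ->
  h (ray_limit sv t) * t (expo b) = meval (tcoord t) (initial v b A).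
Proof.
move=> ph /(laurent_unique ph)[sA ->]; rewrite /laurent_fun /lincomb /initial rmorph_sum.
rewrite mulr_suml [RHS]big_mkcond big_seq [RHS]big_seq; apply: eq_bigr => m mA.
rewrite ray_limitE; last exact: sA.
rewrite wtB subr_eq0; case: eqP => _; last by rewrite mulr0 mul0r.
transitivity (mcoeff m A * meval (tcoord t) (mpolyX C m)).
  by rewrite meval_mono -mulrA -torusD subrK.
by rewrite -mevalZ.
Qed.

End AffineLaurent.

(** * Line bundles on affine toric varieties *)

Section AffineCocycle.
Context {R : realType} {k : nat}.
Local Notation C := R[i].
Local Notation P := (mpoly k C).
Local Notation supp := (@msupp k C).
Local Notation T := (torus R k).
Local Notation rof := (@real_of R k).
Local Notation ev t p := (meval (tcoord t) p).

Lemma torus_exprz (t : T) m (n : int) : t (m *~ n) = t m ^ n.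
Proof.
by case: n => n; rewrite ?NegzE -?mulrNz ?torusN ?mulrNz ?torusN -?pmulrn torusMn// ?exprnN.
Qed.

Lemma tcoord_inj : injective (@tcoord R k).
Proof.
move=> t u tu; apply: aff_eq => m _.
have -> : m = \sum_j (delta_mx 0 j *~ m 0 j).
  apply/rowP => i; rewrite summxE (bigD1 i)//= big1 => [|j /negPf ji].
    by rewrite addr0 -scaler_int !mxE !eqxx mulr1 intz.
  by rewrite -scaler_int !mxE eq_sym ji andbF mulr0.
rewrite !torus_sum; apply: eq_bigr => j _; rewrite !torus_exprz; congr (_ ^ _).
by have := congr1 (fun f => f j) tu.
Qed.

Lemma torus_expoMn (t : T) b N : t (expo (mnm_muln b N)) = t (expo b) ^+ N.
Proof.
elim: N => [|N IHN]; first by rewrite mulm0n expo0 aff_val0.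
by rewrite mulmS expoD torusD IHN exprS.
Qed.

Section Cone.
Variables (s : set 'rV[R]_k) (r : nat) (v : 'I_r -> 'rV[int]_k).
Hypothesis sc : rational_cone s.
Hypothesis sE : s = [set x | exists2 c : 'I_r -> R, (forall i, 0 <= c i) &
                                         x = \sum_(i < r) c i *: real_of (v i)].
Let s0 : s 0. Proof. exact: rational_cone0. Qed.
Let sv i : s (rof (v i)). Proof. exact: cone_gen sE i. Qed.

(** A point in the relative interior of [s]: an element of S_s that is zero on it is zero on all
    generators. *)
Definition barycentre : 'rV[R]_k := \sum_i rof (v i).

Lemma barycentre_in : s barycentre.
Proof.
have -> : barycentre = \sum_i 1 *: rof (v i) by apply: eq_bigr => i _; rewrite scale1r.
by rewrite sE; exists (fun=> 1).
Qed.

(** The distinguished point of U_s, in the closed orbit *)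
Definition dist_point : aff_toric s := ray_limit barycentre_in torus_one.

Local Notation tor := (tor s0).
Local Notation laurent := (laurent s0).

Lemma barycentre_wt0 m i : dual_monoid s m -> wt barycentre m = 0 -> wt (rof (v i)) m = 0.
Proof.
move=> sm; rewrite /barycentre wt_sum => /eqP; rewrite psumr_eq0 => [|j _]; last exact/sm/sv.
by move=> /allP/(_ i (mem_index_enum i))/eqP.
Qed.

Lemma dist_point_exponent (h : aff_toric s -> C) q b : aff_poly h -> laurent h q b ->
  h dist_point != 0 -> exists2 m, m \in supp q & forall i, wt (rof (v i)) (expo m) = wt (rof (v i)) (expo b).
Proof.
move=> ph hq h0; have [sq _] := laurent_unique ph hq.
have [m mq mb] := ray_limit_neq0 ph hq h0; exists m => // i.
apply/eqP; rewrite -subr_eq0 -wtB; apply/eqP/barycentre_wt0; first exact: sq.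
by rewrite wtB mb subrr.
Qed.

Lemma supp_in_gen (A : P) b :
  (forall i m, m \in supp A -> wt (rof (v i)) (expo b) <= wt (rof (v i)) (expo m)) ->
  supp_in s A b.
Proof.
move=> H m mA; apply/(dual_monoid_gen sE) => i.
by rewrite wtB subr_ge0 H.
Qed.

(** As [h] does not vanish at the distinguished point, its power has a term of weight zero in all
    directions [v i], and [supp_vertex] passes such a term on to the divisor [a]. Divided by this
    monomial, [a] becomes regular on U_s and divides a power of [h] there, so its zeros are zeros of
    [h]. *)
Lemma divisor_vertex (h : aff_toric s -> C) q b a N : aff_poly h -> laurent h q b ->
  h dist_point != 0 -> divides a (q ^+ N) -> exists m1,
  supp_in s a m1 /\ forall x, h x != 0 -> laurent_fun a m1 x != 0.
Proof.
move=> ph hq h0 [a' qE].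
have phN := aff_poly_exp N ph; have hqN := laurentX (N) hq.
have hN0 : h dist_point ^+ N != 0 by rewrite expf_neq0.
have [m0 m0q m0b] := dist_point_exponent phN hqN hN0.
have [sq _] := laurent_unique phN hqN.
have qN0 := laurent_neq0 phN hqN hN0.
have [||| m1 [m2 [m1a m2a m1min m2min m12]]] := @supp_vertex R k C r (fun i => rof (v i)) a a' m0.
- by rewrite -qE.
- by rewrite -qE.
- move=> i m; rewrite -qE => mq; rewrite m0b -subr_ge0 -wtB.
  exact: (sq m mq) _ (sv i).
have sa : supp_in s a m1 by exact: supp_in_gen.
have sa' : supp_in s a' m2 by exact: supp_in_gen.
exists m1; split=> // x hx.
(* The monomials of the two factors and the denominator of [h ^+ N] agree on the generators but need
   not be equal; [u] is their difference. *)
pose u := expo m1 + expo m2 - expo (mnm_muln b N).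
have su : dual_monoid s u.
  by apply/(dual_monoid_gen sE) => i; rewrite wtB wtD m12 m0b subrr.
suff : (fun x : aff_toric s => laurent_fun a m1 x * laurent_fun a' m2 x * x u) = (fun x => h x ^+ N).
  move=> /(congr1 (fun g => g x)) E; apply: contraNneq hx => a0.
  by move: E; rewrite a0 !mul0r => /esym/eqP; rewrite expf_eq0 => /andP[_].
have pa := laurent_fun_poly sa; have pa' := laurent_fun_poly sa'.
apply: (@aff_poly_density _ _ _ s0 _ _ (fun=> 1) dist_point) => //.
- by apply: aff_polyM; [exact: aff_polyM|exact: aff_poly_char].
- exact: aff_poly_cst.
- exact: oner_neq0.
move=> t _; have aE := laurent_funP s0 sa t; have a'E := laurent_funP s0 sa' t; have hE := hqN t.
apply: (mulIf (torus_neq0 t (expo (mnm_muln b N)))).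
rewrite hE qE mevalM -aE -a'E torE// torusB torusD.
by field; exact: torus_neq0.
Qed.

Lemma wt_supp_exp w (q : P) (c : R) L : (forall n, n \in supp q -> c <= wt w (expo n)) ->
  forall n, n \in supp (q ^+ L) -> L%:R * c <= wt w (expo n).
Proof.
move=> H; elim: L => [|L IHL] n.
  rewrite expr0 msupp1 inE => /eqP ->; by rewrite expo0 wt0 mul0r.
rewrite exprS => /msuppM_le/allpairsP[[n1 n2] /= [/H n1c /IHL n2c ->]].
by rewrite expoD wtD -natr1 mulrDl mul1r addrC lerD.
Qed.

Lemma seq_lower_bound (w : 'rV[R]_k) (l : seq (multinom k)) :
  exists c, forall m, m \in l -> c <= wt w (expo m).
Proof.
elim: l => [|m l [c IHl]]; first by exists 0.
exists (Order.min c (wt w (expo m))) => n; rewrite inE => /predU1P[->|/IHl].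
  by rewrite ge_min lexx orbT.
by move=> cn; rewrite ge_min cn.
Qed.

Lemma seq_gap (w : 'rV[R]_k) (c : R) (l : seq (multinom k)) :
  (forall m, m \in l -> c < wt w (expo m)) ->
  exists2 d, 0 < d & forall m, m \in l -> c + d <= wt w (expo m).
Proof.
elim: l => [|m l IHl] H; first by exists 1.
have [|d d0 dl] := IHl; first by move=> n nl; apply: H; rewrite inE nl orbT.
have mc := H m (mem_head _ _).
exists (Order.min d (wt w (expo m) - c)) => [|n]; first by rewrite lt_min d0 subr_gt0.
rewrite inE => /predU1P[->|/dl].
  by rewrite -lerBrDl ge_min lexx orbT.
by apply: le_trans; rewrite lerD2l ge_min lexx.
Qed.

(** * Extending a function from D([h]) ∩ D([ho]) and the torus part of D([h]) to D([h]) *)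

Section Extend.
Variables (h ho f : aff_toric s -> C) (q qo F : P) (b bo bF : multinom k) (N : nat).
Hypotheses (ph : aff_poly h) (pho : aff_poly ho).
Hypotheses (hq : laurent h q b) (hoq : laurent ho qo bo).
Hypothesis ho0 : ho dist_point != 0.
Hypothesis rf : regfun [set x | h x != 0 /\ ho x != 0] f.
Hypothesis fF : forall t, h (tor t) != 0 -> ho (tor t) != 0 ->
  f (tor t) * h (tor t) ^+ N * t (expo bF) = ev t F.

(** [f] is regular at a general limit point in the direction [v i], and a term of [F] of too small a
    weight would be a pole there. *)
Lemma extend_weight i n : n \in supp q -> wt (rof (v i)) (expo n) = wt (rof (v i)) (expo b) ->
  forall m, m \in supp F -> wt (rof (v i)) (expo bF) <= wt (rof (v i)) (expo m).
Proof.
move=> nq nb; have [no noq nob] := dist_point_exponent pho hoq ho0.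
have i1 := initial_neq0 nq nb; have i2 := initial_neq0 noq (nob i).
(* At this torus point the initial forms of [h] and [ho] are nonzero, so the limit [y] lies in the
   domain of [f]. *)
have [t] := mpoly_torus_sep (mulf_neq0 i1 i2).
rewrite mevalM mulf_eq0 negb_or -(ray_limit_initial (sv i) t ph hq).
rewrite -(ray_limit_initial (sv i) t pho hoq) !mulf_eq0 !negb_or.
set y := ray_limit _ _ => /andP[/andP[hy _] /andP[hoy _]].
have [al [be [pal pbe bey fE]]] : exists a b, [/\ aff_poly a, aff_poly b, b y != 0 &
    forall y, b y != 0 -> (h y != 0 /\ ho y != 0) /\ f y = a y / b y].
  by move/aff_regfunP: rf; apply.
have [B [d beB]] := laurent_exists s0 pbe.
have palh : aff_poly (fun x => al x * h x ^+ N) by apply: aff_polyM => //; exact: aff_poly_exp.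
have [A [c alA]] := laurent_exists s0 palh.
have [sA _] := laurent_unique palh alA.
have B0 := laurent_neq0 pbe beB bey.
(* The local form [f = al / be] cleared of denominators. Since [be] does not vanish at [y], its
   least weight does not exceed that of its denominator, so the bound falls on [F]. *)
have E : F * B * mpolyX C c = A * (mpolyX C bF * mpolyX C d).
  apply: (mpoly_torus_eq B0) => u; rewrite -beB mulf_eq0 negb_or => /andP[beu _].
  have [[hu hou] fu] := fE _ beu.
  rewrite !mevalM -(fF hu hou) -alA -beB !meval_mono fu.
  by field.
have [->|F0] := eqVneq F 0; first by move=> m; rewrite msupp0.
have [m1 [m2 [m1F m2B m12 m1min m2min]]] := wt_min_mul (rof (v i)) F0 B0.
have [n2 n2B n2d] := ray_limit_neq0 pbe beB bey.
have : mnm_add c (mnm_add m1 m2) \in supp (F * B * mpolyX C c).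
  by rewrite mcoeff_msupp mcoeffMX -mcoeff_msupp.
rewrite E -mpolyXD => /msuppM_le/allpairsP[[m' m''] /= [m'A]].
rewrite msuppX inE => /eqP -> /(congr1 expo); rewrite !expoD => /(congr1 (wt (rof (v i)))).
rewrite !wtD => wE; have : 0 <= wt (rof (v i)) (expo m' - expo c) by exact: (sA _ m'A) _ (sv i).
rewrite wtB => le' m mF; have := m1min m mF; have := m2min n2 n2B; lra.
Qed.

(** The exponents of F h^L lie in S_s for large L: for a generator v_i of s, if
    h has an exponent of weight 0 then f is regular at some limit point in
    direction v_i, which bounds the weights of F; otherwise multiplication by h
    raises all weights. *)
Lemma extend_regular : exists L G, aff_poly G /\
  forall t, G (tor t) * t (expo bF) = ev t F * h (tor t) ^+ L.
Proof.
have [sq _] := laurent_unique ph hq.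
have qb i n : n \in supp q -> wt (rof (v i)) (expo b) <= wt (rof (v i)) (expo n).
  by move=> nq; rewrite -subr_ge0 -wtB; exact: (sq n nq) _ (sv i).
(* In the first alternative [F] already satisfies the bound; in the second, [d] is the least weight
   gained with each factor [h]. Either way the bound persists for larger exponents. *)
have HL i : exists L : nat, forall m, m \in supp F ->
    wt (rof (v i)) (expo bF) + L%:R * wt (rof (v i)) (expo b) <= wt (rof (v i)) (expo m) +
    L%:R * wt (rof (v i)) (expo b) \/ exists2 d, 0 < d &
    (forall n, n \in supp q -> wt (rof (v i)) (expo b) + d <= wt (rof (v i)) (expo n)) /\
    wt (rof (v i)) (expo bF) <= wt (rof (v i)) (expo m) + L%:R * d.
  have [[n nq nb]|H] := pselect (exists2 n, n \in supp q & wt (rof (v i)) (expo n) = wt (rof (v i)) (expo b)).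
    by exists 0%N => m mF; left; rewrite lerD2r; exact: extend_weight nq nb m mF.
  have [|d d0 dP] := @seq_gap (rof (v i)) (wt (rof (v i)) (expo b)) (supp q).
    move=> n nq; rewrite lt_neqAle qb// andbT; apply/eqP => E; apply: H; exists n => //.
  have [c cP] := seq_lower_bound (rof (v i)) (supp F).
  exists (Num.bound `|(wt (rof (v i)) (expo bF) - c) / d|) => m mF; right; exists d => //.
  split=> //; have := archi_boundP (normr_ge0 ((wt (rof (v i)) (expo bF) - c) / d)).
  move=> /(le_lt_trans (ler_norm _)); rewrite ltr_pdivrMr// => lt.
  by have := cP m mF; lra.
have [L LP] := choice HL; pose M := (\sum_i L i)%N.
have LM i : (L i <= M)%N by rewrite /M (bigD1 i)//= leq_addr.
have sG : supp_in s (F * q ^+ M) (mnm_add bF (mnm_muln b M)).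
  have bM i : wt (rof (v i)) (expo (mnm_muln b M)) = M%:R * wt (rof (v i)) (expo b).
    elim: M {LM} => [|M' IHM]; first by rewrite mulm0n expo0 wt0 mul0r.
    by rewrite mulmS expoD wtD IHM -natr1 mulrDl mul1r addrC.
  apply: supp_in_gen => i m /msuppM_le/allpairsP[[m1 m2] /= [m1F m2q ->]].
  rewrite !expoD !wtD bM.
  have [le|[d d0 [dP le]]] := LP i m1 m1F.
    have := @wt_supp_exp _ q _ M (qb i) _ m2q; lra.
  have := @wt_supp_exp _ q _ M dP _ m2q.
  have : (L i)%:R * d <= M%:R * d by rewrite ler_wpM2r ?ler_nat// ltW.
  by rewrite mulrDr; lra.
exists M, (laurent_fun (F * q ^+ M) (mnm_add bF (mnm_muln b M))).
split; first exact: laurent_fun_poly.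
move=> t; have := laurent_funP s0 sG t; have := laurentX M hq t.
rewrite expoD torusD mevalM => <- E.
apply: (mulIf (torus_neq0 t (expo (mnm_muln b M)))).
by rewrite -mulrA E mulrA.
Qed.

End Extend.

Section Cocycle.
Variables (I : Type) (h : I -> aff_toric s -> C) (f : I -> I -> aff_toric s -> C).
Hypothesis ph : forall i, aff_poly (h i).
Hypothesis hn0 : forall i, exists x, h i x != 0.
Hypothesis cover : forall x, exists i, h i x != 0.
Hypothesis rf : forall i j, regfun [set x | h i x != 0 /\ h j x != 0] (f i j).
Hypothesis f0 : forall i j x, h i x != 0 -> h j x != 0 -> f i j x != 0.
Hypothesis fM : forall i j l x, h i x != 0 -> h j x != 0 -> h l x != 0 ->
  f i j x * f j l x = f i l x.

(* A function on the torus as a function of all points of C^k, with junk value 0 *)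
Let torus_fun (g : aff_toric s -> C) (z : 'I_k -> C) : C :=
  if pselect (exists t : T, tcoord t = z) is left H then g (tor (projT1 (cid H))) else 0.

Let torus_funE g t : torus_fun g (tcoord t) = g (tor t).
Proof.
rewrite /torus_fun; case: pselect => [H|[]]; last by exists t.
by case: cid => u /= /tcoord_inj ->.
Qed.

(** The factor [allX] ensures that D([q i]), as a subset of C^k, lies in the torus. *)
Lemma laurent_allX : exists qb : I -> P * multinom k,
  forall i, laurent (h i) (qb i).1 (qb i).2 /\ divides allX (qb i).1.
Proof.
suff H i : exists qb : P * multinom k, laurent (h i) qb.1 qb.2 /\ divides allX qb.1.
  by have [qb qbP] := choice H; exists qb.
have [A [b hA]] := laurent_exists s0 (ph i).
exists (A * allX, mnm_add b (Multinom [tuple 1%N | j < k])) => /=; split.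
  by move=> t; rewrite expoD torusD mevalM meval_mono -hA mulrA.
by exists A; rewrite mulrC.
Qed.

Section Laurent.
Variables (q : I -> P) (b : I -> multinom k).
Hypothesis hq : forall i, laurent (h i) (q i) (b i).
Hypothesis Xq : forall i, divides allX (q i).

Let q0 i : q i != 0.
Proof. by have [x hx] := hn0 i; exact: laurent_neq0 (ph i) (hq i) hx. Qed.

Let hqE i t : (h i (tor t) != 0) = (ev t (q i) != 0).
Proof. by rewrite -hq mulf_eq0 negb_or torus_neq0 andbT. Qed.

Let point i z : meval z (q i) != 0 -> exists2 t, tcoord t = z & h i (tor t) != 0.
Proof.
move=> qz; have [t tz] := allX_point (divides_ev (Xq i) qz); exists t => //.
by rewrite hqE tz.
Qed.

Lemma torus_regular_unit i j : regular_unit (q i * q j) (torus_fun (f i j)).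
Proof.
move=> z; rewrite mevalM mulf_eq0 negb_or => /andP[/point[t <- hi]].
rewrite -hqE => hj; have /aff_regfunP/(_ (tor t)) := @rf i j.
case; first by split.
move=> al [be [pal pbe bt fE]].
have [A [c alA]] := laurent_exists s0 pal; have [B [d beB]] := laurent_exists s0 pbe.
exists (A * mpolyX C d), (B * mpolyX C c); split.
- rewrite mevalM meval_mono -alA !mulf_neq0 ?torus_neq0//.
  have := f0 hi hj; have [_ ->] := fE _ bt.
  by rewrite mulf_eq0 negb_or => /andP[].
- by rewrite mevalM meval_mono -beB !mulf_neq0 ?torus_neq0.
move=> w; rewrite mevalM mulf_eq0 negb_or => /andP[/point[u <- hiu] _].
move=> bw; have : be (tor u) != 0.
  by move: bw; rewrite mevalM -beB !mulf_eq0 !negb_or => /andP[/andP[]].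
move=> bu; rewrite torus_funE !mevalM !meval_mono -alA -beB.
by have [_ ->] := fE _ bu; field.
Qed.

Lemma torus_cocycle_frac : exists a c : I -> P,
  (forall i, exists N, divides (a i) (q i ^+ N) /\ divides (c i) (q i ^+ N)) /\
  (forall i j t, h i (tor t) != 0 -> h j (tor t) != 0 ->
    f i j (tor t) * ev t (c i * a j) = ev t (a i * c j)).
Proof.
have [o _] := cover dist_point.
have [||a [c [dvd acf]]] := @torus_cocycle C k I allX q (fun i j => torus_fun (f i j)) q0 Xq _ torus_regular_unit _ o.
- move=> z /allX_point[t <-]; have [i hi] := cover (tor t).
  by exists i; rewrite -hqE.
- move=> i j l z /point[t <- hi]; rewrite -!hqE => hj hl.
  by rewrite !torus_funE fM.
exists a, c; split=> // i j t hi hj.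
by rewrite -(acf i j) ?torus_funE -?hqE.
Qed.

(** The trivialization over the torus is rescaled by a character so that it becomes a unit around
    the distinguished point. It and its inverse then extend to every chart D([h i]) by
    [extend_regular], and the cocycle relation extends by density. *)
Lemma aff_cocycle_frac : exists g : I -> aff_toric s -> C,
  (forall i, regfun [set x | h i x != 0] (g i)) /\
  (forall i x, h i x != 0 -> g i x != 0) /\
  (forall i j x, h i x != 0 -> h j x != 0 -> f i j x * g j x = g i x).
Proof.
(* A chart containing the distinguished point. There [a o] and [c o] become units after division by
   the monomials [m1] and [n1]. *)
have [o ho0] := cover dist_point.
have [a [c [dvd acf]]] := torus_cocycle_frac.
have [N0 [ao co]] := dvd o.
have [m1 [sa al0]] := divisor_vertex (ph o) (hq o) ho0 ao.
have [n1 [sc1 ga0]] := divisor_vertex (ph o) (hq o) ho0 co.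
pose al := laurent_fun (s := s) (a o) m1; pose ga := laurent_fun (s := s) (c o) n1.
have pal : aff_poly al by exact: laurent_fun_poly.
have pga : aff_poly ga by exact: laurent_fun_poly.
have alE t : al (tor t) * t (expo m1) = ev t (a o) := laurent_funP s0 sa t.
have gaE t : ga (tor t) * t (expo n1) = ev t (c o) := laurent_funP s0 sc1 t.
have hopen i j : open [set x | h i x != 0 /\ h j x != 0].
  exact: regfun_open (@rf i j).
(* On the torus this is [a i / c i] times the character [expo n1 - expo m1], which is the same for
   all [i]. *)
pose phi i x := f i o x * al x / ga x.
have rpoly i (d : aff_toric s -> C) : aff_poly d -> regfun [set x | h i x != 0 /\ h o x != 0] d.
  move=> pd; exact: regfun_restr (hopen i o) (@subsetT _ _) (aff_poly_regfun pd).
have rphi i : regfun [set x | h i x != 0 /\ h o x != 0] (phi i).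
  apply: regfunM; first by apply: regfunM => //; exact: rpoly.
  by apply: regfun_inv; [exact: rpoly|move=> x [_ /ga0]].
have phi0 i x : h i x != 0 -> h o x != 0 -> phi i x != 0.
  by move=> hi ho; rewrite /phi !mulf_neq0 ?invr_eq0 ?f0// ?al0// ga0.
have phiE i t : h i (tor t) != 0 -> h o (tor t) != 0 ->
    phi i (tor t) * (ev t (c i) * t (expo m1)) = ev t (a i) * t (expo n1).
  move=> hi ho; have := acf i o t hi ho; rewrite !mevalM -alE -gaE.
  have := ga0 _ ho; rewrite -/ga /phi => gat E.
  apply: (mulIf gat); transitivity (f i o (tor t) * (ev t (c i) * (al (tor t) * t (expo m1)))).
    by field.
  by rewrite E; ring.
(* [phi i] and its inverse, each multiplied by a power of [h i], extend to regular functions on U_s.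
   The relations are stated without division, on the torus. *)
have HG i : exists LG : (nat * nat) * ((aff_toric s -> C) * (aff_toric s -> C)),
    [/\ aff_poly LG.2.1, aff_poly LG.2.2 &
    forall t, h i (tor t) != 0 ->
      LG.2.1 (tor t) * (ev t (c i) * t (expo m1)) = ev t (a i) * t (expo n1) * h i (tor t) ^+ LG.1.1 /\
      LG.2.2 (tor t) * (ev t (a i) * t (expo n1)) = ev t (c i) * t (expo m1) * h i (tor t) ^+ LG.1.2].
  have [N [[a' aE] [c' cE]]] := dvd i.
  have aq t : ev t (a i) * ev t a' = (h i (tor t) * t (expo (b i))) ^+ N.
    by rewrite hq -mevalM -aE rmorphXn.
  have cq t : ev t (c i) * ev t c' = (h i (tor t) * t (expo (b i))) ^+ N.
    by rewrite hq -mevalM -cE rmorphXn.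
  have tbN (t : T) : t (expo (mnm_muln (b i) N)) = t (expo (b i)) ^+ N.
    exact: torus_expoMn.
  have ac0 t : h i (tor t) != 0 -> ev t (a i) != 0 /\ ev t (c i) != 0.
    move=> hi; have H : (h i (tor t) * t (expo (b i))) ^+ N != 0.
      by rewrite expf_neq0// mulf_neq0// torus_neq0.
    split; first by move: H; rewrite -aq mulf_eq0 negb_or => /andP[].
    by move: H; rewrite -cq mulf_eq0 negb_or => /andP[].
  have [|L [G [pG GE]]] := @extend_regular (h i) (h o) (phi i) (q i) (q o)
    (a i * c' * mpolyX C n1) (b i) (b o) (mnm_add m1 (mnm_muln (b i) N)) N
    (ph i) (ph o) (hq i) (hq o) ho0 (rphi i).
    move=> t hi ho; have [_ ct] := ac0 t hi; apply: (mulIf ct).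
    rewrite expoD torusD tbN !mevalM meval_mono.
    transitivity (phi i (tor t) * (ev t (c i) * t (expo m1)) * (h i (tor t) * t (expo (b i))) ^+ N).
      by rewrite exprMn; ring.
    by rewrite phiE// -cq; ring.
  have rphiV : regfun [set x | h i x != 0 /\ h o x != 0] (fun x => (phi i x)^-1).
    by apply: regfun_inv => // x [hi ho]; exact: phi0.
  have [|L' [G' [pG' G'E]]] := @extend_regular (h i) (h o) (fun x => (phi i x)^-1) (q i) (q o)
    (c i * a' * mpolyX C m1) (b i) (b o) (mnm_add n1 (mnm_muln (b i) N)) N
    (ph i) (ph o) (hq i) (hq o) ho0 rphiV.
    move=> t hi ho; have [at0 _] := ac0 t hi; apply: (mulIf at0); apply: (mulIf (phi0 _ _ hi ho)).
    rewrite expoD torusD tbN !mevalM meval_mono.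
    transitivity ((ev t (a i) * t (expo n1)) * (h i (tor t) * t (expo (b i))) ^+ N).
      by rewrite exprMn; field; exact: phi0.
    by rewrite -phiE// -aq; ring.
  exists ((L + N, L' + N)%N, (G, G')); split=> //= t hi; have [at0 ct0] := ac0 t hi.
  split.
    have := GE t; rewrite expoD torusD tbN !mevalM meval_mono => E.
    apply: (mulIf (expf_neq0 N (torus_neq0 t (expo (b i))))).
    transitivity (G (tor t) * (t (expo m1) * t (expo (b i)) ^+ N) * ev t (c i)); first by ring.
    rewrite E exprD; transitivity (ev t (a i) * t (expo n1) * h i (tor t) ^+ L * (ev t (c i) * ev t c')).
      by ring.
    by rewrite cq exprMn; ring.
  have := G'E t; rewrite expoD torusD tbN !mevalM meval_mono => E.
  apply: (mulIf (expf_neq0 N (torus_neq0 t (expo (b i))))).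
  transitivity (G' (tor t) * (t (expo n1) * t (expo (b i)) ^+ N) * ev t (a i)); first by ring.
  rewrite E exprD; transitivity (ev t (c i) * t (expo m1) * h i (tor t) ^+ L' * (ev t (a i) * ev t a')).
    by ring.
  by rewrite aq exprMn; ring.
have [LG LGP] := choice HG.
(* The extensions remain inverse to each other up to a power of [h i], so neither has a zero on
   D([h i]). *)
have GG i x : (LG i).2.1 x * (LG i).2.2 x = h i x ^+ ((LG i).1.1 + (LG i).1.2)%N.
  have [pG pG' GE] := LGP i; have [x0 hx0] := hn0 i.
  suff : (fun x => (LG i).2.1 x * (LG i).2.2 x) = (fun x => h i x ^+ ((LG i).1.1 + (LG i).1.2)%N).
    by move/(congr1 (fun g => g x)).
  apply: (@aff_poly_density _ _ _ s0 _ _ (h i) x0) => //.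
  - exact: aff_polyM.
  - exact: aff_poly_exp.
  move=> t hi; have [E1 E2] := GE t hi.
  have n0 : h i (tor t) ^+ (LG i).1.1 != 0 by exact: expf_neq0.
  have [N [/divides_ev aN /divides_ev cN]] := dvd i.
  have qN : ev t (q i ^+ N) != 0 by rewrite rmorphXn expf_neq0// -hqE.
  have at0 := aN _ qN; have ct0 := cN _ qN.
  apply: (mulIf (mulf_neq0 ct0 (torus_neq0 t (expo m1)))).
  rewrite exprD; transitivity ((LG i).2.1 (tor t) * (ev t (c i) * t (expo m1)) * (LG i).2.2 (tor t)).
    by ring.
  rewrite E1; transitivity (h i (tor t) ^+ (LG i).1.1 * ((LG i).2.2 (tor t) * (ev t (a i) * t (expo n1)))).
    by ring.
  by rewrite E2; ring.
pose g i x := (LG i).2.1 x / h i x ^+ (LG i).1.1.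
have hi_open i : open [set x | h i x != 0] by exact: aff_poly_open.
have rg i : regfun [set x | h i x != 0] (g i).
  have [pG _ _] := LGP i; apply: regfunM.
    exact: regfun_restr (hi_open i) (@subsetT _ _) (aff_poly_regfun pG).
  apply: regfun_inv; last by move=> x hx; exact: expf_neq0.
  by apply: regfun_restr (hi_open i) (@subsetT _ _) (aff_poly_regfun _); exact: aff_poly_exp.
have g0 i x : h i x != 0 -> g i x != 0.
  move=> hx; have : (LG i).2.1 x * (LG i).2.2 x != 0 by rewrite GG expf_neq0.
  by rewrite mulf_eq0 negb_or => /andP[Gx _]; rewrite /g mulf_neq0// invr_eq0 expf_neq0.
exists g; split=> //; split=> // i j x hi hj.
have rgi l : (l = i \/ l = j) -> regfun [set x | h i x != 0 /\ h j x != 0] (g l).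
  by move=> lE; apply: regfun_restr (hopen i j) _ (rg l) => y []; case: lE => ->.
apply: (@aff_regfun_density _ _ s s0 [set x | h i x != 0 /\ h j x != 0] (fun x => f i j x * g j x)) => //.
- by apply: regfunM => //; apply: rgi; right.
- by apply: rgi; left.
move=> t [hit hjt].
have gE l : h l (tor t) != 0 -> g l (tor t) * (ev t (c l) * t (expo m1)) = ev t (a l) * t (expo n1).
  move=> hl; have [_ _ /(_ t hl)[E _]] := LGP l.
  apply: (mulIf (expf_neq0 (LG l).1.1 hl)); rewrite -E /g; field.
  exact: expf_neq0.
have nz l : h l (tor t) != 0 -> ev t (a l) != 0 /\ ev t (c l) != 0.
  move=> hl; have [N [/divides_ev aN /divides_ev cN]] := dvd l.
  by have qN : ev t (q l ^+ N) != 0 by [rewrite rmorphXn expf_neq0// -hqE]; split; [exact: aN|exact: cN].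
have [ai ci] := nz i hit; have [aj cj] := nz j hjt.
have := acf i j t hit hjt; rewrite !mevalM => E.
apply: (mulIf (mulf_neq0 ci (mulf_neq0 (torus_neq0 t (expo m1)) cj))).
transitivity (f i j (tor t) * ev t (c i) * (g j (tor t) * (ev t (c j) * t (expo m1)))).
  by ring.
rewrite gE//; transitivity (f i j (tor t) * (ev t (c i) * ev t (a j)) * t (expo n1)); first by ring.
rewrite E; transitivity ((ev t (a i) * t (expo n1)) * ev t (c j)); first by ring.
by rewrite -gE//; ring.
Qed.

End Laurent.

(** Line bundles on affine toric varieties are trivial. *)
Lemma aff_cocycle_gen : exists g : I -> aff_toric s -> C,
  (forall i, regfun [set x | h i x != 0] (g i)) /\
  (forall i x, h i x != 0 -> g i x != 0) /\
  (forall i j x, h i x != 0 -> h j x != 0 -> f i j x * g j x = g i x).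
Proof.
have [qb qbP] := laurent_allX.
exact: (@aff_cocycle_frac (fun i => (qb i).1) (fun i => (qb i).2) (fun i => (qbP i).1) (fun i => (qbP i).2)).
Qed.

End Cocycle.
End Cone.
End AffineCocycle.

(** * Units *)

Section Units.
Context {R : realType} {k : nat}.
Local Notation C := R[i].
Local Notation P := (mpoly k C).
Local Notation supp := (@msupp k C).
Local Notation T := (torus R k).

Lemma wt_delta (m : multinom k) j : wt (delta_mx 0 j : 'rV[R]_k) (expo m) = (m j)%:R.
Proof.
rewrite /wt /pairing (bigD1 j)//= !mxE !eqxx mulr1 big1 ?addr0// => i /negPf ij.
by rewrite !mxE ij andbF mulr0.
Qed.

(** A single term is least in every coordinate direction and in its negative. By [supp_vertex] some
    exponent of [a] is smallest and some exponent is largest in all coordinates, and the same holds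
    for the cofactor; since both pairs add up to [m0], smallest and largest coincide. *)
Lemma monomial_divisor (a : P) m0 : divides a (mpolyX C m0) ->
  exists c m, c != 0 /\ a = c *: mpolyX C m.
Proof.
move=> [a' E].
have Xn0 : mpolyX C m0 != 0 by rewrite -msupp_eq0 msuppX.
have aa0 : a * a' != 0 by rewrite -E.
have m0s : m0 \in supp (a * a') by rewrite -E msuppX inE.
have [|m1 [m2 [m1a _ m1min m2min m12]]] := supp_vertex (v := fun j => delta_mx 0 j : 'rV[R]_k) aa0 m0s.
  by move=> i m; rewrite -E msuppX inE => /eqP ->.
have [|n1 [n2 [n1a n2a' n1min n2min n12]]] := supp_vertex (v := fun j => - delta_mx 0 j : 'rV[R]_k) aa0 m0s.
  by move=> i m; rewrite -E msuppX inE => /eqP ->.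
have wtNv (w : 'rV[R]_k) m : wt (- w) m = - wt w m by exact: pairingNr.
exists (mcoeff m1 a), m1; split; first by rewrite -mcoeff_msupp.
have ms m : m \in supp a -> m = m1.
  move=> ma; apply/mnmP => j; apply/eqP; rewrite -(eqr_nat R) -!wt_delta.
  have := n1min j m ma; have := m1min j m ma; have := m1min j _ n1a.
  have := m2min j _ n2a'; have := m12 j; have := n12 j; rewrite !wtNv.
  by move=> *; apply/eqP; lra.
apply/mpolyP => m; rewrite mcoeffZ mcoeffX.
have [<-|mm1] := eqVneq m1 m; first by rewrite mulr1.
rewrite mulr0; apply: memN_msupp_eq0; apply: contra mm1 => /ms ->; exact: eqxx.
Qed.

Lemma tor_zero (z0 : [set 0 : 'rV[R]_k] 0) (t : T) : tor z0 t = t.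
Proof. by apply: aff_eq => m sm; rewrite torE. Qed.

(** Written as a single fraction, [f] has a numerator and a denominator dividing a power of the
    product of the coordinates, so both are monomials. *)
Lemma torus_unit (f : T -> C) : regfun setT f -> (forall t, f t != 0) ->
  exists c m, c != 0 /\ forall t, f t = c * t m.
Proof.
move=> /aff_regfunP rf f0.
pose F (z : 'I_k -> C) := if pselect (exists t : T, tcoord t = z) is left H then f (projT1 (cid H)) else 0.
have FE t : F (tcoord t) = f t.
  rewrite /F; case: pselect => [H|[]]; last by exists t.
  by case: cid => u /= /tcoord_inj ->.
have z0 : [set 0 : 'rV[R]_k] 0 by [].
have FU : regular_unit (@allX R k) F.
  move=> z /allX_point[t <-]; have [al [be [pal pbe bt fE]]] := rf t I.
  have [A [c alA]] := laurent_exists z0 pal; have [B [d beB]] := laurent_exists z0 pbe.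
  exists (A * mpolyX C d), (B * mpolyX C c); split.
  - rewrite mevalM meval_mono -alA tor_zero !mulf_neq0 ?torus_neq0//.
    by have := f0 t; have [_ ->] := fE _ bt; rewrite mulf_eq0 negb_or => /andP[].
  - by rewrite mevalM meval_mono -beB tor_zero !mulf_neq0 ?torus_neq0.
  move=> w /allX_point[u <-] bw; have bu : be u != 0.
    by move: bw; rewrite mevalM -beB tor_zero !mulf_eq0 !negb_or => /andP[/andP[]].
  rewrite FE !mevalM !meval_mono -alA -beB tor_zero.
  by have [_ ->] := fE _ bu; field.
have [a [c [N [aN cN FF]]]] := regular_unit_frac (@allX_neq0 R k) FU.
rewrite /allX mpolyXn in aN cN.
have [a0 [m [a00 aE]]] := monomial_divisor aN; have [c0 [n [c00 cE]]] := monomial_divisor cN.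
exists (a0 / c0), (expo m - expo n); split; first by rewrite mulf_neq0// invr_eq0.
move=> t; have := FF (tcoord t) (meval_allX_coord t).
rewrite FE aE cE !mevalZ !meval_mono torusB => E.
apply: (mulIf (mulf_neq0 c00 (torus_neq0 t (expo n)))).
by rewrite E; field; rewrite c00 torus_neq0.
Qed.

(** Otherwise f would vanish or blow up at the limit point in direction v. *)
Lemma unit_perp (s : set 'rV[R]_k) (s0 : s 0) (f : aff_toric s -> C) c m v : s v ->
  regfun setT f -> (forall x, f x != 0) -> c != 0 ->
  (forall t, f (tor s0 t) = c * t m) -> wt v m = 0.
Proof.
move=> sv /aff_regfunP rf f0 c0 fE.
pose y := ray_limit sv (torus_one : T).
have [a [b [pa pb b_y fab]]] := rf y I.
have ay : a y != 0.
  by have := f0 y; have [_ ->] := fab _ b_y; rewrite mulf_eq0 negb_or => /andP[].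
have [A [d aA]] := laurent_exists s0 pa; have [B [e bB]] := laurent_exists s0 pb.
(* The exponent [m] may have negative entries, which [b'] clears. *)
have [b' b'P] := expo_shift [:: m]; have [|m' m'E] := b'P m; first by rewrite inE.
have [sA _] := laurent_unique pa aA; have [sB _] := laurent_unique pb bB.
have B0 := laurent_neq0 pb bB b_y.
have E : A * (mpolyX C (mnm_add e b')) = c *: (B * mpolyX C (mnm_add m' d)).
  apply: (mpoly_torus_eq B0) => t; rewrite -bB mulf_eq0 negb_or => /andP[bt _].
  have := fE t; have [_ ->] := fab _ bt => /(canRL (divfK bt)) ab.
  rewrite mevalZ !mevalM !meval_mono -aA -bB ab !expoD !torusD m'E torusD; ring.
(* Numerator and denominator are both nonzero at the limit, so each has a term of weight zero;
   traced through [E], the two terms bound the weight of [m] from either side. *)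
have [n nA nd] := ray_limit_neq0 pa aA ay; have [l lB le] := ray_limit_neq0 pb bB b_y.
have H1 : wt v m <= 0.
  have : mnm_add (mnm_add e b') n \in supp (c *: (B * mpolyX C (mnm_add m' d))).
    by rewrite -E mcoeff_msupp mcoeffMX -mcoeff_msupp.
  rewrite (perm_mem (msuppZ _ c0)) => /msuppM_le/allpairsP[[n1 n2] /= [n1B]].
  rewrite msuppX inE => /eqP -> /(congr1 (fun x => wt v (expo x))).
  rewrite !expoD !wtD m'E wtD nd; have : 0 <= wt v (expo n1 - expo e) by exact: (sB _ n1B).
  rewrite wtB; lra.
have H2 : 0 <= wt v m.
  have : mnm_add (mnm_add m' d) l \in supp (A * mpolyX C (mnm_add e b')).
    rewrite E (perm_mem (msuppZ _ c0)).
    by rewrite mcoeff_msupp mcoeffMX -mcoeff_msupp.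
  move=> /msuppM_le/allpairsP[[n1 n2] /= [n1A]].
  rewrite msuppX inE => /eqP -> /(congr1 (fun x => wt v (expo x))).
  rewrite !expoD !wtD m'E wtD le; have : 0 <= wt v (expo n1 - expo d) by exact: (sA _ n1A).
  rewrite wtB; lra.
by apply/eqP; rewrite eq_le H1 H2.
Qed.

End Units.

(** * Principal bundles on affine toric varieties *)

Section TorusPoints.
Context {R : realType} {n : nat}.
Local Notation C := R[i].
Local Notation T := (torus R n : funSpaceType C).

Lemma regfun_exprz (X : funSpaceType C) (U : set X) (f : X -> C) (z : int) :
  regfun U f -> (forall x, U x -> f x != 0) -> regfun U (fun x => f x ^ z).
Proof.
move=> rf f0; case: z => [m|m]; first exact: regfun_exp.
apply: (@regfun_inv _ _ _ (fun x => f x ^+ m.+1)); first exact: regfun_exp.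
by move=> x Ux; rewrite expf_neq0// f0.
Qed.

Definition torus_of (z : 'I_n -> C) : torus R n :=
  if pselect (forall j, z j != 0) is left z0 then torus_point z0 else torus_one.

Lemma torus_ofE z m : (forall j, z j != 0) -> torus_of z m = \prod_j z j ^ m 0 j.
Proof. by rewrite /torus_of; case: pselect. Qed.

Lemma tcoord_torus_of z : (forall j, z j != 0) -> tcoord (torus_of z) = z.
Proof. by rewrite /torus_of; case: pselect => // z0 _; exact: tcoord_torus_point. Qed.

Lemma torus_of_regfun (X : funSpaceType C) (U : set X) (z : X -> 'I_n -> C) m : open U ->
  (forall j, regfun U (fun x => z x j)) -> (forall x j, U x -> z x j != 0) ->
  regfun U (fun x => torus_of (z x) m).
Proof.
move=> oU rz z0; apply: (@regfun_eq _ _ _ _ (fun x => \prod_j z x j ^ m 0 j)).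
  by move=> x Ux; rewrite torus_ofE// => j; exact: z0.
by apply: regfun_prod => // j; apply: regfun_exprz => // x; exact: z0.
Qed.

Lemma morphism_to_torus (Z : funSpaceType C) (U : set Z) (f : Z -> T) :
  open U -> (forall m, regfun U (fun z => f z m)) -> morphism_on U f.
Proof. by move=> oU rf; apply: morphism_to_aff. Qed.

Section Inverse.
Variable t : torus R n.
Fact torus_inv0 : t (- 0) = 1. Proof. by rewrite oppr0 aff_val0. Qed.
Fact torus_invD m m' : dual_monoid [set 0 : 'rV[R]_n] m -> dual_monoid [set 0 : 'rV[R]_n] m' ->
  t (- (m + m')) = t (- m) * t (- m').
Proof. by move=> _ _; rewrite opprD torusD. Qed.
Fact torus_inv_out m : ~ dual_monoid [set 0 : 'rV[R]_n] m -> t (- m) = 0.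
Proof. by case; exact: dual_monoid_torus. Qed.
Definition torus_inv : torus R n :=
  AffToric (aff_val := fun m => t (- m)) torus_inv0 torus_invD torus_inv_out.
End Inverse.

Lemma torus_invE t m : torus_inv t m = (t m)^-1.
Proof. exact: torusN. Qed.

Lemma torus_mulE (t u : torus R n) m : torus_mul t u m = t m * u m.
Proof. by []. Qed.

Lemma torus_eq (t u : torus R n) : (forall m, t m = u m) -> t = u.
Proof. by move=> H; apply: aff_eq => m _. Qed.

End TorusPoints.

(** * Fibres of a principal bundle as torsors *)

Section Bundle.
Context {R : realType} {n : nat} (X E : funSpaceType R[i]).
Local Notation C := R[i].
Local Notation T := (torus R n : funSpaceType C).
Variables (p : E -> X) (act : torus R n -> E -> E).
Hypothesis bundleE : principal_bundle p act.

Let p_act t x : p (act t x) = p x.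
Proof. by case: bundleE. Qed.

Let act1 x : act torus_one x = x.
Proof. by case: bundleE => _ []. Qed.

Let actM t u x : act (torus_mul t u) x = act t (act u x).
Proof. by case: bundleE => _ []. Qed.

Lemma act_transitive e e' : p e = p e' -> exists t, e' = act t e.
Proof.
move=> ee'; case: bundleE => _ _ _ _ /(_ (p e))[U [theta [psi [[_ Ue] _ _ tpsi [_ tact]]]]].
exists (torus_mul (theta e').2 (torus_inv (theta e).2)).
set t := torus_mul _ _; have [t1 t2] := tpsi e Ue.
have Ue' : U (p e') by rewrite -ee'.
have Ut : U (p (act t e)) by rewrite p_act.
have [t1' t2'] := tpsi _ Ue'; have [t1'' t2''] := tpsi _ Ut.
rewrite -[LHS]t2' -[RHS]t2''; congr psi.
rewrite (surjective_pairing (theta e')) (surjective_pairing (theta (act t e))).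
rewrite t1' t1'' p_act ee'; congr pair; rewrite tact//; apply: torus_eq => m.
by rewrite !torus_mulE torus_invE divfK// torus_neq0.
Qed.

Lemma act_free t t' e : act t e = act t' e -> t = t'.
Proof.
case: bundleE => _ _ _ _ /(_ (p e))[U [theta [psi [[_ Ue] _ _ tpsi [_ tact]]]]] E'.
have := congr1 (fun x => (theta x).2) E'; rewrite !tact// => E''; apply: torus_eq => m.
have := congr1 (fun u : torus R n => u m) E''; rewrite !torus_mulE => /mulIf; apply.
exact: torus_neq0.
Qed.

(** The torus element that carries [e] to [e'], with default 1 for points of different fibres. *)
Definition tdiff (e e' : E) : torus R n :=
  if pselect (exists t, e' = act t e) is left H then projT1 (cid H) else torus_one.

Lemma tdiffP e e' : p e = p e' -> act (tdiff e e') e = e'.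
Proof.
move=> /act_transitive H; rewrite /tdiff; case: pselect => // H'.
by case: cid => t /= ->.
Qed.

Lemma tdiff_act t e : tdiff e (act t e) = t.
Proof.
apply: (@act_free _ _ e); apply: tdiffP; by rewrite p_act.
Qed.

Lemma tdiff_trans e e' e'' m : p e = p e' -> p e' = p e'' ->
  tdiff e e'' m = tdiff e e' m * tdiff e' e'' m.
Proof.
move=> ee' ee''; have := tdiff_act (torus_mul (tdiff e' e'') (tdiff e e')) e.
by rewrite actM tdiffP// tdiffP// => ->; rewrite torus_mulE mulrC.
Qed.

Lemma tdiff_actr t e e' : p e = p e' -> tdiff e (act t e') = torus_mul t (tdiff e e').
Proof. by move=> ee'; rewrite -{1}(tdiffP ee') -actM tdiff_act. Qed.

(** In a local trivialization this is a quotient of torus coordinates. *)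
Lemma tdiff_regfun (Z : funSpaceType C) (U : set Z) (f g : Z -> E) m :
  morphism_on U f -> morphism_on U g -> (forall z, U z -> p (f z) = p (g z)) ->
  regfun U (fun z => tdiff (f z) (g z) m).
Proof.
move=> mf mg fg; apply: regfun_local => z Uz.
case: bundleE => _ _ mp _ /(_ (p (f z)))[W [theta [psi [[oW Wz] mtheta _ tpsi [_ tact]]]]].
have mpf := morphism_comp mf mp; have mpg := morphism_comp mg mp.
pose V := U `&` (p \o f) @^-1` W.
have oV : open V by exact: morphism_on_open mpf oW.
exists V; split=> //; first by move=> y [].
have mV (h : Z -> E) : morphism_on U h -> (forall z, U z -> p (f z) = p (h z)) ->
    regfun V (fun z => (theta (h z)).2 m).
  move=> mh fh; have := morphism_on_comp mh mtheta; set V' := (X in morphism_on X) => mth.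
  have VE : V = V'.
    by apply/seteqP; split=> y [Uy /= Wy]; split=> //=; [rewrite -fh|rewrite fh].
  rewrite VE; have := morphism_comp mth (@vprod_snd _ _ _).
  move=> /(_ setT (fun t : T => t m) (torus_char_regfun m)).
  by rewrite preimage_setT setIT.
apply: (@regfun_eq _ _ _ _ (fun z => (theta (g z)).2 m * ((theta (f z)).2 m)^-1)).
  move=> y [Uy Wy]; rewrite -{2}(tdiffP (fg y Uy)) tact// torus_mulE mulfK//.
  exact: torus_neq0.
apply: regfunM; first exact: mV.
by apply: regfun_inv; [exact: mV|move=> y _; exact: torus_neq0].
Qed.

Lemma act_morphism (Z : funSpaceType C) (U : set Z) (t : Z -> T) (f : Z -> E) :
  morphism_on U t -> morphism_on U f -> morphism_on U (fun z => act (t z) (f z)).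
Proof.
move=> mt mf; have [_ [_ _ mact] _ _ _] := bundleE.
exact: (morphism_comp (morphism_pair mt mf) mact).
Qed.

Lemma local_section (b : X) : exists (U : set X) (sec : X -> E),
  [/\ open U, U b, morphism_on U sec & forall x, U x -> p (sec x) = x].
Proof.
case: bundleE => _ _ _ _ /(_ b)[U [theta [psi [[oU Ub] _ mpsi _ [psit _]]]]].
exists U, (fun x => psi (x, torus_one)); split=> //; last by move=> x Ux; have [] := psit x torus_one Ux.
have mi : morphism_on setT (fun x : X => (x, torus_one) : vprod X T).
  apply: morphism_pair; first by move=> V g; rewrite setTI.
  apply: morphism_to_torus; first exact: openT.
  by move=> m; apply: regfun_cst; exact: openT.
by have := morphism_on_comp mi mpsi; rewrite setTI.
Qed.

End Bundle.

(** * Global sections over affine toric charts *)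

Section AffineSection.
Context {R : realType} {k n : nat} (X E : funSpaceType R[i]).
Local Notation C := R[i].
Local Notation T := (torus R n : funSpaceType C).
Variables (p : E -> X) (act : torus R n -> E -> E).
Hypothesis bundleE : principal_bundle p act.
Variables (s : set 'rV[R]_k) (sc : rational_cone s) (iota : aff_toric s -> X).
Hypothesis miota : morphism iota.

(** Each coordinate of the differences of local sections is the cocycle of a line bundle on U_s,
    hence a coboundary; the local sections are corrected by the inverses of the trivializing
    functions. The cover is indexed by the points of U_s. *)
Lemma aff_section : exists sec : aff_toric s -> E, morphism sec /\ forall y, p (sec y) = iota y.
Proof.
have Hloc x : exists hs : (aff_toric s -> C) * (aff_toric s -> E),
    [/\ aff_poly hs.1, hs.1 x != 0, morphism_on [set y | hs.1 y != 0] hs.2 &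
        forall y, hs.1 y != 0 -> p (hs.2 y) = iota y].
  have [U [sec [oU Ux msec psec]]] := local_section bundleE (iota x).
  have oUi := morphism_open miota oU.
  have [a [pa ax aU]] : exists a, [/\ aff_poly a, a x != 0 & forall y, a y != 0 -> U (iota y)].
    by move/aff_openP: oUi; apply.
  exists (a, sec \o iota); split=> //= [|y ay]; last exact/psec/aU.
  have := morphism_on_comp miota msec; rewrite setTI.
  apply: morphism_on_sub; first exact: aff_poly_open.
  by move=> y /aU.
have [hs hsP] := choice Hloc; pose h x := (hs x).1; pose sec x := (hs x).2.
have ph x : aff_poly (h x) by have [] := hsP x.
have hx x : h x x != 0 by have [] := hsP x.
have msec x : morphism_on [set y | h x y != 0] (sec x) by have [] := hsP x.
have psec x y : h x y != 0 -> p (sec x y) = iota y by have [_ _ _] := hsP x; exact.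
pose D x x' := [set y | h x y != 0 /\ h x' y != 0].
have oD x x' : open (D x x').
  have -> : D x x' = [set y | h x y * h x' y != 0].
    apply/seteqP; split=> y /=; first by move=> [? ?]; rewrite mulf_neq0.
    by rewrite mulf_eq0 negb_or => /andP[].
  by apply: aff_poly_open; exact: aff_polyM.
pose f x x' y : T := tdiff act (sec x' y) (sec x y).
have [[r [v sE]] _] := sc.
have HG j : exists g : aff_toric s -> aff_toric s -> C,
    (forall i, regfun [set x | h i x != 0] (g i)) /\
    (forall i x, h i x != 0 -> g i x != 0) /\
    (forall i i' x, h i x != 0 -> h i' x != 0 -> tcoord (f i i' x) j * g i' x = g i x).
  apply: (@aff_cocycle_gen R k s r v sc sE (aff_toric s) h (fun x x' y => tcoord (f x x' y) j)) => //.
  - by move=> x; exists x.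
  - by move=> x; exists x.
  - move=> x x'; apply: (tdiff_regfun bundleE).
    + by apply: morphism_on_sub (oD x x') _ (msec x') => y [].
    + by apply: morphism_on_sub (oD x x') _ (msec x) => y [].
    + by move=> y [xy x'y]; rewrite !psec.
  - by move=> *; exact: torus_neq0.
  - move=> x x' x'' y xy x'y x''y; rewrite /tcoord /f mulrC.
    by rewrite -(tdiff_trans bundleE)// !psec.
have [g gP] := choice HG.
have g0 x y j : h x y != 0 -> (g j x y)^-1 != 0.
  by move=> xy; rewrite invr_eq0; have [_ [+ _]] := gP j; apply.
pose t x y := torus_of (fun j => (g j x y)^-1).
have mt x : morphism_on [set y | h x y != 0] (t x : _ -> T).
  have oh : open [set y | h x y != 0] by exact: aff_poly_open.
  apply: morphism_to_torus => // m; apply: torus_of_regfun => //.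
    move=> j; have [rg [gn0 _]] := gP j; apply: regfun_inv; first exact: rg.
    by move=> y; exact: gn0.
  by move=> y j; exact: g0.
have tsec x x' y : h x y != 0 -> h x' y != 0 -> act (t x y) (sec x y) = act (t x' y) (sec x' y).
  move=> xy x'y; have E' : p (sec x' y) = p (sec x y) by rewrite !psec.
  rewrite -(tdiffP bundleE E'); case: (bundleE) => _ [_ actM _] _ _ _; rewrite -actM; congr act.
  apply: tcoord_inj; apply/funext => j; rewrite /tcoord torus_mulE.
  rewrite -[t x y _]/(tcoord (t x y) j) -[t x' y _]/(tcoord (t x' y) j).
  rewrite !tcoord_torus_of; try by move=> i; exact: g0.
  have [_ [gn0 gE]] := gP j; have := gE x x' y xy x'y => <-.
  rewrite /tcoord -/(f x x' y) invfM mulrAC mulVf ?mul1r//; exact: torus_neq0.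
(* At [y] the chart chosen for [y] itself is used; by [tsec] any other chart around [y] gives the
   same value. *)
exists (fun y => act (t y y) (sec y y)); split; last first.
  by move=> y; case: (bundleE) => _ _ _ p_act _; rewrite p_act psec.
apply: morphism_on_local => y _; exists [set y' | h y y' != 0]; split; [exact: hx|by []|].
have H := act_morphism bundleE (mt y) (msec y).
by apply: morphism_on_eq H => y' yy'; exact: tsec.
Qed.

End AffineSection.

(** * Principal bundles on toric varieties *)

Section NormalizedSections.
Context {R : realType} {k n : nat} (S : set (set 'rV[R]_k)) (E : funSpaceType R[i]).
Local Notation C := R[i].
Hypotheses (fanS : fan S) (zeroS : S [set 0]).
Variables (p : E -> toric_variety S) (act : torus R n -> E -> E).
Hypothesis bundleE : principal_bundle p act.

Lemma torus_val h (t : torus R h) m : t m = \prod_j tcoord t j ^ m 0 j.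
Proof.
have z0 j : tcoord t j != 0 by exact: torus_neq0.
have -> : t = torus_point z0 by apply: tcoord_inj; rewrite tcoord_torus_point.
by apply: eq_bigr => j _; rewrite tcoord_torus_point.
Qed.

Lemma tor_morphism (s : set 'rV[R]_k) (s0 : s 0) : morphism (tor s0 : (torus R k : funSpaceType C) -> _).
Proof. exact: aff_restr_morphism. Qed.

Lemma aff_restr_tor (s t : set 'rV[R]_k) (ts : t `<=` s) (t0 : t 0) (s0 : s 0) u :
  aff_restr ts (tor t0 u) = tor s0 u.
Proof.
apply: aff_eq => m sm; rewrite aff_restrE// !torE//.
exact: dual_monoid_sub ts _ sm.
Qed.

Lemma chart_tor (s : set 'rV[R]_k) (Ss : S s) (s0 : s 0) u : chart Ss (tor s0 u) = chart zeroS u.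
Proof. exact: chart_restr. Qed.

Lemma exists_sections : exists sec : forall s, aff_toric s -> E,
  forall s (Ss : S s), morphism (sec s) /\ forall y, p (sec s y) = chart Ss y.
Proof.
have H s (Ss : S s) : exists sec : aff_toric s -> E, morphism sec /\ forall y, p (sec y) = chart Ss y.
  have mc : morphism (chart Ss) by exact: chart_morphism.
  exact: (aff_section bundleE (fan_cone fanS Ss) mc).
have [e0 _] := H _ zeroS.
(* Sets outside the fan receive a constant map, so that one family indexed by all sets can be
   chosen. *)
have H' s : exists sec : aff_toric s -> E, forall Ss : S s, morphism sec /\ forall y, p (sec y) = chart Ss y.
  have [Ss|nSs] := pselect (S s); last by exists (fun=> e0 torus_one).
  have [sec [msec psec]] := H s Ss; exists sec => Ss'; split=> // y.
  by rewrite psec; exact: chart_irrelevance.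
exists (fun s => projT1 (cid (H' s))) => s Ss.
by case: cid => sec /=; apply.
Qed.

(** Comparing the sections over the affine charts with a fixed section e0 over
    the torus, the units on the torus being monomials up to constants *)
Lemma normalized_sections : exists (sec : forall s, aff_toric s -> E) (e0 : torus R k -> E)
    (M : set 'rV[R]_k -> 'M[int]_(n, k)),
  (forall s (Ss : S s), morphism (sec s) /\ forall y, p (sec s y) = chart Ss y) /\
  (forall t, p (e0 t) = chart zeroS t) /\
  (forall s (Ss : S s) (s0 : s 0) t m', tdiff act (e0 t) (sec s (tor s0 t)) m' = t (m' *m M s)).
Proof.
have [sec secP] := exists_sections; pose e0 := sec [set 0].
have [me0 pe0] := secP _ zeroS.
(* Row j of the matrix is the character, and entry j of the vector the constant, in the j-th
   coordinate of the difference from [e0]. *)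
have H s : exists cM : ('I_n -> C) * 'M[int]_(n, k), S s -> (forall j, cM.1 j != 0) /\
    forall (s0 : s 0) t m', tdiff act (e0 t) (sec s (tor s0 t)) m' = torus_of cM.1 m' * t (m' *m cM.2).
  have [Ss|nSs] := pselect (S s); last by exists (fun=> 0, 0).
  have [msec psec] := secP s Ss; have s0 := rational_cone0 (fan_cone fanS Ss).
  have rt j : regfun setT (fun t : torus R k => tdiff act (e0 t) (sec s (tor s0 t)) (delta_mx 0 j)).
    apply: (tdiff_regfun bundleE) => //.
      exact: morphism_comp (@tor_morphism s s0) msec.
    by move=> t _; rewrite pe0 psec chart_tor.
  have Hj j : exists cm : C * 'rV[int]_k, cm.1 != 0 /\
      forall t, tdiff act (e0 t) (sec s (tor s0 t)) (delta_mx 0 j) = cm.1 * t cm.2.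
    have [c [m [c0 E']]] := torus_unit (@rt j) (fun t => torus_neq0 _ _).
    by exists (c, m).
  have [cm cmP] := choice Hj.
  exists (fun j => (cm j).1, \matrix_j (cm j).2) => _ /=; split; first by move=> j; have [] := cmP j.
  move=> s0' t m'; rewrite (Prop_irrelevance s0' s0).
  rewrite torus_ofE => [|j]; last by have [] := cmP j.
  rewrite torus_val mulmx_sum_row torus_sum -big_split; apply: eq_bigr => j _.
  have [_ cmE] := cmP j; rewrite /tcoord cmE expfzMl; congr (_ * _).
  rewrite rowK -torus_exprz; congr (aff_val t _).
  by apply/rowP => i; rewrite -scaler_int !mxE intz.
have [cM cMP] := choice H.
(* Translating each section by a fixed torus element removes the constants. *)
exists (fun s y => act (torus_inv (torus_of (cM s).1)) (sec s y)), e0, (fun s => (cM s).2).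
split; [|split=> // s Ss s0 t m'].
  move=> s Ss; have [msec psec] := secP s Ss; split.
    apply: (act_morphism bundleE) => //; apply: morphism_to_torus; first exact: openT.
    by move=> m; apply: regfun_cst; exact: openT.
  by move=> y; case: (bundleE) => _ _ _ pact _; rewrite pact.
have [msec psec] := secP s Ss.
rewrite (tdiff_actr bundleE); last by rewrite pe0 psec chart_tor.
have [c0 cE] := cMP s Ss.
by rewrite torus_mulE torus_invE cE mulrA mulVf ?mul1r// torus_neq0.
Qed.

(** * Transition functions between normalized sections *)

Section Transition.
Variables (sec : forall s : set 'rV[R]_k, aff_toric s -> E) (e0 : torus R k -> E) (M : set 'rV[R]_k -> 'M[int]_(n, k)).
Hypothesis secP : forall s (Ss : S s), morphism (@sec s) /\ forall y, p (sec y) = chart Ss y.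
Hypothesis pe0 : forall t, p (e0 t) = chart zeroS t.
Hypothesis secM : forall s (Ss : S s) (s0 : s 0) t m',
  tdiff act (e0 t) (sec (tor s0 t)) m' = t (m' *m M s).

Section Pair.
Variables (s t : set 'rV[R]_k) (Ss : S s) (St : S t).
Let l : s `&` t `<=` s := @subIsetl _ s t.
Let r : s `&` t `<=` t := @subIsetr _ s t.
Let u z : torus R n := tdiff act (sec (aff_restr r z)) (sec (aff_restr l z)).
Let St0 : (s `&` t) 0.
Proof. by split; exact: rational_cone0 (fan_cone fanS _). Qed.

Let same_fibre z : p (sec (aff_restr r z)) = p (sec (aff_restr l z)).
Proof.
have [_ ->] := secP St; have [_ ->] := secP Ss; symmetry.
by apply/(chart_eqP fanS); exists z.
Qed.

Let ru m' : regfun setT (fun z => u z m').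
Proof.
apply: (tdiff_regfun bundleE) => [||z _]; last exact: same_fibre.
- exact: morphism_comp (@aff_restr_morphism _ _ _ _ r) (secP St).1.
- exact: morphism_comp (@aff_restr_morphism _ _ _ _ l) (secP Ss).1.
Qed.

Let u_tor x m' : u (tor St0 x) m' = x (m' *m (M s - M t)).
Proof.
have s0 := St0.1; have t0 := St0.2.
rewrite /u (aff_restr_tor _ _ s0) (aff_restr_tor _ _ t0).
have := @tdiff_trans _ _ _ _ _ _ bundleE (e0 x) (sec (tor t0 x)) (sec (tor s0 x)) m'.
rewrite pe0; have [_ ->] := secP St; have [_ ->] := secP Ss; rewrite !chart_tor.
move=> /(_ erefl erefl); rewrite (secM Ss) (secM St) mulmxBr torusB => ->.
by rewrite mulrAC divff ?mul1r// torus_neq0.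
Qed.

(** The transition function is a unit on the overlap that restricts to a character of the torus, so
    this character is orthogonal to the common face. *)
Lemma transition_perp m' v : s v -> t v -> wt v (m' *m M s) = wt v (m' *m M t).
Proof.
move=> sv tv; apply/eqP; rewrite -subr_eq0 -wtB -mulmxBr; apply/eqP.
apply: (@unit_perp _ _ (s `&` t) St0 (fun z => u z m') 1) => //.
- by move=> z; exact: torus_neq0.
- exact: oner_neq0.
- by move=> x; rewrite u_tor mul1r.
Qed.

Lemma transition_dual m' : dual_monoid (s `&` t) (m' *m (M s - M t)).
Proof.
move=> v [sv tv]; rewrite -/(wt v _) mulmxBr wtB.
by rewrite (transition_perp m' sv tv) subrr.
Qed.

(** True on the torus by the normalization, and on the whole overlap by density. *)
Lemma transition z m' : u z m' = z (m' *m (M s - M t)).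
Proof.
have rz : regfun setT (fun z : aff_toric (s `&` t) => z (m' *m (M s - M t))).
  exact: aff_char_regfun.
have H := aff_regfun_density (s0 := St0) (@ru m') rz.
by apply: (H _ z I) => x _; rewrite u_tor torE//; exact: transition_dual.
Qed.

Lemma transition_act z : sec (aff_restr l z) = act (u z) (sec (aff_restr r z)).
Proof. by rewrite /u (tdiffP bundleE). Qed.

End Pair.
End Transition.
End NormalizedSections.

(** * The twisted product *)

Section TwistedFan.
Context {R : realType} {k n : nat}.
Variables (SB : set (set 'rV[R]_k)) (SF : set (set 'rV[R]_n)) (Phi : 'rV[R]_k -> 'rV[R]_n).
Implicit Types (s : set 'rV[R]_k) (t : set 'rV[R]_n).

Definition twist s t : set 'rV[R]_(k + n) :=
  [set x + y | x in graph_cone Phi s & y in fiber_cone t].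

Lemma twistP s t w : twist s t w <-> s (lsubmx w) /\ t (rsubmx w - Phi (lsubmx w)).
Proof.
split=> [[_ [x sx <-] [_ [y ty <-] <-]]|[sw tw]].
  by rewrite add_row_mx addr0 row_mxKl row_mxKr addrAC subrr add0r.
exists (row_mx (lsubmx w) (Phi (lsubmx w))); first by exists (lsubmx w).
exists (row_mx 0 (rsubmx w - Phi (lsubmx w))); first by exists (rsubmx w - Phi (lsubmx w)).
by rewrite add_row_mx addr0 addrCA subrr addr0 hsubmxK.
Qed.

Lemma twist_row s t x y : twist s t (row_mx x y) <-> s x /\ t (y - Phi x).
Proof. by rewrite twistP row_mxKl row_mxKr. Qed.

Lemma twistI s s' t t' : twist s t `&` twist s' t' = twist (s `&` s') (t `&` t').
Proof.
apply/seteqP; split=> w.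
  by move=> [/twistP[? ?] /twistP[? ?]]; apply/twistP; split; split.
by move=> /twistP[[? ?] [? ?]]; split; apply/twistP; split.
Qed.

Lemma pairing_row (m1 x : 'rV[R]_k) (m2 y : 'rV[R]_n) :
  pairing (row_mx m1 m2) (row_mx x y) = pairing m1 x + pairing m2 y.
Proof.
rewrite /pairing big_split_ord; congr (_ + _); apply: eq_bigr => i _.
  by rewrite !row_mxEl.
by rewrite !row_mxEr.
Qed.

Lemma pairing_mulmx (m : 'rV[R]_n) (x : 'rV[R]_k) (A : 'M[R]_(k, n)) :
  pairing m (x *m A) = pairing (m *m A^T) x.
Proof.
have E h (u w : 'rV[R]_h) : pairing u w = (u *m w^T) 0 0.
  by rewrite mxE; apply: eq_bigr => i _; rewrite mxE.
by rewrite !E trmx_mul mulmxA.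
Qed.

(** Over [s] the shear (x, y) -> (x, y - Phi x) is linear and turns the twisted cone into s x t. The
    term [m2 *m A^T] is the effect of the shear on linear forms. *)
Lemma face_twist s s' t t' : (exists A : 'M[R]_(k, n), forall x, s x -> Phi x = x *m A) ->
  s 0 -> t 0 -> face s' s -> face t' t -> face (twist s' t') (twist s t).
Proof.
move=> [A PhiA] s0 t0 [m1 m1s s'E] [m2 m2t t'E].
have pE x y : s x -> pairing (row_mx (m1 - m2 *m A^T) m2) (row_mx x y) =
    pairing m1 x + pairing m2 (y - Phi x).
  move=> sx; rewrite pairing_row pairingDl pairingNl -pairing_mulmx PhiA// pairingDr pairingNr.
  by rewrite addrAC -addrA.
exists (row_mx (m1 - m2 *m A^T) m2).
  move=> w /twistP[sw tw]; rewrite -(hsubmxK w) pE// addr_ge0//; [exact: m1s|exact: m2t].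
apply/seteqP; split=> w.
  move=> /twistP; rewrite s'E t'E => -[[sw /= w1] [tw /= w2]]; split; first exact/twistP.
  by rewrite /= -(hsubmxK w) pE// w1 w2 addr0.
move=> [/twistP[sw tw] /=]; rewrite -{1}(hsubmxK w) pE// => /eqP.
rewrite paddr_eq0; [|exact: m1s|exact: m2t] => /andP[/eqP w1 /eqP w2].
by apply/twistP; rewrite s'E t'E.
Qed.

Lemma twist_face s t f : (exists A : 'M[R]_(k, n), forall x, s x -> Phi x = x *m A) ->
  s 0 -> t 0 -> face f (twist s t) -> exists s' t', [/\ face s' s, face t' t & f = twist s' t'].
Proof.
move=> [A PhiA] s0 t0 [m mst fE].
have Phi0 : Phi 0 = 0 by rewrite PhiA// mul0mx.
pose m1 := lsubmx m + rsubmx m *m A^T; pose m2 := rsubmx m.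
have pE w : s (lsubmx w) -> pairing m w = pairing m1 (lsubmx w) + pairing m2 (rsubmx w - Phi (lsubmx w)).
  move=> sw; rewrite -{1}(hsubmxK w) -{1}(hsubmxK m) pairing_row pairingDl -pairing_mulmx.
  by rewrite pairingDr pairingNr -PhiA// addrACA subrr addr0.
have m1s x : s x -> 0 <= pairing m1 x.
  move=> sx; have := mst (row_mx x (Phi x)); rewrite pE row_mxKl// row_mxKr subrr pairing0r addr0.
  by apply; apply/twist_row; rewrite subrr.
have m2t y : t y -> 0 <= pairing m2 y.
  move=> ty; have := mst (row_mx 0 y); rewrite pE row_mxKl// row_mxKr Phi0 subr0 pairing0r add0r.
  by apply; apply/twist_row; rewrite Phi0 subr0.
exists (s `&` [set x | pairing m1 x = 0]), (t `&` [set y | pairing m2 y = 0]); split.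
- by exists m1.
- by exists m2.
rewrite fE; apply/seteqP; split=> w.
  move=> [/twistP[sw tw] /= /eqP]; rewrite pE// paddr_eq0; [|exact: m1s|exact: m2t].
  by move=> /andP[/eqP w1 /eqP w2]; apply/twistP.
move=> /twistP[[sw /= w1] [tw /= w2]]; split; first exact/twistP.
by rewrite /= pE// w1 w2 addr0.
Qed.

Lemma sum_row_mx (I : Type) (r : seq I) (F : I -> 'rV[R]_k) (G : I -> 'rV[R]_n) :
  \sum_(i <- r) row_mx (F i) (G i) = row_mx (\sum_(i <- r) F i) (\sum_(i <- r) G i).
Proof.
elim/big_rec3: _ => [|i x y z _ ->]; first by rewrite row_mx0.
by rewrite add_row_mx.
Qed.

(** Generators are the lifts of the generators of [s] to the graph, integral because Phi is,
    together with the generators of [t]. *)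
Lemma rational_cone_twist s t : (exists A : 'M[R]_(k, n), forall x, s x -> Phi x = x *m A) ->
  (forall v : 'rV[int]_k, s (real_of v) -> exists w : 'rV[int]_n, Phi (real_of v) = real_of w) ->
  rational_cone s -> rational_cone t -> rational_cone (twist s t).
Proof.
move=> [A PhiA] Phi_int sc tc; have s0 := rational_cone0 sc; have t0 := rational_cone0 tc.
have Phi0 : Phi 0 = 0 by rewrite PhiA// mul0mx.
have [[[r [v sE]] sconv] [[r' [u tE]] tconv]] := (sc, tc).
have /choice[w wE] i : exists w : 'rV[int]_n, Phi (real_of (v i)) = real_of w.
  by apply: Phi_int; exact: cone_gen sE i.
split; last first.
  move=> y /twistP[sy ty] /twistP; rewrite -scaleN1r !linearZ/= !scaleN1r => -[sNy].
  have l0 := sconv _ sy sNy; rewrite l0 oppr0 Phi0 subr0 => tNy.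
  have r0 : rsubmx y = 0 by apply: tconv => //; move: ty; rewrite l0 Phi0 subr0.
  by rewrite -(hsubmxK y) l0 r0 row_mx0.
have rof_row (a : 'rV[int]_k) (b : 'rV[int]_n) :
    real_of (row_mx a b) = row_mx (real_of a) (real_of b) :> 'rV[R]_(k + n).
  by rewrite /real_of map_row_mx.
exists (r + r')%N, (fun i => match fintype.split i with inl j => row_mx (v j) (w j) | inr j => row_mx 0 (u j) end).
have sumE (c : 'I_(r + r') -> R) : \sum_(i < r + r') c i *: real_of
    match fintype.split i with inl j => row_mx (v j) (w j) | inr j => row_mx 0 (u j) end =
    row_mx (\sum_i c (lshift r' i) *: real_of (v i))
      (\sum_i c (lshift r' i) *: real_of (w i) + \sum_i c (rshift r i) *: real_of (u i)) :> 'rV[R]_(k + n).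
  rewrite big_split_ord/=.
  under eq_bigr => i _ do rewrite (unsplitK (inl i)) rof_row scale_row_mx.
  under [X in _ + X]eq_bigr => i _ do rewrite (unsplitK (inr i)) rof_row scale_row_mx real_of0 scaler0.
  by rewrite !sum_row_mx add_row_mx [X in _ + X](big1 _ _ _) ?addr0.
have PhiE (c : 'I_r -> R) : (forall i, 0 <= c i) ->
    Phi (\sum_i c i *: real_of (v i)) = \sum_i c i *: real_of (w i).
  move=> c0; rewrite PhiA; last by rewrite sE; exists c.
  rewrite mulmx_suml; apply: eq_bigr => i _; rewrite -scalemxAl -PhiA ?wE//.
  exact: cone_gen sE i.
apply/seteqP; split=> y /=.
  move=> /twistP[]; rewrite {1}sE {1}tE => -[c c0 cE] [d d0 dE].
  exists (fun i => match fintype.split i with inl j => c j | inr j => d j end).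
    by move=> i; case: (fintype.split i).
  rewrite sumE -(hsubmxK y) cE /=; congr row_mx.
    by apply: eq_bigr => i _; rewrite (unsplitK (inl i)).
  transitivity (\sum_i c i *: real_of (w i) + \sum_i d i *: real_of (u i) : 'rV[R]_n).
    by rewrite -dE cE PhiE// addrCA subrr addr0.
  congr (_ + _); apply: eq_bigr => i _; first by rewrite (unsplitK (inl i)).
  by rewrite (unsplitK (inr i)).
move=> [c c0 ->]; rewrite sumE; apply/twist_row; rewrite PhiE//.
rewrite addrAC subrr add0r; split; [rewrite sE|rewrite tE].
  by exists (fun i => c (lshift r' i)).
by exists (fun i => c (rshift r i)).
Qed.

Hypotheses (fanB : fan SB) (fanF : fan SF) (PhiP : conewise_linear SB Phi).

Lemma twisted_productP K : twisted_product SB Phi SF K <->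
  exists s t, [/\ SB s, SF t & K = twist s t].
Proof.
by split=> [[s Ss [t St <-]]|[s [t [Ss St ->]]]]; [exists s, t|exists s => //; exists t].
Qed.

Let lin s : SB s -> exists A : 'M[R]_(k, n), forall x, s x -> Phi x = x *m A.
Proof. by move=> Ss; have [_ /(_ s Ss)[]] := PhiP. Qed.

Let B0 s : SB s -> s 0. Proof. by move=> Ss; exact: rational_cone0 (fan_cone fanB Ss). Qed.
Let F0 t : SF t -> t 0. Proof. by move=> St; exact: rational_cone0 (fan_cone fanF St). Qed.

Lemma fan_twisted_product : fan (twisted_product SB Phi SF).
Proof.
have [finB [s0 Ss0] cB fB iB] := fanB; have [finF [t0 St0] cF fF iF] := fanF.
split.
- have -> : twisted_product SB Phi SF = (fun st : set 'rV[R]_k * set 'rV[R]_n => twist st.1 st.2) @` (SB `*` SF).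
    apply/seteqP; split=> K.
      by move=> /twisted_productP[s [t [Ss St ->]]]; exists (s, t).
    by move=> [[s t] [/= Ss St] <-]; apply/twisted_productP; exists s, t.
  exact: finite_image (finite_setX finB finF).
- by exists (twist s0 t0); apply/twisted_productP; exists s0, t0.
- move=> K /twisted_productP[s [t [Ss St ->]]]; apply: rational_cone_twist.
  + exact: lin.
  + by have [_ /(_ s Ss)[]] := PhiP.
  + exact: cB.
  + exact: cF.
- move=> K f /twisted_productP[s [t [Ss St ->]]].
  move=> /(twist_face (lin Ss) (B0 Ss) (F0 St))[s' [t' [fs ft ->]]].
  by apply/twisted_productP; exists s', t'; split=> //; [exact: fB fs|exact: fF ft].
- move=> K K' /twisted_productP[s [t [Ss St ->]]] /twisted_productP[s' [t' [Ss' St' ->]]].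
  have [f1 f1'] := iB _ _ Ss Ss'; have [f2 f2'] := iF _ _ St St'.
  rewrite twistI; split; apply: face_twist => //; solve [exact: lin|exact: B0|exact: F0].
Qed.

Lemma rays_span_twisted_product : rays_span SB -> rays_span SF ->
  rays_span (twisted_product SB Phi SF).
Proof.
move=> spanB spanF; have zB := fan_zero fanB spanB; have zF := fan_zero fanF spanF.
have Phi0 : Phi 0 = 0 by have [A ->//] := lin zB; rewrite mul0mx.
move=> x; have [r [c [w [wP xE]]]] := spanB (lsubmx x).
(* The lifted rays of the base already contribute to the fibre component; the rays of [SF] supply
   the remainder. *)
have [r' [d [u [uP yE]]]] := spanF (rsubmx x - \sum_i c i *: Phi (w i)).
exists (r + r')%N, (fun i => match fintype.split i with inl j => c j | inr j => d j end),
  (fun i => match fintype.split i with inl j => row_mx (w j) (Phi (w j)) | inr j => row_mx 0 (u j) end).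
split.
  move=> i; case: (fintype.split i) => j.
    (* Rays of [SB] are lifted to the graph using the zero cone of [SF], rays of [SF] are placed
       over the zero cone of [SB]. *)
    have [s [Ss [v v0 sE] sw]] := wP j; exists (twist s [set 0]); split.
    - by apply/twisted_productP; exists s, [set 0].
    - have sv : s v by rewrite sE; exists 1; rewrite ?scale1r.
      exists (row_mx v (Phi v)).
        apply: contra v0 => /eqP/(congr1 lsubmx); rewrite row_mxKl linear0 => ->.
        exact: eqxx.
      have [A PhiA] := lin Ss; apply/seteqP; split=> y.
        move=> /twistP[sy /eqP]; rewrite subr_eq0 => /eqP yr; move: (sy); rewrite {1}sE => -[a a0 ya].
        exists a => //; rewrite -(hsubmxK y) yr scale_row_mx -ya; congr row_mx.
        by rewrite PhiA// ya -scalemxAl -PhiA.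
      move=> [a a0 ->]; rewrite scale_row_mx; apply/twist_row.
      have sa : s (a *: v) by rewrite sE; exists a.
      by split=> //=; rewrite (PhiA _ sa) -scalemxAl -PhiA// subrr.
    - by apply/twist_row; split=> //=; rewrite subrr.
  have [t [St [v v0 tE] tu]] := uP j; exists (twist [set 0] t); split.
  - by apply/twisted_productP; exists [set 0], t.
  - exists (row_mx 0 v).
      apply: contra v0 => /eqP/(congr1 rsubmx); rewrite row_mxKr linear0 => ->.
      exact: eqxx.
    apply/seteqP; split=> y.
      move=> /twistP[/= y0]; rewrite y0 Phi0 subr0 tE => -[a a0 ya]; exists a => //.
      by rewrite -(hsubmxK y) y0 ya scale_row_mx scaler0.
    move=> [a a0 ->]; rewrite scale_row_mx scaler0; apply/twist_row; split=> //.
    by rewrite Phi0 subr0 tE; exists a.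
  - by apply/twist_row; split=> //; rewrite Phi0 subr0.
rewrite big_split_ord/=.
under eq_bigr => i _ do rewrite (unsplitK (inl i)) scale_row_mx.
under [X in _ + X]eq_bigr => i _ do rewrite (unsplitK (inr i)) scale_row_mx scaler0.
rewrite !sum_row_mx add_row_mx -xE -yE [X in _ + X](big1 _ _ _) ?addr0// addrCA subrr addr0.
by rewrite hsubmxK.
Qed.

End TwistedFan.

(** * The cone-wise linear map determined by the sections *)

Section TwistMap.
Context {R : realType} {k n : nat}.
Variables (SB : set (set 'rV[R]_k)) (M : set 'rV[R]_k -> 'M[int]_(n, k)).
Hypothesis fanB : fan SB.
Hypothesis perp : forall s t m' v, SB s -> SB t -> s v -> t v ->
  wt v (m' *m M s) = wt v (m' *m M t).

(** The map on cocharacters dual to m' -> - m' N on characters. *)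
Definition minus_tr (N : 'M[int]_(n, k)) : 'M[R]_(k, n) := - (map_mx intr N)^T.

Lemma real_of_mulmx (m' : 'rV[int]_n) (N : 'M[int]_(n, k)) :
  real_of (m' *m N) = real_of m' *m map_mx intr N :> 'rV[R]_k.
Proof. exact: map_mxM. Qed.

Lemma wt_minus_tr x N m' : wt (x *m minus_tr N) m' = - wt x (m' *m N).
Proof.
by rewrite /wt pairing_mulmx linearN/= trmxK mulmxN pairingNl real_of_mulmx.
Qed.

Lemma wt_ext (h : nat) (x y : 'rV[R]_h) : (forall m, wt x m = wt y m) -> x = y.
Proof.
move=> H; apply/rowP => j.
have E (z : 'rV[R]_h) : wt z (delta_mx 0 j) = z 0 j.
  rewrite /wt /pairing (bigD1 j)//= !mxE !eqxx mul1r big1 ?addr0// => i /negPf ij.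
  by rewrite !mxE ij andbF mul0r.
by rewrite -!E.
Qed.

(** Any cone containing [x] may be chosen, because of [perp]; off the support the value is 0. *)
Definition twist_map (x : 'rV[R]_k) : 'rV[R]_n :=
  if pselect (exists s, SB s /\ s x) is left H then x *m minus_tr (M (projT1 (cid H))) else 0.

Lemma twist_mapE s x : SB s -> s x -> twist_map x = x *m minus_tr (M s).
Proof.
move=> Ss sx; rewrite /twist_map; case: pselect => [H|[]]; last by exists s.
case: cid => t /= [St tx]; apply: wt_ext => m'.
by rewrite !wt_minus_tr (perp m' St Ss).
Qed.

Lemma twist_map_conewise_linear : conewise_linear SB twist_map.
Proof.
have [finB _ _ _ _] := fanB; split.
  apply: within_bigcup_continuous => // s Ss; first exact: closed_rational_cone (fan_cone fanB Ss).
  have H : {in s, (fun x => x *m minus_tr (M s)) =1 twist_map}.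
    by move=> x /set_mem sx; rewrite (twist_mapE Ss).
  apply: (subspace_eq_continuous H); apply: continuous_subspaceT.
  exact: continuous_mulmx.
move=> s Ss; split; first by exists (minus_tr (M s)) => x; exact: twist_mapE.
move=> v sv; exists (- (v *m (M s)^T)); rewrite (twist_mapE Ss sv) real_ofN mulmxN.
by congr (- _); rewrite /real_of map_mxM map_trmx.
Qed.

(** Pairing (m, m') with (x, Phi x + y) gives the pairing of m - m' N with x plus that of m' with y,
    and x and y range over [s] and [t] independently. *)
Lemma dual_twist (Phi : 'rV[R]_k -> 'rV[R]_n) s t N m m' : s 0 -> t 0 ->
  (forall x, s x -> Phi x = x *m minus_tr N) ->
  dual_monoid (twist Phi s t) (row_mx m m') <-> dual_monoid s (m - m' *m N) /\ dual_monoid t m'.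
Proof.
move=> s0 t0 PhiE.
have wtE x y : wt (row_mx x y) (row_mx m m') = wt x m + wt y m'.
  by rewrite /wt /real_of map_row_mx pairing_row.
have wtPhi x : s x -> wt (Phi x) m' = - wt x (m' *m N) by move=> /PhiE ->; exact: wt_minus_tr.
split=> [H|[sm tm] w /twistP[sw tw]].
  split=> x sx; rewrite -/(wt _ _).
    have := H (row_mx x (Phi x)); rewrite -/(wt _ _) wtE wtPhi// -wtB; apply.
    by apply/twist_row; rewrite subrr.
  have := H (row_mx 0 x); rewrite -/(wt _ _) wtE /wt pairing0r add0r; apply.
  by apply/twist_row; rewrite PhiE// mul0mx subr0.
rewrite -/(wt _ _) -(hsubmxK w) wtE.
have := sm _ sw; have := tm _ tw; rewrite -!/(wt _ _) wtB.
have -> : wt (rsubmx w - Phi (lsubmx w)) m' = wt (rsubmx w) m' - wt (Phi (lsubmx w)) m'.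
  by rewrite /wt pairingDr pairingNr.
rewrite wtPhi//; lra.
Qed.

End TwistMap.

(** * Charts of the twisted product as products of charts *)

Section Join.
Context {R : realType} {k n : nat}.
Variables (s : set 'rV[R]_k) (t : set 'rV[R]_n) (K : set 'rV[R]_(k + n)) (N : 'M[int]_(n, k)).
Hypothesis dualK : forall m m', dual_monoid K (row_mx m m') <-> dual_monoid s (m - m' *m N) /\ dual_monoid t m'.

Let dualKu u : dual_monoid K u <-> dual_monoid s (lsubmx u - rsubmx u *m N) /\ dual_monoid t (rsubmx u).
Proof. by rewrite -{1}(hsubmxK u). Qed.

Section JoinPoint.
Variables (b : aff_toric s) (y : aff_toric t).

Let val (u : 'rV[int]_(k + n)) : R[i] := b (lsubmx u - rsubmx u *m N) * y (rsubmx u).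

Fact aff_join0 : val 0 = 1.
Proof. by rewrite /val !linear0 mul0mx subr0 !aff_val0 mulr1. Qed.

Fact aff_joinD u u' : dual_monoid K u -> dual_monoid K u' -> val (u + u') = val u * val u'.
Proof.
move=> /dualKu[su tu] /dualKu[su' tu']; rewrite /val !linearD/= mulmxDl opprD addrACA.
by rewrite (aff_valD b su su') (aff_valD y tu tu') mulrACA.
Qed.

Fact aff_join_out u : ~ dual_monoid K u -> val u = 0.
Proof.
move=> Ku; rewrite /val; have [su|su] := pselect (dual_monoid s (lsubmx u - rsubmx u *m N)).
  by rewrite (aff_val_out y) ?mulr0// => tu; apply: Ku; apply/dualKu.
by rewrite (aff_val_out b)// mul0r.
Qed.

(** U_K = U_s x U_t, in the coordinates sheared by N *)
Definition aff_join : aff_toric K := AffToric aff_join0 aff_joinD aff_join_out.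

Lemma aff_joinE m m' : aff_join (row_mx m m') = b (m - m' *m N) * y m'.
Proof. by rewrite /= /val row_mxKl row_mxKr. Qed.

End JoinPoint.

Section SplitPoint.
Variable w : aff_toric K.

Let dual1 m : dual_monoid K (row_mx m 0) <-> dual_monoid s m.
Proof.
by rewrite dualK mul0mx subr0; split=> [[]//|sm]; split=> //; exact: dual_monoid0.
Qed.

Let dual2 m' : dual_monoid K (row_mx (m' *m N) m') <-> dual_monoid t m'.
Proof.
by rewrite dualK subrr; split=> [[]//|sm]; split=> //; exact: dual_monoid0.
Qed.

Fact aff_split1_0 : w (row_mx 0 0) = 1.
Proof. by rewrite row_mx0 aff_val0. Qed.

Fact aff_split1_D m m' : dual_monoid s m -> dual_monoid s m' ->
  w (row_mx (m + m') 0) = w (row_mx m 0) * w (row_mx m' 0).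
Proof.
by move=> sm sm'; rewrite -aff_valD ?dual1// add_row_mx addr0.
Qed.

Fact aff_split1_out m : ~ dual_monoid s m -> w (row_mx m 0) = 0.
Proof. by move=> sm; apply: aff_val_out; rewrite dual1. Qed.

Definition aff_split1 : aff_toric s :=
  AffToric (aff_val := fun m => w (row_mx m 0)) aff_split1_0 aff_split1_D aff_split1_out.

Fact aff_split2_0 : w (row_mx (0 *m N) 0) = 1.
Proof. by rewrite mul0mx row_mx0 aff_val0. Qed.

Fact aff_split2_D m m' : dual_monoid t m -> dual_monoid t m' ->
  w (row_mx ((m + m') *m N) (m + m')) = w (row_mx (m *m N) m) * w (row_mx (m' *m N) m').
Proof.
by move=> sm sm'; rewrite -aff_valD ?dual2// add_row_mx mulmxDl.
Qed.

Fact aff_split2_out m : ~ dual_monoid t m -> w (row_mx (m *m N) m) = 0.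
Proof. by move=> sm; apply: aff_val_out; rewrite dual2. Qed.

(** The exponents (m' N, m') are those whose base component m - m' N vanishes, so this is the
    projection to the fibre in sheared coordinates. *)
Definition aff_split2 : aff_toric t :=
  AffToric (aff_val := fun m => w (row_mx (m *m N) m)) aff_split2_0 aff_split2_D aff_split2_out.

Lemma aff_splitK : aff_join aff_split1 aff_split2 = w.
Proof.
apply: aff_eq => u; rewrite -(hsubmxK u) => Ku.
rewrite aff_joinE /=.
have [su tu] := (dualK _ _).1 Ku.
rewrite -aff_valD ?dual1 ?dual2// add_row_mx subrK add0r.
by [].
Qed.

End SplitPoint.

Lemma aff_joinK1 b y : aff_split1 (aff_join b y) = b.
Proof.
apply: aff_eq => m sm; transitivity (aff_join b y (row_mx m 0)) => //.
by rewrite aff_joinE mul0mx subr0 aff_val0 mulr1.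
Qed.

Lemma aff_joinK2 b y : aff_split2 (aff_join b y) = y.
Proof.
apply: aff_eq => m sm; transitivity (aff_join b y (row_mx (m *m N) m)) => //.
by rewrite aff_joinE subrr aff_val0 mul1r.
Qed.

Lemma aff_split1_morphism : morphism aff_split1.
Proof. by apply: morphism_to_aff => [|m sm]; [exact: openT|exact: aff_char_regfun]. Qed.

Lemma aff_split2_morphism : morphism aff_split2.
Proof. by apply: morphism_to_aff => [|m sm]; [exact: openT|exact: aff_char_regfun]. Qed.

Lemma aff_join_morphism (Z : funSpaceType R[i]) (U : set Z) (f : Z -> aff_toric s) (g : Z -> aff_toric t) :
  open U -> (forall m, regfun U (fun z => f z m)) -> (forall m, regfun U (fun z => g z m)) ->
  morphism_on U (fun z => aff_join (f z) (g z)).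
Proof.
move=> oU rf rg; apply: morphism_to_aff => // u _.
exact: regfunM (rf _) (rg _).
Qed.

End Join.

(** * The associated bundle *)

Section ChartInverse.
Context {R : realType}.
Local Notation C := R[i].

Lemma aff_coord_regfun k (s : set 'rV[R]_k) (Z : funSpaceType C) (U : set Z) (f : Z -> aff_toric s) m :
  morphism_on U f -> regfun U (fun z => f z m).
Proof.
move=> mf; have rm : regfun setT (fun x : aff_toric s => x m) by exact: aff_char_regfun.
by have := mf _ _ rm; rewrite preimage_setT setIT.
Qed.

(** The point [x0] provides values off the chart domain, so that local coordinates become a total
    function. *)
Lemma chart_inverse k (S : set (set 'rV[R]_k)) (fanS : fan S) s (Ss : S s) (x0 : aff_toric s) :
  exists w : toric_variety S -> aff_toric s,
    morphism_on (chart_dom Ss) w /\ forall q, chart_dom Ss q -> chart Ss (w q) = q.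
Proof.
have /choice[w wE] : forall q, exists x, chart_dom Ss q -> chart Ss x = q.
  move=> q; have [[y _ <-]|nq] := pselect (chart_dom Ss q); first by exists y.
  by exists x0.
exists w; split=> //; apply: morphism_to_aff.
  exact: (@chart_dom_open _ _ S fanS s Ss).
move=> m sm; apply: (toric_char_regfun fanS) => x; congr (aff_val _ m).
by apply: (chart_inj fanS (Ss := Ss)); apply: wE; exists x.
Qed.

Lemma aff_act1 k (s : set 'rV[R]_k) (x : aff_toric s) : aff_act torus_one x = x.
Proof. by apply: aff_eq => m _ /=; rewrite mul1r. Qed.

Lemma aff_actM k (s : set 'rV[R]_k) t u (x : aff_toric s) :
  aff_act (torus_mul t u) x = aff_act t (aff_act u x).
Proof. by apply: aff_eq => m _ /=; rewrite mulrA. Qed.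

End ChartInverse.

Section AssociatedBundle.
Context {R : realType} {k n : nat}.
Local Notation C := R[i].
Variables (SB : set (set 'rV[R]_k)) (SF : set (set 'rV[R]_n)).
Hypotheses (fanB : fan SB) (fanF : fan SF) (zeroB : SB [set 0]).
Variables (E : funSpaceType C) (p : E -> toric_variety SB) (act : torus R n -> E -> E).
Hypothesis bundleE : principal_bundle p act.
Variables (sec : forall s : set 'rV[R]_k, aff_toric s -> E) (e0 : torus R k -> E) (M : set 'rV[R]_k -> 'M[int]_(n, k)).
Hypothesis secP : forall s (Ss : SB s), morphism (@sec s) /\ forall y, p (sec y) = chart Ss y.
Hypothesis pe0 : forall t, p (e0 t) = chart zeroB t.
Hypothesis secM : forall s (Ss : SB s) (s0 : s 0) t m',
  tdiff act (e0 t) (sec (tor s0 t)) m' = t (m' *m M s).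

Let perp s t m' v : SB s -> SB t -> s v -> t v -> wt v (m' *m M s) = wt v (m' *m M t).
Proof. by move=> Ss St; exact: (transition_perp fanB bundleE secP pe0 secM Ss St m'). Qed.

Let Phi := twist_map SB M.
Let Sigma := twisted_product SB Phi SF.
Let XF : funSpaceType C := toric_variety SF.
Let A : funSpaceType C := assoc_bundle act (@toric_act R n SF).
Let PhiE s x (Ss : SB s) (sx : s x) : Phi x = x *m minus_tr (M s) := twist_mapE perp Ss sx.
Let B0 s : SB s -> s 0. Proof. by move=> Ss; exact: rational_cone0 (fan_cone fanB Ss). Qed.
Let F0 t : SF t -> t 0. Proof. by move=> St; exact: rational_cone0 (fan_cone fanF St). Qed.

Let linPhi : conewise_linear SB Phi := twist_map_conewise_linear fanB perp.
Let fanS : fan Sigma := fan_twisted_product fanB fanF linPhi.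

Let SK s t (Ss : SB s) (St : SF t) : Sigma (twist Phi s t).
Proof. by apply/twisted_productP; exists s, t. Qed.

Let dualK s t (Ss : SB s) (St : SF t) m m' : dual_monoid (twist Phi s t) (row_mx m m') <->
  dual_monoid s (m - m' *m M s) /\ dual_monoid t m'.
Proof. by apply: dual_twist; [exact: B0|exact: F0|move=> x; exact: PhiE]. Qed.

Let p_act t e : p (act t e) = p e. Proof. by case: bundleE. Qed.
Let act1 e : act torus_one e = e. Proof. by case: bundleE => _ []. Qed.
Let actM t u e : act (torus_mul t u) e = act t (act u e). Proof. by case: bundleE => _ []. Qed.
Let tact1 x : @toric_act R n SF torus_one x = x.
Proof. by case: (toric_regular_action fanF). Qed.
Let tactM t u x : @toric_act R n SF (torus_mul t u) x = toric_act t (toric_act u x).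
Proof. by case: (toric_regular_action fanF). Qed.

Let torus_mulV (t : torus R n) : torus_mul (torus_inv t) t = torus_one.
Proof. by apply: torus_eq => m; rewrite torus_mulE torus_invE mulVf// torus_neq0. Qed.

Local Notation orbit := (@diag_orbit R n E XF act (@toric_act R n SF)).

Let orbit_refl u : orbit u u.
Proof. by exists torus_one; rewrite act1 tact1; case: u. Qed.

Let orbit_sym u v : orbit u v -> orbit v u.
Proof.
move=> [t ->]; exists (torus_inv t) => /=.
by rewrite -actM -tactM torus_mulV act1 tact1; case: u.
Qed.

Let orbit_trans u v w : orbit u v -> orbit v w -> orbit u w.
Proof. by move=> [t ->] [t' ->]; exists (torus_mul t' t); rewrite /= actM tactM. Qed.

(** Local coordinates (b, y) on the associated bundle, given by the section over U_s; [lam] takes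
    the same coordinates to the toric variety of the twisted product. *)
Let kap s t (Ss : SB s) (St : SF t) (b : aff_toric s) (y : aff_toric t) : A :=
  to_quot orbit (sec b, chart St y).

Let lam s t (Ss : SB s) (St : SF t) (b : aff_toric s) (y : aff_toric t) : toric_variety Sigma :=
  chart (SK Ss St) (aff_join (dualK Ss St) b y).

(** Each orbit has a representative whose first component lies on the section; moving there
    multiplies the fibre coordinate by the inverse difference. *)
Let kap_point e x s t (Ss : SB s) (St : SF t) b y : p e = chart Ss b -> x = chart St y ->
  to_quot orbit (e, x) = kap Ss St b (aff_act (torus_inv (tdiff act (sec b) e)) y).
Proof.
move=> pe ->; apply/(to_quotP orbit_refl orbit_sym orbit_trans).
have [_ psec] := secP Ss; have pse : p (sec b) = p e by rewrite psec pe.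
exists (torus_inv (tdiff act (sec b) e)).
rewrite -(toric_act_chart fanF); congr pair.
by rewrite -{2}(tdiffP bundleE pse) -actM torus_mulV act1.
Qed.

Let kap_surj (c : A) : exists s t (Ss : SB s) (St : SF t) b y, c = kap Ss St b y.
Proof.
rewrite -(of_quotK c); case: (of_quot c) => e x.
have [s [Ss [b pe]]] := toric_variety_case (p e); have [t [St [y xE]]] := toric_variety_case x.
exists s, t, Ss, St, b; rewrite (kap_point pe xE); by eexists.
Qed.

Let lam_surj (c : toric_variety Sigma) : exists s t (Ss : SB s) (St : SF t) b y, c = lam Ss St b y.
Proof.
have [K [SK' [w ->]]] := toric_variety_case c.
have /twisted_productP[s [t [Ss St KE]]] := SK'; subst K.
exists s, t, Ss, St, (aff_split1 (dualK Ss St) w), (aff_split2 (dualK Ss St) w).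
by rewrite /lam aff_splitK; exact: chart_irrelevance.
Qed.

Section Compare.
Variables (s1 s2 : set 'rV[R]_k) (t1 t2 : set 'rV[R]_n).
Variables (Ss1 : SB s1) (Ss2 : SB s2) (St1 : SF t1) (St2 : SF t2).

Let K := twist Phi s1 t1 `&` twist Phi s2 t2.

Let dualI m m' : dual_monoid K (row_mx m m') <->
  dual_monoid (s1 `&` s2) (m - m' *m M s2) /\ dual_monoid (t1 `&` t2) m'.
Proof.
rewrite /K twistI; apply: dual_twist.
- by split; exact: B0.
- by split; exact: F0.
- by move=> x [_]; exact: PhiE.
Qed.

Let join_restr2 z1 z2 : aff_join (dualK Ss2 St2) (aff_restr (@subIsetr _ s1 s2) z1)
    (aff_restr (@subIsetr _ t1 t2) z2) = aff_restr (@subIsetr _ _ _) (aff_join dualI z1 z2).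
Proof.
apply: aff_eq => u; rewrite -(hsubmxK u) => Ku.
have [su tu] := (dualK Ss2 St2 _ _).1 Ku.
by rewrite [RHS]aff_restrE// !aff_joinE !aff_restrE.
Qed.

(** The intersection is sheared by [M s2]. Passing from [M s1] to [M s2] changes the value at (m,
    m') by the character m' (M s1 - M s2), which translation of the fibre coordinate by [w]
    supplies. *)
Let join_restr1 (z1 : aff_toric (s1 `&` s2)) z2 (w : torus R n) :
  (forall m', w m' = z1 (m' *m (M s1 - M s2))) ->
  aff_join (dualK Ss1 St1) (aff_restr (@subIsetl _ s1 s2) z1)
    (aff_act w (aff_restr (@subIsetl _ t1 t2) z2)) = aff_restr (@subIsetl _ _ _) (aff_join dualI z1 z2).
Proof.
move=> wE; apply: aff_eq => u; rewrite -(hsubmxK u) => Ku.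
have [su tu] := (dualK Ss1 St1 _ _).1 Ku.
rewrite [RHS]aff_restrE// !aff_joinE aff_restrE//.
transitivity (z1 (lsubmx u - rsubmx u *m M s1) *
  (w (rsubmx u) * aff_restr (@subIsetl _ t1 t2) z2 (rsubmx u))) => //.
rewrite aff_restrE// wE mulrA -aff_valD.
- by rewrite mulmxBr addrA subrK.
- exact: dual_monoid_sub (@subIsetl _ _ _) _ su.
- exact: (transition_dual fanB bundleE secP pe0 secM Ss1 Ss2).
Qed.

Let u12 (z : aff_toric (s1 `&` s2)) : torus R n :=
  tdiff act (sec (aff_restr (@subIsetr _ s1 s2) z)) (sec (aff_restr (@subIsetl _ s1 s2) z)).

Let u12E z m' : u12 z m' = z (m' *m (M s1 - M s2)).
Proof. exact: (transition fanB bundleE secP pe0 secM Ss1 Ss2). Qed.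

Let sec12 z : sec (aff_restr (@subIsetl _ s1 s2) z) = act (u12 z) (sec (aff_restr (@subIsetr _ s1 s2) z)).
Proof. exact: (transition_act fanB bundleE secP Ss1 Ss2). Qed.

(** Both equalities mean that [b1] and [b2] come from one point z1 of the overlap in the base, that
    [y2] comes from one point of the overlap in the fibre, and that [y1] comes from the same point
    translated by the transition function at z1. *)
Lemma kap_lam b1 b2 y1 y2 : kap Ss1 St1 b1 y1 = kap Ss2 St2 b2 y2 <-> lam Ss1 St1 b1 y1 = lam Ss2 St2 b2 y2.
Proof.
have chartB := chart_eqP fanB; have chartF := chart_eqP fanF; have chartS := chart_eqP fanS.
have [_ psec1] := secP Ss1; have [_ psec2] := secP Ss2.
split.
  move=> /(to_quotP orbit_refl orbit_sym orbit_trans)[t stE].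
  have se : sec b2 = act t (sec b1) := congr1 fst stE.
  have ye : chart St2 y2 = toric_act t (chart St1 y1) := congr1 snd stE.
  have : chart Ss1 b1 = chart Ss2 b2 by rewrite -psec1 -psec2 se p_act.
  move=> /chartB[z1 [b1E b2E]].
  move: ye; rewrite (toric_act_chart fanF) => /esym/chartF[z2 [y1E y2E]].
  (* The inverse appears because [t] carries the first section to the second, while [u12] carries
     the second to the first. *)
  have tE : t = torus_inv (u12 z1).
    apply: (act_free bundleE (e := sec b1)); rewrite -se b1E sec12 -actM torus_mulV act1.
    by rewrite b2E.
  have y1E' : y1 = aff_act (u12 z1) (aff_restr (@subIsetl _ t1 t2) z2).
    rewrite -y1E tE -aff_actM; have -> : torus_mul (u12 z1) (torus_inv (u12 z1)) = torus_one.
      by apply: torus_eq => m; rewrite torus_mulE torus_invE mulfV// torus_neq0.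
    by rewrite aff_act1.
  apply/chartS; exists (aff_join dualI z1 z2); rewrite b1E y1E' b2E y2E; split.
    by apply: join_restr1 => m'; exact: u12E.
  exact: join_restr2.
move=> /chartS[z [w1E w2E]].
pose z1 := aff_split1 dualI z; pose z2 := aff_split2 dualI z.
have zE : z = aff_join dualI z1 z2 by rewrite aff_splitK.
rewrite zE -(join_restr1 z2 (u12E z1)) in w1E; rewrite zE -join_restr2 in w2E.
have := congr1 (aff_split1 (dualK Ss1 St1)) w1E; rewrite !aff_joinK1 => b1E.
have := congr1 (aff_split2 (dualK Ss1 St1)) w1E; rewrite !aff_joinK2 => y1E.
have := congr1 (aff_split1 (dualK Ss2 St2)) w2E; rewrite !aff_joinK1 => b2E.
have := congr1 (aff_split2 (dualK Ss2 St2)) w2E; rewrite !aff_joinK2 => y2E.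
apply/(to_quotP orbit_refl orbit_sym orbit_trans)/orbit_sym; exists (u12 z1).
rewrite b1E b2E sec12; congr pair.
rewrite y1E y2E -!(toric_act_chart fanF); congr toric_act.
by apply/chartF; exists z2.
Qed.

End Compare.

(** By [kap_lam], sending [kap] to [lam] with the same coordinates is well defined in both
    directions. The map from the toric variety is tested on its affine charts, the map from the
    bundle on E x X_F before passing to the quotient. *)
Lemma assoc_bundle_isomorphism : exists f : A -> toric_variety Sigma, isomorphism f.
Proof.
have /choice[f fP] (c : A) : exists d : toric_variety Sigma, forall s t (Ss : SB s) (St : SF t) b y,
    c = kap Ss St b y -> d = lam Ss St b y.
  have [s [t [Ss [St [b [y cE]]]]]] := kap_surj c; exists (lam Ss St b y).
  by move=> s' t' Ss' St' b' y'; rewrite cE => /kap_lam.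
have /choice[g gP] (d : toric_variety Sigma) : exists c : A, forall s t (Ss : SB s) (St : SF t) b y,
    d = lam Ss St b y -> c = kap Ss St b y.
  have [s [t [Ss [St [b [y dE]]]]]] := lam_surj d; exists (kap Ss St b y).
  by move=> s' t' Ss' St' b' y'; rewrite dE => /kap_lam.
exists f; split; last first.
  exists g; split.
  - move=> V h rh; rewrite setTI; apply/toric_regfunP => K SK'.
    have /twisted_productP[s [t [Ss St KE]]] := SK'; subst K.
    have mk : morphism (fun w : aff_toric (twist Phi s t) =>
        (sec (aff_split1 (dualK Ss St) w), chart St (aff_split2 (dualK Ss St) w)) : vprod E XF).
      apply: morphism_pair.
        exact: morphism_comp (@aff_split1_morphism _ _ _ _ _ _ _ (dualK Ss St)) (secP Ss).1.
      exact: morphism_comp (@aff_split2_morphism _ _ _ _ _ _ _ (dualK Ss St)) (@chart_morphism _ _ _ _ _).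
    have rq : regfun (to_quot orbit @^-1` V : set (vprod E XF)) (h \o to_quot orbit) by exact: rh.
    have := mk _ _ rq; rewrite setTI; congr regfun; last first.
      apply/funext => w; rewrite /= (gP _ s t Ss St (aff_split1 (dualK Ss St) w) (aff_split2 (dualK Ss St) w))//.
      by rewrite /lam aff_splitK; exact: chart_irrelevance.
    apply/funext => w; rewrite /preimage /=.
    rewrite (gP _ s t Ss St (aff_split1 (dualK Ss St) w) (aff_split2 (dualK Ss St) w))//.
    by rewrite /lam aff_splitK; exact: chart_irrelevance.
  - move=> c; have [s [t [Ss [St [b [y cE]]]]]] := kap_surj c.
    by rewrite (fP _ _ _ _ _ _ _ cE) (gP _ _ _ _ _ _ _ erefl).
  - move=> d; have [s [t [Ss [St [b [y dE]]]]]] := lam_surj d.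
    by rewrite (gP _ _ _ _ _ _ _ dE) (fP _ _ _ _ _ _ _ erefl).
have mF : morphism ((f \o to_quot orbit) : vprod E XF -> toric_variety Sigma).
  apply: morphism_to_toric => -[e x] _.
  have [s [Ss [b pe]]] := toric_variety_case (p e); have [t [St [y xE]]] := toric_variety_case x.
  have [bb [mbb bbE]] := chart_inverse fanB Ss b; have [yy [myy yyE]] := chart_inverse fanF St y.
  have mp : morphism p by case: bundleE.
  have mpe : morphism (p \o (fst : vprod E XF -> E)) := morphism_comp (@vprod_fst _ E XF) mp.
  pose V : set (vprod E XF) := (p \o fst) @^-1` chart_dom Ss `&` snd @^-1` chart_dom St.
  have o1 : open ((p \o (fst : vprod E XF -> E)) @^-1` chart_dom Ss : set (vprod E XF)).
    exact: morphism_open mpe (@chart_dom_open _ _ _ fanB _ Ss).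
  have o2 : open (snd @^-1` chart_dom St : set (vprod E XF)).
    exact: morphism_open (@vprod_snd _ E XF) (@chart_dom_open _ _ _ fanF _ St).
  have oV : open V by exact: openI.
  have mb : morphism_on V (fun u : vprod E XF => bb (p u.1)).
    have := morphism_on_comp mpe mbb; rewrite setTI; apply: morphism_on_sub => //.
    exact: subIsetl.
  have my : morphism_on V (fun u : vprod E XF => yy u.2).
    have := morphism_on_comp (@vprod_snd _ E XF) myy; rewrite setTI; apply: morphism_on_sub => //.
    exact: subIsetr.
  have mfst : morphism_on V (fst : vprod E XF -> E).
    by apply: morphism_on_sub (@vprod_fst _ E XF).
  (* The torus element from the section to the given point of E; its inverse acts on the fibre
     coordinate as in [kap_point]. *)
  pose th (u : vprod E XF) := tdiff act (sec (bb (p u.1))) u.1.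
  have rth m : regfun V (fun u => th u m).
    apply: (tdiff_regfun bundleE) => //; first exact: morphism_comp mb (secP Ss).1.
    by move=> u [/= /bbE pu _]; rewrite (secP Ss).2 pu.
  exists V, (twist Phi s t), (SK Ss St),
    (fun u => aff_join (dualK Ss St) (bb (p u.1)) (aff_act (torus_inv (th u)) (yy u.2))).
  split=> //.
  - split; first by exists b.
    by exists y.
  - apply: aff_join_morphism => // m; first exact: aff_coord_regfun mb.
    apply: regfunM; last exact: aff_coord_regfun my.
    apply: (@regfun_eq _ _ _ _ (fun u => (th u m)^-1)); first by move=> u _; exact: torus_invE.
    by apply: regfun_inv => // u _; exact: torus_neq0.
  - move=> [e' x'] [/= /bbE pe' /yyE x'E].
    by rewrite (fP _ _ _ _ _ _ _ (kap_point (esym pe') (esym x'E))).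
(* Regularity on the quotient is regularity of the pull-back, by definition. *)
by move=> V h rh; have := mF V h rh; rewrite !setTI.
Qed.

End AssociatedBundle.

Theorem theorem2p8 (R : realType) (k n : nat)
    (SB : set (set 'rV[R]_k)) (SF : set (set 'rV[R]_n))
    (fanB : fan SB) (fanF : fan SF) (spanB : rays_span SB) (spanF : rays_span SF)
    (E : funSpaceType R[i]) (p : E -> toric_variety SB)
    (act : torus R n -> E -> E) (bundleE : principal_bundle p act) :
  exists Phi : 'rV[R]_k -> 'rV[R]_n,
    [/\ conewise_linear SB Phi,
        fan (twisted_product SB Phi SF),
        rays_span (twisted_product SB Phi SF) &
        exists actT : torus R (k + n) ->
            assoc_bundle act (@toric_act R n SF) ->
            assoc_bundle act (@toric_act R n SF),
          is_toric_variety (twisted_product SB Phi SF) actT].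
Proof.
have zB := fan_zero fanB spanB.
have [sec [e0 [M [secP [pe0 secM]]]]] := normalized_sections fanB zB bundleE.
have perp s t m' v : SB s -> SB t -> s v -> t v -> wt v (m' *m M s) = wt v (m' *m M t).
  by move=> Ss St; exact: (transition_perp fanB bundleE secP pe0 secM Ss St m').
have linPhi := twist_map_conewise_linear fanB perp.
have fanS := fan_twisted_product fanB fanF linPhi.
exists (twist_map SB M); split=> //; first exact: rays_span_twisted_product.
have [f [mf [g [mg fK gK]]]] := assoc_bundle_isomorphism fanB fanF bundleE secP pe0 secM.
have [tact1 tactM mtact] := toric_regular_action fanS.
(* The action is transported from the toric variety along [f], which is thereby equivariant. *)
exists (fun t x => g (toric_act t (f x))); split; last first.
  by exists f; split; [split=> //; exists g|move=> t x; rewrite gK].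
split.
- by move=> x; rewrite tact1 fK.
- by move=> t u x; rewrite gK tactM.
have m1 : morphism (fun v : vprod (torus R (k + n) : funSpaceType R[i])
    (assoc_bundle act (@toric_act R n SF)) => (v.1, f v.2)
    : vprod (torus R (k + n) : funSpaceType R[i]) (toric_variety (twisted_product SB (twist_map SB M) SF))).
  apply: morphism_pair; first exact: vprod_fst.
  exact: morphism_comp (@vprod_snd _ _ _) mf.
exact: morphism_comp (morphism_comp m1 mtact) mg.
Qed.
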